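(* Let $d$ be a semi-metric of negative type and let $0<\rho_0<\rho^*<\rho_1<1$. Suppose the single change-point alternative $H_A$ holds: $y_1,\dots,y_n$ are independent, $y_1,\dots,y_{\tau^*}\sim F_0$ and $y_{\tau^*+1},\dots,y_n\sim F_1$ with $\tau^*=\lceil n\rho^*\rceil$ and $F_0\ne F_1$. Suppose there is a constant $M>0$ such that $\widetilde k(y_i,y_i)\le M^2$ almost surely for all $i\in\{1,\dots,n\}$. (a) If $\mu_0,\mu_1$ are fixed (do not depend on $n$) and $\mu_0\ne\mu_1$, then for any $x>0$ and any $n$, with probability at least $1-22e^{-x}$, $$\left|\frac{\widehat\tau-\tau^*}n\right|\le\frac{C_1}n\left(\frac{M^2x}{\|\mu_0-\mu_1\|_{\mathcal H}^2}+\frac{M^4x}{\|\mu_0-\mu_1\|_{\mathcal H}^4}\right),$$ where $\widehat\tau$ is the change point estimated using $S_1$, and $C_1$ is a constant depending (only) on $\rho_0,\rho_1,\rho^*$. (b) If $\mu_0=\mu_1$, and $v_0,v_1$ are fixed (do not depend on $n$) with $v_0\ne v_1$, then for any $x>0$, when $n$ is sufficiently large, with probability at least $1-16e^{-x}$, $$\left|\frac{\widehat\tau-\tau^*}n\right|\le\frac{C_2}n\left(\frac{M^4x}{|v_0-v_1|^2}+\frac{M^2x}{|v_0-v_1|}\right),$$ where $\widehat\tau$ is the change point estimated using $S_2$, and $C_2$ is a constant depending (only) on $\rho_0,\rho_1,\rho^*$.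
   Context: Observations $y_1,\dots,y_n$ take values in a measurable space $\mathcal X$. A (measurable) function $d:\mathcal X\times\mathcal X\to\mathbb R$ is a semi-metric of negative type if (1) $d(y,y')=0$ iff $y=y'$; (2) $d(y,y')=d(y',y)$; (3) $\sum_{i,j=1}^m c_ic_jd(x_i,x_j)\le 0$ for all $m\ge2$, $x_1,\dots,x_m\in\mathcal X$, and $c_1,\dots,c_m\in\mathbb R$ with $\sum_ic_i=0$. Centered kernel: for any $y_0\in\mathcal X$ put $k^{(y_0)}(y,y')=\frac12[d(y,y_0)+d(y',y_0)-d(y,y')]$ and, with $Y,Y'\sim F_0$ independent, $\widetilde k(y,y')=k^{(y_0)}(y,y')-\mathbb E k^{(y_0)}(y,Y)-\mathbb E k^{(y_0)}(Y,y')+\mathbb E k^{(y_0)}(Y,Y')$ (this does not depend on $y_0$). The eigen-expansion with respect to $F_0$ is $\widetilde k(y,y')=\sum_{l\ge1}\lambda_l\psi_l(y)\psi_l(y')$, where $\int\widetilde k(y,y')\psi_l(y)\,dF_0(y)=\lambda_l\psi_l(y')$ and $\int\psi_l\psi_{l'}\,dF_0=\delta_{l,l'}$. The feature map is $\phi(y)=(\lambda_1^{1/2}\psi_1(y),\lambda_2^{1/2}\psi_2(y),\dots)^\top\in\mathcal H$, where $\mathcal H$ is a Hilbert (sequence) space with $\langle\phi(y),\phi(y')\rangle_{\mathcal H}=\sum_l\phi_l(y)\phi_l(y')=\widetilde k(y,y')$. For $j=0,1$: $\mu_j=\mathbb E_{Y\sim F_j}\phi(Y)$ and $v_j=\mathbb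 E_{Y\sim F_j}\|\phi(Y)-\mu_j\|_{\mathcal H}^2$. Statistics: for $1<t<n-1$ let $\bar d_{A(t)}=\frac1{t(n-t)}\sum_{i\le t<j}d(y_i,y_j)$, $\bar d_{B_1(t)}=\frac1{t(t-1)}\sum_{i\ne j;\,i,j\le t}d(y_i,y_j)$, $\bar d_{B_2(t)}=\frac1{(n-t)(n-t-1)}\sum_{i\neq j;\,i,j>t}d(y_i,y_j)$, $T_1(t)=\bar d_{A(t)}-\frac12\bar d_{B_1(t)}-\frac12\bar d_{B_2(t)}$ and $T_2(t)=|\bar d_{B_1(t)}-\bar d_{B_2(t)}|$. With $n_0=\lceil n\rho_0\rceil$, $n_1=\lceil n\rho_1\rceil$, $$S_1=\max_{n_0\le t\le n_1}\frac{t(n-t)}nT_1(t),\qquad S_2=\max_{n_0\le t\le n_1}\frac1{2\widehat s_n}\sqrt{\frac{t(n-t)}n}\,T_2(t),$$ where $\widehat s_n\ge0$, $\widehat s_n^2=\frac1n\sum_{i=1}^n(\bar d_i)^2-(\bar d)^2$, $\bar d_i=\frac1n\sum_{j=1}^nd(y_i,y_j)$, $\bar d=\frac1{n^2}\sum_{i,j=1}^nd(y_i,y_j)$ (statistics are considered for $n$ such that all terms are defined). The change point estimated using $S_1$ (resp. $S_2$) is a value $\widehat\tau\in\{n_0,\dots,n_1\}$ of $t$ at which the maximum defining $S_1$ (resp. $S_2$) is attained. *)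

(* Defs.v *)
From HB Require Import structures.
From mathcomp Require Import all_boot all_order all_algebra.
From mathcomp Require Import all_classical all_reals all_analysis.

Set Implicit Arguments.
Unset Strict Implicit.
Unset Printing Implicit Defensive.
Import Order.TTheory GRing.Theory Num.Theory.
Import numFieldNormedType.Exports.

Local Open Scope classical_set_scope.
Local Open Scope ring_scope.

(* Measurability is with respect to the product sigma-algebra.  The points
   [x i] are not required to be distinct. *)
Definition negative_type_semimetric {R : realType} {disp : measure_display}
    {X : measurableType disp} (d : X -> X -> R) : Prop :=
  [/\ measurable_fun [set: X * X] (fun p : X * X => d p.1 p.2),
      forall y y', d y y' = 0 <-> y = y',
      forall y y', d y y' = d y' y
    & forall m (x : 'I_m -> X) (c : 'I_m -> R), (2 <= m)%N ->
        \sum_(i < m) c i = 0 ->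
        \sum_(i < m) \sum_(j < m) c i * c j * d (x i) (x j) <= 0].

Section Kernel.
Context {R : realType} {disp : measure_display} {X : measurableType disp}.
Variables (d : X -> X -> R) (F0 : probability X R).

Definition base_kernel (y0 y y' : X) : R :=
  2^-1 * (d y y0 + d y' y0 - d y y').

(* The last term is the expectation at an independent pair [(Y, Y')] of
   F0-distributed points, whose joint law is the product measure. *)
Definition centered_kernel (y0 y y' : X) : R :=
  base_kernel y0 y y'
  - (\int[F0]_z base_kernel y0 y z)%R
  - (\int[F0]_z base_kernel y0 z y')%R
  + (\int[(F0 \x F0)%E]_p base_kernel y0 p.1 p.2)%R.

End Kernel.

Section FeatureMap.
Context {R : realType} {disp : measure_display} {X : measurableType disp}.

(* Expansions with finitely many terms (forced when L2(F0) has finite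
   dimension) are padded with [lambda l = 0]; this is why orthonormality is only
   asked of the eigenfunctions with a nonzero eigenvalue.  The eigen-equations
   are stated in the extended reals, so that a finite right-hand side also
   asserts integrability.  The expansion holds at every pair of points, not just
   F0-almost everywhere: it is also evaluated at points drawn from F1. *)
Definition eigen_expansion (F0 : probability X R) (k : X -> X -> R)
    (lambda : nat -> R) (psi : nat -> X -> R) : Prop :=
  [/\ forall l, 0 <= lambda l,
      forall l, measurable_fun [set: X] (psi l),
      forall l y', (\int[F0]_y (k y y' * psi l y)%:E = (lambda l * psi l y')%:E)%E,
      forall l l', lambda l != 0 -> lambda l' != 0 ->
        (\int[F0]_y (psi l y * psi l' y)%:E = (l == l')%:R%:E)%E
    & forall y y',
        series (fun l => lambda l * psi l y * psi l y') @ \oo --> k y y'].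

Definition feature (lambda : nat -> R) (psi : nat -> X -> R) (y : X) : nat -> R :=
  fun l => Num.sqrt (lambda l) * psi l y.

(* Norm of the sequence space l2; only meaningful for square-summable [u]. *)
Definition hnorm (u : nat -> R) : R :=
  Num.sqrt (fine (\sum_(0 <= l <oo) ((u l) ^+ 2)%:E)%E).

(* Expectation of an l2-valued map, taken coordinatewise. *)
Definition feature_mean (F : probability X R) (phi : X -> nat -> R) : nat -> R :=
  fun l => (\int[F]_y phi y l)%R.

Definition feature_var (F : probability X R) (phi : X -> nat -> R) : R :=
  (\int[F]_y (hnorm (fun l => phi y l - feature_mean F phi l) ^+ 2))%R.

End FeatureMap.

(* Indices start at 0: the observation numbered i in 1..n is [y (i - 1)], so that
   "i <= t" reads [i < t] and "i > t" reads [t <= i]. *)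
Section Statistics.
Context {R : realType} {X : Type}.
Variables (d : X -> X -> R) (n : nat) (y : 'I_n -> X).

Definition dbarA (t : nat) : R :=
  (t * (n - t))%N%:R^-1 *
  \sum_(i < n | (i < t)%N) \sum_(j < n | (t <= j)%N) d (y i) (y j).

Definition dbarB1 (t : nat) : R :=
  (t * (t - 1))%N%:R^-1 *
  \sum_(i < n | (i < t)%N) \sum_(j < n | (j < t)%N && (i != j)) d (y i) (y j).

Definition dbarB2 (t : nat) : R :=
  ((n - t) * (n - t - 1))%N%:R^-1 *
  \sum_(i < n | (t <= i)%N) \sum_(j < n | (t <= j)%N && (i != j)) d (y i) (y j).

Definition T1 (t : nat) : R := dbarA t - 2^-1 * dbarB1 t - 2^-1 * dbarB2 t.

Definition T2 (t : nat) : R := `|dbarB1 t - dbarB2 t|.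

Definition dbar_row (i : 'I_n) : R := n%:R^-1 * \sum_(j < n) d (y i) (y j).

Definition dbar : R :=
  (n ^ 2)%N%:R^-1 * \sum_(i < n) \sum_(j < n) d (y i) (y j).

Definition shat : R :=
  Num.sqrt (n%:R^-1 * \sum_(i < n) dbar_row i ^+ 2 - dbar ^+ 2).

Definition scan1 (t : nat) : R := (t * (n - t))%N%:R / n%:R * T1 t.

(* If [shat = 0] this is 0 for every t, and then every t is a maximizer. *)
Definition scan2 (t : nat) : R :=
  (2 * shat)^-1 * Num.sqrt ((t * (n - t))%N%:R / n%:R) * T2 t.

End Statistics.

(* ceil(n * rho); the integer is nonnegative when [rho] is. *)
Definition nceil {R : realType} (n : nat) (rho : R) : nat :=
  `|Num.ceil (n%:R * rho)|%N.

Definition attains_max {R : realType} (f : nat -> R) (a b t : nat) : Prop :=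
  (a <= t <= b)%N /\ forall s, (a <= s <= b)%N -> f s <= f t.

Section Sampling.
Context {R : realType} {dispX dispO : measure_display}
  {X : measurableType dispX} {Omega : measurableType dispO}
  {P : probability Omega R}.

Definition mutually_independent n (y : 'I_n -> {RV P >-> X}) : Prop :=
  forall (J : {set 'I_n}) (A : 'I_n -> set X),
    (forall i, measurable (A i)) ->
    P (\bigcap_(i in [set` J]) (y i @^-1` A i)) =
    (\prod_(i in J) P (y i @^-1` A i))%E.

(* Laws are compared on measurable sets only: a measure carries unspecified
   values on the other sets. *)
Definition same_law (F G : set X -> \bar R) : Prop :=
  forall A, measurable A -> F A = G A.

Definition single_change_point n (y : 'I_n -> {RV P >-> X}) (tau : nat)
    (F0 F1 : probability X R) : Prop :=
  [/\ mutually_independent y,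
      forall i : 'I_n, (i < tau)%N -> same_law (distribution P (y i)) F0,
      forall i : 'I_n, (tau <= i)%N -> same_law (distribution P (y i)) F1
    & ~ same_law F0 F1].

End Sampling.

(* Main.v *)
Require Import Defs.
From HB Require Import structures.
From mathcomp Require Import all_boot all_order all_algebra.
From mathcomp Require Import all_classical all_reals all_analysis.
From mathcomp Require Import measurable_realfun.
From mathcomp Require Import ring lra zify.

Set Implicit Arguments.
Unset Strict Implicit.
Unset Printing Implicit Defensive.
Import Order.TTheory GRing.Theory Num.Theory.
Import numFieldNormedType.Exports.

Local Open Scope classical_set_scope.
Local Open Scope ring_scope.

(** Let U(t) be n/(t(n-t)) times the squared norm of the CUSUM of the features
    at t.  Without noise U decreases at least linearly away from the change
    point tau, by a multiple of |t - tau| |mu0 - mu1|^2, and the noise enters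
    only through a global bound on the random walk of the centered features and
    through its increments from tau, projected on mu0 - mu1.  Both are
    controlled by the maximal inequality for the supermartingale
    cosh(lambda |W_k|) / cosh(lambda b)^k, whose one-step estimate does not
    depend on the dimension.  One can therefore keep the first L coordinates of
    the feature map and let L tend to infinity only in the comparison of the
    scan statistics at tau and at the maximizer.

    For S_1, the scan statistic differs from U by at most 2 M^2.  For S_2, the
    square of the scan statistic is, up to the factor 1/s_n^2, the same CUSUM
    energy for the scalars |phi - mu|^2, whose means are v0 and v1, with the
    CUSUM perturbed by an error of order M^2 x that comes from the walk of the
    vectors phi - mu; and s_n = 0 would make all row averages equal, which the
    jump from v0 to v1 forbids. *)

(** The radius must be free of any logarithm of n, which excludes a union bound over t. Two facts
    replace it. Every noise term in U(tau) - U(t) carries a factor |t - tau|, so it competes with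
    the signal at the signal's own scale. And for a barrier beta j, linear in the number j of steps,
    one fixed lambda proportional to beta makes the exponent at step j proportional to j, so that a
    single maximal inequality covers all t beyond a given distance. The quadratic part of the noise
    needs no probabilistic control of its increments: they are of order b |t - tau|
    deterministically and get multiplied by the global bound on the walk. The exceptional sets
    depend on L and need not be nested, so no single one serves all L; but off a set of the same
    probability the estimates hold for infinitely many L, which suffices to compare limits. The
    claim is vacuous for x <= 1/2; otherwise M^2 <= 2 M^2 x lets errors of order M^2 be absorbed
    into the radius. The failure probabilities obtained are 6 exp(-x) and 8 exp(-x). *)

(** * Expectations of products of independent factors *)

Section Independence.
Context {R : realType} {dispO : measure_display} {Omega : measurableType dispO}.
Variable P : probability Omega R.

Lemma bounded_integrable (f : Omega -> R) (b : R) :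
  measurable_fun [set: Omega] f -> (forall w, `|f w| <= b) ->
  P.-integrable [set: Omega] (EFin \o f).
Proof.
move=> mf fb; apply: measurable_bounded_integrable => //.
  by rewrite -ge0_fin_numE// fin_num_measure.
exists b; split; first by rewrite num_real.
by move=> z bz w _ /=; exact: le_trans (fb w) (ltW bz).
Qed.

(** The law of [(u, v)] agrees with the product law on rectangles, hence everywhere, and by Fubini
    the inner integral of [g] vanishes. The target of [u] is arbitrary so that [u] may carry a whole
    past. *)
Lemma independent_mean0 {dispT dispX : measure_display}
    {T : measurableType dispT} {X : measurableType dispX}
    (u : {RV P >-> T}) (v : {RV P >-> X})
    (f : T -> R) (g : X -> R) (a b : R) :
  (forall A B, measurable A -> measurable B ->
     P ((u @^-1` A) `&` (v @^-1` B)) = (P (u @^-1` A) * P (v @^-1` B))%E) ->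
  measurable_fun [set: T] f -> measurable_fun [set: X] g ->
  (forall t, `|f t| <= a) -> (forall z, `|g z| <= b) ->
  (\int[P]_w (g (v w))%:E = 0)%E ->
  (\int[P]_w (f (u w) * g (v w))%:E = 0)%E.
Proof.
move=> uv mf mg fa gb g0.
pose h w : T * X := (u w, v w).
have mh : measurable_fun [set: Omega] h by apply: measurable_fun_pair.
pose H : {mfun Omega >-> (T * X)%type} := [the {mfun _ >-> _} of mfun_Sub (mem_set mh)].
have HE : (H : Omega -> T * X) = h by [].
have mfg : measurable_fun [set: T * X] (fun p : T * X => f p.1 * g p.2).
  by apply: measurable_funM; apply: measurableT_comp.
have ifg : P.-integrable [set: Omega]
    ((fun p : T * X => (f p.1 * g p.2)%:E) \o h).
  apply: (@bounded_integrable _ (a * b)) => /=.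
    apply: measurable_funM; first exact: (measurableT_comp mf).
    exact: (measurableT_comp mg).
  by move=> w; rewrite normrM ler_pM.
transitivity (\int[distribution P H]_p (f p.1 * g p.2)%:E)%E.
  rewrite integral_distribution //; first exact/measurable_EFinP.
have E := @product_measure_unique _ _ _ _ R (distribution P u) (distribution P v)
  (distribution P H).
have {}E : forall A, measurable A ->
    (distribution P u \x distribution P v)%E A = distribution P H A.
  by apply: E => A B mA mB; exact: uv.
rewrite (eq_measure_integral (distribution P u \x distribution P v)%E); last first.
  by move=> A mA _; exact/esym/E.
rewrite -integral12_prod_meas1 /=; last first.
  apply: measurable_bounded_integrable => //.
    by rewrite [X in (X < _)%E]E// -ge0_fin_numE// fin_num_measure.
  exists (a * b); split; first by rewrite num_real.
  by move=> z bz w _ /=; apply: le_trans (ltW bz); rewrite normrM ler_pM.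
rewrite /fubini_F /= -[RHS](integral0 (distribution P u) setT).
apply: eq_integral => t _.
under eq_integral do rewrite EFinM.
rewrite integralZl//; last first.
  apply: measurable_bounded_integrable => //.
    by rewrite -ge0_fin_numE// fin_num_measure.
  exists b; split; first by rewrite num_real.
  by move=> z bz w _ /=; exact: le_trans (gb w) (ltW bz).
rewrite integral_distribution//.
- by rewrite /comp g0 mule0.
- exact/measurable_EFinP.
- apply: (@bounded_integrable _ b) => //=; exact: measurableT_comp.
Qed.

End Independence.

(** * The sigma-algebra generated by part of the sample *)

Section Past.
Context {R : realType} {dispX dispO : measure_display}
  {X : measurableType dispX} {Omega : measurableType dispO}
  {P : probability Omega R}.
Variables (n : nat) (y : 'I_n -> {RV P >-> X}).
Implicit Types (J K : {set 'I_n}).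

(** These sets form a pi-system on which mutual independence can be read off directly. *)
Definition cylinder (J : {set 'I_n}) : set (set Omega) :=
  [set E | exists2 A : 'I_n -> set X, (forall i, measurable (A i)) &
     E = \bigcap_(i in [set` J]) (y i @^-1` A i)].

(** Same carrier as [Omega], coarser sigma-algebra: measurability with respect to the past becomes
    [measurable_fun] with a cast on the domain. *)
Definition past (J : {set 'I_n}) := g_sigma_algebraType (cylinder J).

Lemma cylinder_measurable J : cylinder J `<=` measurable.
Proof.
move=> E [A mA ->]; apply: fin_bigcap_measurable => // i _.
by rewrite -[X in measurable X]setTI; exact: measurable_funP.
Qed.

Lemma past_measurable J (A : set Omega) :
  measurable (A : set (past J)) -> measurable A.
Proof. by apply: smallest_sub; [exact: sigma_algebra_measurable|exact: cylinder_measurable]. Qed.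

Lemma past_id_measurable J : measurable_fun [set: Omega] (idfun : Omega -> past J).
Proof. by move=> _ A mA; rewrite setTI preimage_id; exact: past_measurable mA. Qed.

Lemma past_fun_measurable J d' (T : measurableType d') (f : Omega -> T) :
  measurable_fun [set: past J] (f : past J -> T) -> measurable_fun [set: Omega] f.
Proof. by move=> mf; exact: (measurableT_comp mf (@past_id_measurable J)). Qed.

Lemma past_coord_measurable J i : i \in J ->
  measurable_fun [set: past J] (y i : past J -> X).
Proof.
move=> iJ _ B mB; rewrite setTI; apply: sub_sigma_algebra.
exists (fun j => if j == i then B else setT).
  by move=> j; case: ifP.
apply/seteqP; split=> w /=; first by move=> By j _; case: eqP => [->|].
by move=> /(_ i iJ) /=; rewrite eqxx.
Qed.

Lemma cylinder_mono J K : J \subset K -> cylinder J `<=` cylinder K.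
Proof.
move=> JK E [A mA ->]; exists (fun i => if i \in J then A i else setT).
  by move=> i; case: ifP.
apply/seteqP; split=> w /=.
  by move=> H i _; case: ifP => // iJ; exact: H.
by move=> H i iJ; have := H i (fintype.subsetP JK _ iJ); rewrite /= (_ : i \in J = true).
Qed.

Lemma past_mono J K d' (T : measurableType d') (f : Omega -> T) : J \subset K ->
  measurable_fun [set: past J] (f : past J -> T) ->
  measurable_fun [set: past K] (f : past K -> T).
Proof.
move=> JK mf _ B mB; have := mf measurableT B mB; rewrite !setTI.
by apply: sub_smallest2r; [exact: smallest_sigma_algebra|exact: cylinder_mono].
Qed.

Hypothesis y_indep : mutually_independent y.

(** Dynkin's argument: the past events independent of a fixed event of [y i] form a lambda-system
    containing the cylinders. *)
Lemma past_independent J i (A : set Omega) (B : set X) : i \notin J ->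
  measurable (A : set (past J)) -> measurable B ->
  P (A `&` (y i @^-1` B)) = (P A * P (y i @^-1` B))%E.
Proof.
move=> iJ mA mB.
have mE : measurable (y i @^-1` B).
  by rewrite -[X in measurable X]setTI; exact: measurable_funP.
have PP E : measurable E -> P E = (fine (P E))%:E by move=> mF; rewrite fineK // fin_num_measure.
move: A mA; apply: (@dynkin_induction _ (past J) (cylinder J)
  (fun A => P (A `&` (y i @^-1` B)) = (P A * P (y i @^-1` B))%E)) => //.
- move=> E F [A mA ->] [C mC ->]; exists (fun i => A i `&` C i).
    by move=> j; exact: measurableI.
  by rewrite -bigcapI.
- by rewrite setTI probability_setT mul1e.
- move=> _ [A mA ->].
  have := @y_indep (i |: J)%SET (fun j => if j == i then B else A j) _.
  rewrite big_setU1//= eqxx => E.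
  rewrite [RHS]muleC.
  have -> : P (\bigcap_(j in [set` J]) (y j @^-1` A j)) =
      (\prod_(j in J) P (y j @^-1` (if j == i then B else A j)))%E.
    rewrite y_indep//; apply: eq_bigr => j jJ.
    by case: eqP => // ji; rewrite -ji jJ in iJ.
  rewrite -E; last by move=> j; case: ifP.
  congr (P _); apply/seteqP; split => w /=.
    move=> [H Bw] j /=; rewrite !inE => /orP[/eqP ->|jJ]; first by rewrite eqxx.
    by case: eqP => [ji|_]; [rewrite -ji jJ in iJ|exact: H].
  move=> H; split; last by have := H i; rewrite /= eqxx setU11; apply.
  move=> j jJ; have := H j; rewrite /= setU1r// => /(_ isT).
  by case: eqP => // ji; rewrite -ji jJ in iJ.
- move=> S mS ind.
  have {}mS : measurable (S : set Omega) by exact: past_measurable mS.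
  rewrite setIC -setDE measureD//; last by rewrite -ge0_fin_numE// fin_num_measure.
  have indC : P ((y i @^-1` B) `&` S) = (P S * P (y i @^-1` B))%E.
    by rewrite setIC; exact: ind.
  rewrite (probability_setC P mS).
  transitivity (P (y i @^-1` B) - P S * P (y i @^-1` B))%E; first by congr (_ - _)%E.
  rewrite (PP _ mS) (PP _ mE).
  by rewrite -[1%E]/(1%:E) -!(EFinM, EFinB) mulrBl mul1r.
- move=> F mF tF ind.
  have {}mF k : measurable (F k : set Omega) by exact: past_measurable (mF k).
  rewrite setI_bigcupl measure_bigcup//; last 2 first.
  + by move=> k _; exact: measurableI.
  + exact: trivIset_setIr.
  rewrite measure_bigcup// muleC (PP _ mE) -nneseriesZl//.
  by apply: eq_eseriesr => k _; rewrite muleC -(PP _ mE); exact: ind.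
Qed.

(** The identity of [Omega], seen as a random element of [past J], plays the role of the first
    variable in [independent_mean0]. *)
Lemma past_mean0 J i (f : Omega -> R) (g : X -> R) (a b : R) : i \notin J ->
  measurable_fun [set: past J] (f : past J -> R) -> measurable_fun [set: X] g ->
  (forall w, `|f w| <= a) -> (forall z, `|g z| <= b) ->
  (\int[P]_w (g (y i w))%:E = 0)%E ->
  (\int[P]_w (f w * g (y i w))%:E = 0)%E.
Proof.
move=> iJ mf mg fa gb g0.
pose u : {mfun Omega >-> past J} :=
  [the {mfun _ >-> _} of mfun_Sub (mem_set (@past_id_measurable J))].
apply: (@independent_mean0 _ _ _ P _ _ (past J) X u (y i) f g a b) => // A B mA mB.
exact: past_independent mA mB.
Qed.

End Past.

Lemma cvgn_le {R : realType} (f g : nat -> R) (a b : R) :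
  f n @[n --> \oo] --> a -> g n @[n --> \oo] --> b -> (forall n, f n <= g n) -> a <= b.
Proof. by move=> fa gb fg; apply: (@ler_cvg_to _ _ _ R f g a b fa gb); exact: nearW. Qed.

(** * Convexity and growth of the hyperbolic cosine *)

Section HyperbolicCosine.
Context {R : realType}.
Implicit Types (a b s t u v x : R) (m N : nat).

Definition cosh x := (expR x + expR (- x)) / 2.
Definition sinh x := (expR x - expR (- x)) / 2.
(** Written in powers of [x ^+ 2] because every term is then increasing and convex in [x ^+ 2]. *)
Definition cosh_partial N x : R := \sum_(0 <= m < N) (x ^+ 2) ^+ m / (m.*2)`!%:R.

Lemma cosh_partialE N x :
  cosh_partial N x = (series (exp_coeff x) N.*2 + series (exp_coeff (- x)) N.*2) / 2.
Proof.
elim: N => [|N IH]; first by rewrite /cosh_partial /series /= !big_nil addr0 mul0r.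
have seriesSS (g : R^nat) k : series g k.+2 = series g k + g k + g k.+1.
  by rewrite /series /= !big_nat_recr.
have -> : cosh_partial N.+1 x = cosh_partial N x + x ^+ N.*2 / (N.*2)`!%:R.
  by rewrite /cosh_partial big_nat_recr//= -exprM mul2n.
rewrite IH doubleS !seriesSS.
set A := series _ _; set B := series _ _.
have ecE z k : exp_coeff z k = z ^+ k / k`!%:R :> R by [].
rewrite !ecE.
have e2 : (- x) ^+ N.*2 = x ^+ N.*2 by rewrite -mul2n !exprM sqrrN.
rewrite ![_ ^+ N.*2.+1]exprS e2.
move: (x ^+ N.*2) (_`!%:R^-1) (_`!%:R^-1) => z f f'.
by field.
Qed.

Lemma cvg_cosh_partial x : cosh_partial N x @[N --> \oo] --> cosh x.
Proof.
have cd : (double n @[n --> \oo] --> \oo)%classic.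
  by apply/cvgnyPge => A; exists A => //= k /= Ak; rewrite (leq_trans Ak)// -addnn leq_addr.
have ce (z : R) : series (exp_coeff z) N.*2 @[N --> \oo] --> expR z.
  by apply: (cvg_comp _ _ cd); exact: is_cvg_series_exp_coeff.
under eq_fun do rewrite cosh_partialE.
apply: (@cvgM _ _ _ _ _ (cst 2^-1)); last exact: cvg_cst.
apply: cvgD; exact: ce.
Qed.

(** By induction; the defect of each step is t (1 - t) times [(a - b) * (a ^+ m - b ^+ m)], a
    product of factors of the same sign. *)
Lemma expr_convex m a b t : 0 <= a -> 0 <= b -> 0 <= t <= 1 ->
  (t * a + (1 - t) * b) ^+ m <= t * a ^+ m + (1 - t) * b ^+ m.
Proof.
move=> a0 b0 /andP[t0 t1]; have t1' : 0 <= 1 - t by rewrite subr_ge0.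
elim: m => [|m IH]; first by rewrite !expr0 !mulr1 addrC subrK.
rewrite exprS; apply: (@le_trans _ _ ((t * a + (1 - t) * b) * (t * a ^+ m + (1 - t) * b ^+ m))).
  by rewrite ler_wpM2l// addr_ge0// mulr_ge0.
have P : 0 <= (a - b) * (a ^+ m - b ^+ m).
  have [ab|/ltW ab] := leP a b.
    by rewrite mulr_le0// subr_le0// lerXn2r.
  by rewrite mulr_ge0// subr_ge0// lerXn2r.
rewrite -subr_ge0 !exprS.
rewrite [X in _ <= X](_ : _ = t * (1 - t) * ((a - b) * (a ^+ m - b ^+ m))); last by ring.
by rewrite mulr_ge0// mulr_ge0.
Qed.

(** As a function of the square, cosh has a power series with nonnegative coefficients; the
    inequality holds term by term and passes to the limit. *)
Lemma cosh_le_convex v a b t : 0 <= t <= 1 ->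
  v ^+ 2 <= t * a ^+ 2 + (1 - t) * b ^+ 2 ->
  cosh v <= t * cosh a + (1 - t) * cosh b.
Proof.
move=> t01 vab; have /andP[t0 t1] := t01.
have cR : t * cosh_partial N a + (1 - t) * cosh_partial N b @[N --> \oo] -->
    t * cosh a + (1 - t) * cosh b.
  by apply: cvgD; apply: cvgM; [exact: cvg_cst|exact: cvg_cosh_partial
    |exact: cvg_cst|exact: cvg_cosh_partial].
apply: (cvgn_le (@cvg_cosh_partial v) cR) => N; rewrite !mulr_sumr -big_split /=; apply: ler_sum => m _.
rewrite !mulrA -mulrDl ler_wpM2r// ?invr_ge0//.
apply: le_trans (expr_convex m (sqr_ge0 a) (sqr_ge0 b) t01).
by rewrite lerXn2r// nnegrE ?sqr_ge0// addr_ge0// mulr_ge0// ?sqr_ge0// subr_ge0.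
Qed.

(** Termwise, from m! <= (2m)!. This exponent is the source of the factor 4 in the tail conditions
    on the walk. *)
Lemma cosh_le_expR_sqr b : cosh b <= expR (b ^+ 2).
Proof.
apply: (cvgn_le (@cvg_cosh_partial b) (@is_cvg_series_exp_coeff R (b ^+ 2))) => N; apply: ler_sum => m _; rewrite /exp_coeff /=.
apply: ler_wpM2l; first exact/exprn_ge0/sqr_ge0.
have h : (m`!%:R : R) <= (m.*2)`!%:R.
  rewrite ler_nat; apply: (@homo_leq _ factorial leq) => //; [exact: leq_trans| |].
    by move=> k; rewrite factS leq_pmull.
  by rewrite -addnn leq_addr.
by rewrite lef_pV2// posrE ltr0n fact_gt0.
Qed.

Lemma cosh0 : cosh 0 = 1.
Proof. by rewrite /cosh oppr0 expR0; field. Qed.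

Lemma cosh_gt0 x : 0 < cosh x.
Proof. by rewrite /cosh divr_gt0// addr_gt0// expR_gt0. Qed.

Lemma cosh_ge1 x : 1 <= cosh x.
Proof.
rewrite /cosh ler_pdivlMr// mul1r; have := expR_ge1Dx x; have := expR_ge1Dx (- x); lra.
Qed.

Lemma expR_le_cosh x : expR x / 2 <= cosh x.
Proof. by rewrite /cosh ler_wpM2r// lerDl expR_ge0. Qed.

Lemma cosh_add_sub a b u :
  (1 + u) / 2 * cosh (a + b) + (1 - (1 + u) / 2) * cosh (a - b) =
  cosh a * cosh b + u * (sinh a * sinh b).
Proof.
rewrite /cosh /sinh; have -> : - (a - b) = - a + b by ring.
have -> : - (a + b) = - a - b by ring.
by rewrite !expRD; field.
Qed.

(* The convexity of [s |-> cosh (sqrt s)], applied at the extreme cases of the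
   cosine rule. *)
Lemma cosh_cosine_rule v a b u : `|u| <= 1 ->
  v ^+ 2 <= a ^+ 2 + b ^+ 2 + 2 * (u * (a * b)) ->
  cosh v <= cosh a * cosh b + u * (sinh a * sinh b).
Proof.
rewrite ler_norml => /andP[u1 u2] vab; rewrite -cosh_add_sub.
apply: cosh_le_convex; first by apply/andP; split; lra.
by apply: le_trans vab _; rewrite le_eqVlt; apply/orP; left; apply/eqP; field.
Qed.

End HyperbolicCosine.

(** * The inner product of the first [L] coordinates *)

Section InnerProduct.
Context {R : realType} (L : nat).
Implicit Types (u v w : nat -> R) (c : R).

(** A degenerate form on full sequences: the vectors do not depend on [L], so the same ones can be
    measured at every [L]. *)
Definition dot u v : R := \sum_(l < L) u l * v l.
Definition nrm u : R := Num.sqrt (dot u u).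

Lemma dotC u v : dot u v = dot v u.
Proof. by apply: eq_bigr => l _; rewrite mulrC. Qed.

Lemma dotDl u v w : dot (u + v) w = dot u w + dot v w.
Proof. by rewrite -big_split; apply: eq_bigr => l _; rewrite /= -mulrDl. Qed.

Lemma dotZl c u v : dot (c *: u) v = c * dot u v.
Proof. by rewrite mulr_sumr; apply: eq_bigr => l _; rewrite mulrA. Qed.

Lemma dotNl u v : dot (- u) v = - dot u v.
Proof. by rewrite -scaleN1r dotZl mulN1r. Qed.

Lemma dotBl u v w : dot (u - v) w = dot u w - dot v w.
Proof. by rewrite dotDl dotNl. Qed.

Lemma dotDr u v w : dot w (u + v) = dot w u + dot w v.
Proof. by rewrite dotC dotDl !(dotC _ w). Qed.

Lemma dotZr c u v : dot u (c *: v) = c * dot u v.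
Proof. by rewrite dotC dotZl dotC. Qed.

Lemma dotNr u v : dot u (- v) = - dot u v.
Proof. by rewrite dotC dotNl dotC. Qed.

Lemma dotBr u v w : dot w (u - v) = dot w u - dot w v.
Proof. by rewrite dotDr dotNr. Qed.

Lemma dot0l v : dot 0 v = 0.
Proof. by rewrite /dot big1// => l _; rewrite mul0r. Qed.

Lemma dot_suml I (r : seq I) (Q : pred I) (F : I -> nat -> R) v :
  dot (\sum_(i <- r | Q i) F i) v = \sum_(i <- r | Q i) dot (F i) v.
Proof.
by elim/big_rec2: _ => [|i x z _ <-]; rewrite ?dot0l// dotDl.
Qed.

Lemma dot_ge0 u : 0 <= dot u u.
Proof. by apply: sumr_ge0 => l _; rewrite -expr2 sqr_ge0. Qed.

Lemma nrm_ge0 u : 0 <= nrm u. Proof. exact: sqrtr_ge0. Qed.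

Lemma sqr_nrm u : nrm u ^+ 2 = dot u u.
Proof. by rewrite sqr_sqrtr// dot_ge0. Qed.

Lemma coord_le_nrm u (l : 'I_L) : `|u l| <= nrm u.
Proof.
rewrite -sqrtr_sqr ler_sqrt ?dot_ge0// /dot (bigD1 l)//= expr2 lerDl.
by apply: sumr_ge0 => k _; rewrite -expr2 sqr_ge0.
Qed.

(** Cauchy-Schwarz. Since the form is degenerate, [nrm v = 0] does not give [v = 0] and is treated
    through the coordinates below [L]. *)
Lemma dot_le u v : `|dot u v| <= nrm u * nrm v.
Proof.
have [v0|vn0] := eqVneq (nrm v) 0.
  rewrite /dot big1 ?normr0 ?mulr_ge0 ?nrm_ge0// => l _.
  have := coord_le_nrm v l; rewrite v0 normr_le0 => /eqP ->.
  by rewrite mulr0.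
(* The squared length of this combination is |v|^2 (|u|^2 |v|^2 - (dot u v)^2). *)
have := dot_ge0 (dot v v *: u - dot u v *: v).
rewrite !(dotBl, dotBr, dotZl, dotZr) (dotC v u) -!sqr_nrm => H.
rewrite -(@ler_pXn2r _ 2) ?nnegrE ?mulr_ge0 ?nrm_ge0// exprMn real_normK ?num_real//.
have v2 : 0 < nrm v ^+ 2 by rewrite exprn_gt0// lt_def vn0 nrm_ge0.
rewrite -subr_ge0 -(pmulr_rge0 _ v2).
by apply: le_trans H _; rewrite le_eqVlt; apply/orP; left; apply/eqP; ring.
Qed.

Lemma nrmD u v : nrm (u + v) <= nrm u + nrm v.
Proof.
rewrite -(@ler_pXn2r _ 2) ?nnegrE ?addr_ge0 ?nrm_ge0// sqrrD !sqr_nrm.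
rewrite !(dotDl, dotDr) (dotC v u).
by have := dot_le u v; rewrite ler_norml => /andP[_]; lra.
Qed.

Lemma nrmZ c u : nrm (c *: u) = `|c| * nrm u.
Proof. by rewrite /nrm dotZl dotZr mulrA -expr2 sqrtrM ?sqr_ge0// sqrtr_sqr. Qed.

Lemma nrmN u : nrm (- u) = nrm u.
Proof. by rewrite -scaleN1r nrmZ normrN1 mul1r. Qed.

Lemma nrmB u v : nrm (u - v) <= nrm u + nrm v.
Proof. by rewrite -(nrmN v) nrmD. Qed.

Lemma nrm0 : nrm 0 = 0.
Proof. by rewrite /nrm dot0l sqrtr0. Qed.

Lemma nrm_le u c : 0 <= c -> dot u u <= c ^+ 2 -> nrm u <= c.
Proof. by move=> c0 uc; rewrite -(ger0_norm c0) -sqrtr_sqr ler_sqrt// sqr_ge0. Qed.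

Lemma nrm_sum_le I (r : seq I) (F : I -> nat -> R) c :
  (forall i, nrm (F i) <= c) -> nrm (\sum_(i <- r) F i) <= (size r)%:R * c.
Proof.
move=> Fc; elim: r => [|i r IH]; first by rewrite big_nil nrm0 mul0r.
by rewrite big_cons /= mulrS mulrDl mul1r (le_trans (nrmD _ _))// lerD.
Qed.

Lemma measurable_nrm {d} {T : measurableType d} (f : T -> nat -> R) :
  (forall l, measurable_fun [set: T] (f ^~ l)) ->
  measurable_fun [set: T] (nrm \o f).
Proof.
move=> mf; apply: (measurableT_comp (continuous_measurable_fun (@sqrt_continuous R))
  (f := @Num.sqrt R)).

by apply: measurable_sum => l; apply: measurable_funM.
Qed.

End InnerProduct.

(** * Statements that hold off an event of small probability *)

Section WithProbability.
Context {R : realType} {d : measure_display} {Omega : measurableType d}.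
Variable P : probability Omega R.
Implicit Types (e : R) (Q : Omega -> Prop).

(* [Q] itself need not be measurable. *)
Definition exceptional e Q : Prop :=
  exists B, [/\ measurable B, (P B <= e%:E)%E & forall w, ~ B w -> Q w].

Lemma exceptional_imp e e' Q Q' : e <= e' -> (forall w, Q w -> Q' w) ->
  exceptional e Q -> exceptional e' Q'.
Proof.
move=> ee QQ [B [mB PB QB]]; exists B; split=> // [|w Bw]; last exact/QQ/QB.
by apply: le_trans PB _; rewrite lee_fin.
Qed.

Lemma exceptional_and e e' Q Q' : exceptional e Q -> exceptional e' Q' ->
  exceptional (e + e') (fun w => Q w /\ Q' w).
Proof.
move=> [B [mB PB QB]] [B' [mB' PB' QB']]; exists (B `|` B'); split.
- exact: measurableU.
- by rewrite EFinD (le_trans (measureU2 P mB mB'))// leeD.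
- by move=> w /not_orP[nB nB']; split; [exact: QB|exact: QB'].
Qed.

Lemma exceptional_ae e Q Q' : {ae P, forall w, Q' w} -> exceptional e Q ->
  exceptional e (fun w => Q w /\ Q' w).
Proof.
move=> [N [mN PN QN]] [B [mB PB QB]]; exists (B `|` N); split.
- exact: measurableU.
- by rewrite measureU0.
- move=> w /not_orP[nB nN]; split; first exact: QB.
  by apply: contrapT => nQ; exact/nN/QN.
Qed.

Lemma exceptional_probability e (A : set Omega) : measurable A ->
  exceptional e (fun w => A w) -> ((1 - e)%:E <= P A)%E.
Proof.
move=> mA [B [mB PB AB]].
have /(le_measure P) : ~` B `<=` A by move=> w /AB.
rewrite !inE => /(_ (measurableC mB) mA); apply: le_trans.
by rewrite [X in (_ <= X)%E](probability_setC P mB) EFinB leeB.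
Qed.

(** Reverse Fatou. The points lying in all exceptional sets from some index on form an increasing
    union of intersections [C N], each of probability at most [e]; at any other point [Q] holds
    infinitely often. This removes the truncation at no cost in probability. *)
Lemma exceptional_limsup e (Q : nat -> Omega -> Prop) (L0 : nat) :
  (forall L, (L0 <= L)%N -> exceptional e (Q L)) ->
  exceptional e (fun w => forall N, exists2 L, (N <= L)%N & Q L w).
Proof.
move=> H; have H' L : exceptional e (Q (L + L0)%N) by apply: H; rewrite leq_addl.
pose B L := projT1 (cid (H' L)).
have mB L : measurable (B L) by rewrite /B; case: cid => A [].
have PB L : (P (B L) <= e%:E)%E by rewrite /B; case: cid => A [].
have QB L w : ~ B L w -> Q (L + L0)%N w by rewrite /B; case: cid => A [_ _ QA] /=; exact: QA.
pose C N := \bigcap_(L in [set L | (N <= L)%N]) B L.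
have mC N : measurable (C N) by apply: bigcap_measurable; [exists N => /=|move=> L _; exact: mB].
exists (\bigcup_N C N); split.
- exact: bigcup_measurable.
- have cC : P (C N) @[N --> \oo] --> P (\bigcup_N C N).
    apply: nondecreasing_cvg_mu => //; first exact: bigcup_measurable.
    move=> N M NM; apply/subsetPset => w CN L /= ML; apply: CN => /=.
    exact: leq_trans NM ML.
  rewrite -(cvg_lim _ cC)//; apply: lime_le; first by apply/cvg_ex; eexists; exact: cC.
  apply: nearW => N /=; apply: le_trans (PB N).
  by apply: le_measure; rewrite ?inE//; move=> w; apply => /=.
- move=> w nw N; apply: contrapT => nL; apply: nw; exists N => // L /= NL.
  apply: contrapT => /QB QL; apply: nL; exists (L + L0)%N => //.
  by rewrite (leq_trans NL)// leq_addr.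
Qed.

End WithProbability.

(** Continuous off 0, with the value 0 at 0. It serves the normalized direction of the walk in
    [walk_weight]. *)
Lemma inv_measurable {R : realType} : measurable_fun [set: R] (@GRing.inv R).
Proof.
have -> : @GRing.inv R = fun x => if x == 0 then 0 else x^-1.
  by apply/funext => x; case: eqP => // ->; rewrite invr0.
apply: measurable_fun_if => //; first by apply: measurable_fun_eqr.
rewrite setTI; apply: open_continuous_measurable_fun => //=.
  rewrite [X in open X](_ : _ = [set~ 0]); first exact/closed_openC/accessible_closed_set1/hausdorff_accessible/norm_hausdorff.
  by apply/seteqP; split => x /=; [move=> /eqP|move/eqP/negbTE].
by move=> x; rewrite inE /= => x0; apply: inv_continuous; rewrite x0.
Qed.

(** * The cosh supermartingale and its maximal inequalities *)

Section Walk.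
Context {R : realType} {dispX dispO : measure_display}
  {X : measurableType dispX} {Omega : measurableType dispO}
  {P : probability Omega R}.
Variables (n : nat) (y : 'I_n -> {RV P >-> X}) (L : nat).
Variables (g : 'I_n -> X -> nat -> R) (b : R).
Hypothesis y_indep : mutually_independent y.
Hypothesis b_gt0 : 0 < b.
Hypothesis g_measurable : forall i l, measurable_fun [set: X] (fun z => g i z l).
Hypothesis g_bound : forall i z, nrm L (g i z) <= b.
Hypothesis g_mean0 : forall i (l : 'I_L), (\int[P]_w (g i (y i w) l)%:E = 0)%E.
Implicit Types (s : seq 'I_n) (w : Omega) (lam a : R).

(** Indexed by a list rather than by a time, so that the walk can run forwards or backwards from the
    change point. *)
Definition psum s w : nat -> R := \sum_(i <- s) g i (y i w).

Lemma psum_cons i s w : psum (i :: s) w = psum s w + g i (y i w).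
Proof. by rewrite /psum big_cons addrC. Qed.

Lemma psum_nrm_le s w : nrm L (psum s w) <= (size s)%:R * b.
Proof. exact: nrm_sum_le. Qed.

Lemma psum_coordE s w l : psum s w l = \sum_(i <- s) g i (y i w) l.
Proof. by rewrite /psum; elim/big_rec2: _ => [//|i u v _ <-]. Qed.

Definition pastseq s := past y [set i in s].

Lemma psum_measurable s l :
  measurable_fun [set: pastseq s] ((fun w => psum s w l) : pastseq s -> R).
Proof.
have -> : (fun w => psum s w l) = fun w => \sum_(i <- s) g i (y i w) l.
  by apply/funext => w; exact: psum_coordE.
suff H r : {subset r <= s} -> measurable_fun [set: pastseq s]
    ((fun w => \sum_(i <- r) g i (y i w) l) : pastseq s -> R) by exact: H.
elim: r => [|i r IH] rs.
  rewrite (_ : (fun w => _) = cst 0); first exact: measurable_cst.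
  by apply/funext => w; rewrite big_nil.
rewrite (_ : (fun w => _) =
    (fun w => g i (y i w) l) \+ (fun w => \sum_(j <- r) g j (y j w) l)); last first.
  by apply/funext => w; rewrite big_cons.
apply: measurable_funD; last by apply: IH => j jr; apply: rs; rewrite inE jr orbT.
apply: (measurableT_comp (g_measurable i l)).
by apply: past_coord_measurable; rewrite inE rs// inE eqxx.
Qed.

Lemma nrm_psum_measurable s :
  measurable_fun [set: pastseq s] ((fun w => nrm L (psum s w)) : pastseq s -> R).
Proof. by apply: (@measurable_nrm _ _ _ (pastseq s)) => l; exact: psum_measurable. Qed.

Definition walk_cosh lam s w : R :=
  cosh (lam * nrm L (psum s w)) / cosh (lam * b) ^+ size s.

(* The walk is read with its newest increment at the head of the list.  Freezing
   it once it has passed [a] reduces the maximal inequality to Markov's. *)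
Fixpoint stopped lam a s w : R :=
  if s is i :: r then
    if a <= stopped lam a r w then stopped lam a r w else walk_cosh lam s w
  else walk_cosh lam s w.

Lemma stopped_lt lam a s w : stopped lam a s w < a ->
  stopped lam a s w = walk_cosh lam s w.
Proof. by case: s => //= i s; case: (leP a (stopped lam a s w)) => // h; rewrite ltNge h. Qed.

(** A suffix of the list is an earlier stage of the walk, so a passage above [a] at any stage
    survives to the end. *)
Lemma stopped_ge lam a s1 s2 w : a <= walk_cosh lam s2 w ->
  a <= stopped lam a (s1 ++ s2) w.
Proof.
move=> h; elim: s1 => [|i s1 IH] /=; last by rewrite IH.
case: s2 h => //= i s2 h; case: ifP => //.
Qed.

Lemma cosh_measurable : measurable_fun [set: R] (@cosh R).
Proof.
apply: measurable_funM; last exact: measurable_cst.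
apply: measurable_funD; first exact: measurable_expR.
by apply: measurableT_comp => //; exact: measurable_expR.
Qed.

Lemma sinh_measurable : measurable_fun [set: R] (@sinh R).
Proof.
apply: measurable_funM; last exact: measurable_cst.
apply: measurable_funB; first exact: measurable_expR.
by apply: measurableT_comp => //; exact: measurable_expR.
Qed.

Lemma walk_cosh_measurable lam s :
  measurable_fun [set: pastseq s] (walk_cosh lam s : pastseq s -> R).
Proof.
apply: measurable_funM; last exact: measurable_cst.
apply: (measurableT_comp cosh_measurable).
by apply: measurable_funM; [exact: measurable_cst|exact: nrm_psum_measurable].
Qed.

Lemma stopped_measurable lam a s :
  measurable_fun [set: pastseq s] (stopped lam a s : pastseq s -> R).
Proof.
elim: s => [|i s IH]; first exact: walk_cosh_measurable.
have {}IH : measurable_fun [set: pastseq (i :: s)] (stopped lam a s : pastseq (i :: s) -> R).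
  by apply: past_mono IH; apply/fintype.subsetP => j; rewrite !inE => ->; rewrite orbT.
apply: (@measurable_fun_ifT _ _ (pastseq (i :: s)) R _ _ (fun w => a <= stopped lam a s w)) => //.
  by apply: measurable_fun_ler.
exact: walk_cosh_measurable.
Qed.

Lemma cosh_abs_le x c : `|x| <= c -> cosh x <= expR (c ^+ 2) :> R.
Proof.
move=> xc; apply: le_trans (cosh_le_expR_sqr _) _.
by rewrite ler_expR -real_normK ?num_real// lerXn2r// nnegrE (le_trans _ xc).
Qed.

Lemma sinh_abs_le x : `|sinh x| <= cosh x :> R.
Proof.
rewrite /sinh /cosh ler_norml.
by have := expR_gt0 x; have := expR_gt0 (- x); move=> ? ?; apply/andP; split; lra.
Qed.

Definition walk_bound lam s : R := expR ((`|lam| * ((size s)%:R * b)) ^+ 2).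

Lemma cosh_walk_le lam s w :
  cosh (lam * nrm L (psum s w)) <= walk_bound lam s.
Proof.
apply: cosh_abs_le; rewrite normrM ler_wpM2l//.
by rewrite ger0_norm ?nrm_ge0// psum_nrm_le.
Qed.

Lemma coshX_ge1 lam k : 1 <= cosh (lam * b) ^+ k :> R.
Proof. by rewrite exprn_ege1// cosh_ge1. Qed.

Lemma walk_cosh_ge0 lam s w : 0 <= walk_cosh lam s w.
Proof. by rewrite divr_ge0// ?exprn_ge0// ltW// cosh_gt0. Qed.

Lemma walk_cosh_le lam s w : walk_cosh lam s w <= walk_bound lam s.
Proof.
apply: le_trans (cosh_walk_le lam s w).
by rewrite ler_pdivrMr ?exprn_gt0 ?cosh_gt0// ler_peMr ?coshX_ge1// ltW// cosh_gt0.
Qed.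

Lemma stopped_ge0 lam a s w : 0 <= stopped lam a s w.
Proof. by elim: s => [|i s IH] /=; [|case: ifP => // _]; exact: walk_cosh_ge0. Qed.

Lemma stopped_bound lam a s : exists K, forall w, `|stopped lam a s w| <= K.
Proof.
elim: s => [|i s [K IH]].
  exists (walk_bound lam [::]) => w.
  by rewrite ger0_norm ?stopped_ge0// walk_cosh_le.
exists (K + walk_bound lam (i :: s)) => w /=; case: ifP => _.
  by rewrite (le_trans (IH w))// lerDl expR_ge0.
rewrite ger0_norm ?walk_cosh_ge0// (le_trans (walk_cosh_le _ _ _))// lerDr.
exact: le_trans (IH w).
Qed.

(** The coefficient of coordinate [l] of the new increment in the sinh term of the cosine rule; it
    is a function of the past alone. For a walk of norm 0 the quotient is 0 by the convention on
    inverses, consistently with the vanishing sinh. *)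
Definition walk_weight lam s l w : R :=
  psum s w l / (nrm L (psum s w) * b) *
  (sinh (lam * nrm L (psum s w)) * sinh (lam * b)) / cosh (lam * b) ^+ (size s).+1.

Lemma walk_weight_measurable lam s l :
  measurable_fun [set: pastseq s] (walk_weight lam s l : pastseq s -> R).
Proof.
have mN := @nrm_psum_measurable s.
apply: measurable_funM; last exact: measurable_cst.
apply: measurable_funM.
  apply: measurable_funM; first exact: psum_measurable.
  apply: (@measurableT_comp _ _ _ _ _ _ (@GRing.inv R)); first exact: inv_measurable.
  by apply: measurable_funM => //; exact: measurable_cst.
apply: measurable_funM; last exact: measurable_cst.
apply: (measurableT_comp sinh_measurable).
by apply: measurable_funM => //; exact: measurable_cst.
Qed.

Lemma ratio_le1 (u v : R) : `|u| <= v -> `|u / v| <= 1.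
Proof.
move=> uv; have v0 : 0 <= v by exact: le_trans uv.
have [->|vn0] := eqVneq v 0; first by rewrite invr0 mulr0 normr0.
by rewrite normrM normfV (ger0_norm v0) ler_pdivrMr ?mul1r// lt_def vn0.
Qed.

Lemma walk_weight_le lam s (l : 'I_L) w :
  `|walk_weight lam s l w| <= b^-1 * (walk_bound lam s * cosh (lam * b)).
Proof.
rewrite /walk_weight normrM (ger0_norm (x := _^-1)); last first.
  by rewrite invr_ge0 exprn_ge0// ltW// cosh_gt0.
rewrite ler_pdivrMr ?exprn_gt0 ?cosh_gt0//.
apply: (@le_trans _ _ (b^-1 * (walk_bound lam s * cosh (lam * b)))); last first.
  rewrite ler_peMr ?coshX_ge1//.
  by rewrite !mulr_ge0 ?invr_ge0 ?expR_ge0 ?(ltW b_gt0)// ltW// cosh_gt0.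
rewrite normrM ler_pM//.
  rewrite invfM mulrA normrM (ger0_norm (x := b^-1)) ?invr_ge0 ?(ltW b_gt0)//.
  rewrite ler_piMl ?invr_ge0 ?(ltW b_gt0)//; exact/ratio_le1/coord_le_nrm.
rewrite normrM ler_pM ?sinh_abs_le//.
exact: le_trans (sinh_abs_le _) (cosh_walk_le _ _ _).
Qed.

(** The cosine rule, with [u] the normalized inner product of walk and increment. Division by one
    more factor [cosh (lam * b)] leaves the old value plus a term linear in the increment. *)
Lemma walk_cosh_step lam i s w :
  walk_cosh lam (i :: s) w <=
  walk_cosh lam s w + \sum_(l < L) walk_weight lam s l w * g i (y i w) l.
Proof.
set W := psum s w; set G := g i (y i w); set u := dot L W G / (nrm L W * b).
have WG : `|dot L W G| <= nrm L W * b.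
  by rewrite (le_trans (dot_le _ _ _))// ler_wpM2l ?nrm_ge0//; exact: g_bound.
have -> : \sum_(l < L) walk_weight lam s l w * G l =
    u * (sinh (lam * nrm L W) * sinh (lam * b)) / cosh (lam * b) ^+ (size s).+1.
  rewrite /u /dot !mulr_suml; apply: eq_bigr => l _; rewrite /walk_weight -/W; ring.
have H : cosh (lam * nrm L (psum (i :: s) w)) <=
    cosh (lam * nrm L W) * cosh (lam * b) + u * (sinh (lam * nrm L W) * sinh (lam * b)).
  apply: cosh_cosine_rule; first exact: ratio_le1.
  rewrite psum_cons -/W -/G !exprMn sqr_nrm !(dotDl, dotDr) (dotC L G W) -sqr_nrm -(sqr_nrm L G).
  (* This also holds when the denominator of [u] is 0, since the inner product vanishes with it. *)
  have uE : u * (lam * nrm L W * (lam * b)) = lam ^+ 2 * dot L W G.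
    have [W0|Wn0] := eqVneq (nrm L W * b) 0.
      rewrite W0 normr_le0 in WG.
      by rewrite /u (eqP WG) !(mul0r, mulr0).
    transitivity (u * (nrm L W * b) * lam ^+ 2); first by ring.
    by rewrite /u divfK// mulrC.
  rewrite uE.
  have GB : nrm L G ^+ 2 <= b ^+ 2.
    by rewrite lerXn2r ?nnegrE ?nrm_ge0// ?(ltW b_gt0)//; exact: g_bound.
  have := ler_wpM2l (sqr_ge0 lam) GB.
  by set A := lam ^+ 2; lra.
have c0 := cosh_gt0 (lam * b).
have cn0 : cosh (lam * b) != 0 by rewrite gt_eqF.
rewrite /walk_cosh /= -/W [X in _ <= X](_ : _ = (cosh (lam * nrm L W) * cosh (lam * b) +
    u * (sinh (lam * nrm L W) * sinh (lam * b))) / cosh (lam * b) ^+ (size s).+1).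
  by rewrite ler_wpM2r// invr_ge0 exprn_ge0// ltW.
by rewrite exprS; field; rewrite cn0 expf_neq0.
Qed.

Lemma stopped_integrable lam a s :
  P.-integrable [set: Omega] (EFin \o stopped lam a s).
Proof.
have [K hK] := stopped_bound lam a s.
apply: (@bounded_integrable _ _ _ P _ K) => //.
exact: past_fun_measurable (@stopped_measurable lam a s).
Qed.

Lemma sum_integrable (F : 'I_L -> Omega -> R) :
  (forall l, P.-integrable [set: Omega] (EFin \o F l)) ->
  P.-integrable [set: Omega] (EFin \o (fun w => \sum_l F l w)).
Proof.
move=> iF; rewrite (_ : _ \o _ = fun w => (\sum_l (EFin \o F l) w)%E).
  by apply: integrable_sum => // l _; exact: iF.
by apply/funext => w; rewrite /= sumEFin.
Qed.

Lemma Rintegral_sum0 (F : 'I_L -> Omega -> R) :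
  (forall l, P.-integrable [set: Omega] (EFin \o F l)) ->
  (forall l, \int[P]_w (F l w)%:E = 0)%E ->
  \int[P]_w (\sum_l F l w) = 0.
Proof.
move=> iF F0; rewrite /Rintegral.
under eq_integral do rewrite -sumEFin.
by rewrite integral_sum// big1.
Qed.

(** Conditional expectations are avoided: coordinate by coordinate, the linear term is a
    past-measurable factor times a centered one independent of that past, and integrates to 0 by
    [past_mean0]. *)
Lemma stopped_supermartingale lam a i s : i \notin s ->
  \int[P]_w stopped lam a (i :: s) w <= \int[P]_w stopped lam a s w.
Proof.
move=> iNs.
(* The weight is switched off once the process is frozen, so that one pointwise bound covers both
   branches of [stopped]. *)
pose f (l : 'I_L) w := if a <= stopped lam a s w then 0 else walk_weight lam s l w.
have mf l : measurable_fun [set: pastseq s] (f l : pastseq s -> R).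
  apply: (@measurable_fun_ifT _ _ (pastseq s) R _ _ (fun w => a <= stopped lam a s w)) => //.
    by apply: measurable_fun_ler => //; exact: stopped_measurable.
  exact: walk_weight_measurable.
pose B := b^-1 * (walk_bound lam s * cosh (lam * b)).
have B0 : 0 <= B.
  by rewrite !mulr_ge0 ?invr_ge0 ?expR_ge0 ?(ltW b_gt0)// ltW// cosh_gt0.
have fB l w : `|f l w| <= B.
  by rewrite /f; case: ifP => _; [rewrite normr0|exact: walk_weight_le].
have gB (l : 'I_L) z : `|g i z l| <= b by exact: le_trans (coord_le_nrm _ _) (g_bound _ _).
have f0 l : (\int[P]_w (f l w * g i (y i w) l)%:E = 0)%E.
  apply: (@past_mean0 _ _ _ _ _ _ _ _ y_indep [set j in s] i (f l) (fun z => g i z l) B b) => //.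
  by rewrite inE.
have iF l : P.-integrable [set: Omega] (EFin \o (fun w => f l w * g i (y i w) l)).
  apply: (@bounded_integrable _ _ _ P _ (B * b)).
    apply: measurable_funM; first exact: past_fun_measurable (mf l).
    by apply: (measurableT_comp (g_measurable i l)).
  by move=> w; rewrite normrM ler_pM.
apply: (@le_trans _ _ (\int[P]_w (stopped lam a s w + \sum_l f l w * g i (y i w) l))).
  apply: le_Rintegral => //; first exact: stopped_integrable.
    rewrite (_ : _ \o _ = (EFin \o stopped lam a s) \+
       (EFin \o (fun w => \sum_l f l w * g i (y i w) l))); last first.
      by apply/funext => w; rewrite /= EFinD.
    by apply: integrableD => //; [exact: stopped_integrable|exact: sum_integrable].
  move=> w _ /=; rewrite /f; case: ifPn => [|].
    by rewrite big1 ?addr0// => l _; rewrite mul0r.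
  by rewrite -ltNge => /stopped_lt ->; exact: walk_cosh_step.
rewrite RintegralD//; [|exact: stopped_integrable|exact: sum_integrable].
by rewrite Rintegral_sum0// addr0.
Qed.

Lemma stopped_mean lam a s : uniq s -> \int[P]_w stopped lam a s w <= 1.
Proof.
elim: s => [_|i s IH /= /andP[iNs us]]; last first.
  exact: le_trans (stopped_supermartingale lam a iNs) (IH us).
rewrite (_ : stopped lam a [::] = cst 1).
  rewrite Rintegral_cst//.
  rewrite mul1r -lee_fin fineK; first exact: probability_le1.
  exact: fin_num_measure.
by apply/funext => w /=; rewrite /walk_cosh /psum big_nil nrm0 mulr0 cosh0 divr1.
Qed.

Lemma walk_cosh_maximal lam a s : 0 < a -> uniq s ->
  exceptional P (a^-1) (fun w => forall s1 s2, s = s1 ++ s2 -> walk_cosh lam s2 w < a).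
Proof.
move=> a0 us; have mS : measurable_fun [set: Omega] (stopped lam a s).
  exact: past_fun_measurable (@stopped_measurable lam a s).
pose B := [set w | a <= stopped lam a s w].
have mB : measurable B.
  rewrite (_ : B = stopped lam a s @^-1` `[a, +oo[%classic).
    by rewrite -[X in measurable X]setTI; exact: mS.
  by apply/seteqP; split => w; rewrite /B /= in_itv /= andbT.
exists B; split => //; last first.
  move=> w; rewrite /B /= => /negP; rewrite -ltNge => h s1 s2 E; rewrite ltNge.
  apply/negP => /(stopped_ge s1); rewrite -E; apply/negP; rewrite -ltNge//.
have iS := stopped_integrable lam a s.
have H : (\int[P]_w (a * \1_B w)%:E <= \int[P]_w (stopped lam a s w)%:E)%E.
  apply: ge0_le_integral => //.
  - by move=> w _; rewrite lee_fin mulr_ge0// ltW.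
  - by apply/measurable_EFinP; apply: measurable_funM => //; exact: measurable_indic.
  - exact/measurable_EFinP.
  - move=> w _; rewrite lee_fin indicE; case: (boolP (w \in B)) => [|_].
      by rewrite inE mulr1.
    by rewrite mulr0 stopped_ge0.
have E1 : (\int[P]_w (stopped lam a s w)%:E <= 1)%E.
  rewrite -(@fineK _ (\int[P]_w (stopped lam a s w)%:E)%E).
    by rewrite lee_fin; exact: stopped_mean.
  exact: integrable_fin_num iS.
have := le_trans H E1.
under eq_integral do rewrite EFinM.
rewrite integralZl//; last first.
  by apply: (@bounded_integrable _ _ _ P _ 1) => // w; rewrite indicE; case: (_ \in _); rewrite ?normr1 ?normr0.
rewrite integral_indic// setIT.
have fB : P B \is a fin_num by exact: fin_num_measure.
move=> aPB; have : (a%:E * (fine (P B))%:E <= 1)%E by rewrite fineK.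
rewrite -EFinM lee_fin => aB.
suff : ((fine (P B))%:E <= (a^-1)%:E)%E by rewrite fineK.
by rewrite lee_fin -[a^-1]mulr1 ler_pdivlMl.
Qed.

Lemma walk_norm_tail x c s : 0 < c -> (size s <= n)%N -> uniq s ->
  4 * n%:R * b ^+ 2 * x <= c ^+ 2 ->
  exceptional P (2 * expR (- x))
    (fun w => forall s1 s2, s = s1 ++ s2 -> nrm L (psum s2 w) < c).
Proof.
move=> c0 sn us xc; have b2 : 0 < b ^+ 2 by rewrite exprn_gt0.
(* The empty list is set apart because [n] may then be 0, a denominator of [lam]. *)
case: s => [|i0 s'] in sn us *.
  exists set0; split => //; first by rewrite measure0 lee_fin mulr_ge0// expR_ge0.
  by move=> w _ [|//] [|//] _; rewrite /psum big_nil nrm0.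
have n0 : 0 < n%:R :> R by rewrite ltr0n (leq_trans _ sn).
move: (i0 :: s') us sn => s us sn.
(* The maximizer of lam c - n (lam b)^2. *)
pose lam := c / (2 * n%:R * b ^+ 2).
have lam0 : 0 < lam by rewrite divr_gt0// !mulr_gt0.
have lamE : lam * c - n%:R * (lam * b) ^+ 2 = c ^+ 2 / (4 * n%:R * b ^+ 2).
  by rewrite /lam; field; rewrite !gt_eqF.
(* The halving comes from cosh z >= exp(z) / 2 and becomes the factor 2 of the tail. *)
pose a := expR (c ^+ 2 / (4 * n%:R * b ^+ 2)) / 2.
have a0 : 0 < a by rewrite divr_gt0// expR_gt0.
apply: exceptional_imp (walk_cosh_maximal lam a0 us).
  rewrite /a invf_div -expRN ler_wpM2l// ler_expR lerN2 ler_pdivlMr ?mulr_gt0//.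
  by apply: le_trans xc; rewrite mulrC.
move=> w H s1 s2 E; have := H s1 s2 E; rewrite !ltNge; apply: contra => cW.
have ss2 : (size s2 <= n)%N by rewrite (leq_trans _ sn)// E size_cat leq_addl.
rewrite /walk_cosh /a -lamE expRB mulrAC.
apply: ler_pM; rewrite ?divr_ge0 ?expR_ge0 ?invr_ge0//.
  apply: le_trans (expR_le_cosh _); rewrite ler_wpM2r// ler_expR ler_wpM2l// ltW//.
rewrite lef_pV2 ?posrE ?expR_gt0 ?exprn_gt0 ?cosh_gt0//.
rewrite expRM_natl (@le_trans _ _ (cosh (lam * b) ^+ n))//.
  by rewrite ler_weXn2l// cosh_ge1.
by rewrite lerXn2r ?nnegrE ?expR_ge0 ?(ltW (cosh_gt0 _))// cosh_le_expR_sqr.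
Qed.

(** For a linear barrier the best [lam] is the same at every stage, and the exponent at stage j is j
    beta^2 / (4 b^2); among the stages considered it is never below its value at [r0]. *)
Lemma walk_drift_tail x beta r0 s : 0 < beta -> uniq s ->
  4 * b ^+ 2 * x <= r0 * beta ^+ 2 ->
  exceptional P (2 * expR (- x))
    (fun w => forall s1 s2, s = s1 ++ s2 -> r0 <= (size s2)%:R ->
       nrm L (psum s2 w) < beta * (size s2)%:R).
Proof.
move=> c0 us xc; have b2 : 0 < b ^+ 2 by rewrite exprn_gt0.
pose lam := beta / (2 * b ^+ 2).
have lam0 : 0 < lam by rewrite divr_gt0// mulr_gt0.
have lamE (k : nat) : lam * (beta * k%:R) - k%:R * (lam * b) ^+ 2 =
    k%:R * beta ^+ 2 / (4 * b ^+ 2).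
  by rewrite /lam; field; rewrite gt_eqF.
pose a := expR (r0 * beta ^+ 2 / (4 * b ^+ 2)) / 2.
have a0 : 0 < a by rewrite divr_gt0// expR_gt0.
apply: exceptional_imp (walk_cosh_maximal lam a0 us).
  rewrite /a invf_div -expRN ler_wpM2l// ler_expR lerN2 ler_pdivlMr ?mulr_gt0//.
  by apply: le_trans xc; rewrite mulrC.
move=> w H s1 s2 E r0s; have := H s1 s2 E; rewrite !ltNge; apply: contra => cW.
apply: (@le_trans _ _ (expR ((size s2)%:R * beta ^+ 2 / (4 * b ^+ 2)) / 2)).
  by rewrite ler_wpM2r// ler_expR !ler_wpM2r// ?invr_ge0 ?mulr_ge0 ?sqr_ge0// ltW.
rewrite /walk_cosh -lamE expRB mulrAC.
apply: ler_pM; rewrite ?divr_ge0 ?expR_ge0 ?invr_ge0//.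
  apply: le_trans (expR_le_cosh _); rewrite ler_wpM2r// ler_expR ler_wpM2l// ltW//.
rewrite lef_pV2 ?posrE ?expR_gt0 ?exprn_gt0 ?cosh_gt0// expRM_natl.
by rewrite lerXn2r ?nnegrE ?expR_ge0 ?(ltW (cosh_gt0 _))// cosh_le_expR_sqr.
Qed.

End Walk.

(** * Prefix sums and the splitting of index lists *)

Section PrefixSums.
Context {V : zmodType} (n : nat).
Implicit Types (F : 'I_n -> V) (s t : nat).

Definition prefix F t : V := \sum_(i < n | (i < t)%N) F i.

Lemma prefixB F s t : (s <= t)%N ->
  prefix F t - prefix F s = \sum_(i < n | (s <= i < t)%N) F i.
Proof.
move=> st; apply/eqP; rewrite subr_eq addrC /prefix (bigID (fun i : 'I_n => (i < s)%N))/=.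
apply/eqP; congr (_ + _); apply: eq_bigl => i; last by rewrite -leqNgt andbC.
by apply/andP/idP => [[]//|h]; split=> //; exact: leq_trans st.
Qed.

Lemma prefix_all F t : (n <= t)%N -> prefix F t = \sum_i F i.
Proof. by move=> nt; apply: eq_bigl => i; rewrite (leq_trans (ltn_ord i)). Qed.

End PrefixSums.

Lemma filter_sorted_split (s : seq nat) t : sorted ltn s ->
  s = [seq i <- s | (i < t)%N] ++ [seq i <- s | (t <= i)%N].
Proof.
elim: s => //= i s IH pis; have ss := path_sorted pis.
case: (ltnP i t) => it /=; first by congr cons; exact: IH.
have /allP iall := order_path_min ltn_trans pis.
rewrite (_ : [seq i <- s | (i < t)%N] = [::]) /=; last first.
  apply/eqP; rewrite -size_eq0 size_filter -leqn0 leqNgt -has_count; apply/hasPn => j /iall ij.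
  by rewrite -leqNgt (leq_trans it)// ltnW.
congr cons; apply/esym/all_filterP/allP => j /iall ij.
by rewrite (leq_trans it)// ltnW.
Qed.

(** Supplies the decompositions [s1 ++ s2] over which the maximal inequalities quantify. *)
Lemma filter_enum_ord_split n (p : pred nat) t :
  [seq i : 'I_n <- enum 'I_n | p i] =
  [seq i : 'I_n <- enum 'I_n | p i && (i < t)%N] ++ [seq i : 'I_n <- enum 'I_n | p i && (t <= i)%N].
Proof.
apply: (inj_map val_inj); rewrite map_cat.
have E (q : pred nat) : map val [seq i : 'I_n <- enum 'I_n | q (val i)] = [seq i <- iota 0 n | q i].
  by rewrite -val_enum_ord filter_map.
rewrite (E p) (E (fun i => p i && (i < t)%N)) (E (fun i => p i && (t <= i)%N)).
rewrite [LHS](filter_sorted_split t).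
  by rewrite -!filter_predI; congr (_ ++ _); apply: eq_filter => i /=; rewrite andbC.
by apply: sorted_filter (iota_ltn_sorted _ _); exact: ltn_trans.
Qed.

Lemma size_filter_enum_ord n a t :
  size [seq i : 'I_n <- enum 'I_n | (a <= i)%N && (i < t)%N] = (minn n t - a)%N.
Proof.
rewrite size_filter -(count_map val (fun i => (a <= i)%N && (i < t)%N)) val_enum_ord.
elim: n => [|n IH]; first by rewrite min0n.
rewrite -addn1 iotaD count_cat IH /= add0n addn0.
by case: (leqP a n) => an; case: (ltnP n t) => nt /=; lia.
Qed.

(** * Fluctuations of the walk from 0 and from the change point *)

Section Fluctuation.
Context {R : realType} {dispX dispO : measure_display}
  {X : measurableType dispX} {Omega : measurableType dispO}
  {P : probability Omega R}.
Variables (n : nat) (y : 'I_n -> {RV P >-> X}) (L : nat).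
Variables (g : 'I_n -> X -> nat -> R) (b : R).
Hypothesis y_indep : mutually_independent y.
Hypothesis b_gt0 : 0 < b.
Hypothesis g_measurable : forall i l, measurable_fun [set: X] (fun z => g i z l).
Hypothesis g_bound : forall i z, nrm L (g i z) <= b.
Hypothesis g_mean0 : forall i (l : 'I_L), (\int[P]_w (g i (y i w) l)%:E = 0)%E.

Definition walk (w : Omega) : nat -> nat -> R := prefix (fun i => g i (y i w)).

Lemma psum_rev s w : psum y g (rev s) w = psum y g s w.
Proof. by apply: perm_big; rewrite perm_rev. Qed.

Lemma forward_walk a t w : (a <= t)%N ->
  psum y g (rev [seq i : 'I_n <- enum 'I_n | (a <= i)%N && (i < t)%N]) w = walk w t - walk w a.
Proof.
move=> at_; rewrite prefixB// psum_rev /psum big_filter big_enum_cond /=.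
by apply: eq_bigl => i.
Qed.

Lemma walk0 w : walk w 0 = 0.
Proof. by rewrite /walk /prefix big1. Qed.

Lemma walk_norm (x c : R) : 0 < c -> 4 * n%:R * b ^+ 2 * x <= c ^+ 2 ->
  exceptional P (2 * expR (- x)) (fun w => forall t, nrm L (walk w t) < c).
Proof.
move=> c0 xc.
have us : uniq (rev [seq i : 'I_n <- enum 'I_n | true]) by rewrite rev_uniq filter_uniq// enum_uniq.
have ss : (size (rev [seq i : 'I_n <- enum 'I_n | true]) <= n)%N.
  by rewrite size_rev filter_predT size_enum_ord.
apply: exceptional_imp (walk_norm_tail y_indep b_gt0 g_measurable g_bound g_mean0 c0 ss us xc) => //.
move=> w H t; have := H (rev [seq i : 'I_n <- enum 'I_n | true && (t <= i)%N])
    (rev [seq i : 'I_n <- enum 'I_n | (0 <= i)%N && (i < t)%N]).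
by rewrite forward_walk// walk0 subr0; apply; rewrite -rev_cat -filter_enum_ord_split.
Qed.

(** Two one-sided walks start at [tau], each failing with probability at most 2 exp(-x). *)
Lemma walk_drift (x beta r0 : R) tau : 0 < beta -> (tau <= n)%N ->
  4 * b ^+ 2 * x <= r0 * beta ^+ 2 ->
  exceptional P (4 * expR (- x)) (fun w => forall t, (t <= n)%N ->
    r0 <= `|t%:R - tau%:R| -> nrm L (walk w t - walk w tau) < beta * `|t%:R - tau%:R|).
Proof.
move=> b0 tn xc.
(* The newest increment is at the head: indices decrease along the forward list and increase along
   the backward one. *)
pose sf := rev [seq i : 'I_n <- enum 'I_n | (tau <= i)%N].
pose sb := [seq i : 'I_n <- enum 'I_n | (i < tau)%N].
have uf : uniq sf by rewrite rev_uniq filter_uniq// enum_uniq.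
have ub : uniq sb by rewrite filter_uniq// enum_uniq.
have := exceptional_and
  (walk_drift_tail y_indep b_gt0 g_measurable g_bound g_mean0 b0 uf xc)
  (walk_drift_tail y_indep b_gt0 g_measurable g_bound g_mean0 b0 ub xc).
apply: exceptional_imp; first by rewrite -mulrDl; rewrite le_eqVlt; apply/orP; left; apply/eqP; congr (_ * _); lra.
move=> w [Hf Hb] t tn'; case: (leqP tau t) => taut.
  have -> : `|t%:R - tau%:R| = (t - tau)%:R :> R.
    by rewrite ger0_norm ?natrB// subr_ge0 ler_nat.
  have := Hf (rev [seq i : 'I_n <- enum 'I_n | (tau <= i)%N && (t <= i)%N])
    (rev [seq i : 'I_n <- enum 'I_n | (tau <= i)%N && (i < t)%N]).
  rewrite forward_walk// size_rev size_filter_enum_ord (minn_idPr tn'); apply.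
  by rewrite -rev_cat -filter_enum_ord_split.
have -> : `|t%:R - tau%:R| = (tau - t)%:R :> R.
  by rewrite distrC ger0_norm ?natrB ?subr_ge0 ?ler_nat// ltnW.
have := Hb [seq i : 'I_n <- enum 'I_n | (i < tau)%N && (i < t)%N]
    [seq i : 'I_n <- enum 'I_n | (i < tau)%N && (t <= i)%N].
rewrite (_ : psum _ _ _ _ = walk w tau - walk w t); last first.
  rewrite -(forward_walk w (ltnW taut)) psum_rev.
  by congr psum; apply: eq_filter => i; rewrite andbC.
have -> : [seq i : 'I_n <- enum 'I_n | (i < tau)%N && (t <= i)%N] =
    [seq i : 'I_n <- enum 'I_n | (t <= i)%N && (i < tau)%N].
  by apply: eq_filter => i; rewrite andbC.
rewrite size_filter_enum_ord (minn_idPr tn) -nrmN opprB; apply.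
rewrite /sb (filter_enum_ord_split n (fun i => (i < tau)%N) t).
by congr (_ ++ _); apply: eq_filter => i; rewrite andbC.
Qed.

End Fluctuation.

(** * The deterministic peak of the CUSUM energy *)

Section CusumPeak.
Context {R : realType}.

(* The signal part of the difference is [(N - S) (S - T) / (N - T)]; the factor
   [k ^+ 5 / 16] is small enough for the noise not to use up half of it. *)
Lemma cusum_gap_below (N S T k dd p p' q q' : R) :
  0 < k -> k <= 1 -> 0 < N -> T <= S -> k * N <= T -> k * N <= N - S -> 0 <= dd ->
  let r := S - T in let e := k ^+ 5 / 16 in
  `|p' - p| <= e * r * dd -> `|p| <= e * N * dd ->
  `|q' - q| <= e * N * r * dd -> 0 <= q <= e * N ^+ 2 * dd ->
  k / 2 * r * dd <=
    N / (S * (N - S)) * ((S * (N - S) / N) ^+ 2 * dd + 2 * (S * (N - S) / N) * p' + q') -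
    N / (T * (N - T)) * ((T * (N - S) / N) ^+ 2 * dd + 2 * (T * (N - S) / N) * p + q).
Proof.
move=> k0 k1 N0 TS kT kS dd0 r e Hpp Hp Hqq /andP[q0 Hq].
have kN : 0 < k * N by rewrite mulr_gt0.
have T0 : 0 < T by apply: lt_le_trans kT.
have S0 : 0 < S by apply: lt_le_trans TS.
have NS0 : 0 < N - S by apply: lt_le_trans kS.
have NT0 : 0 < N - T by lra.
have r0 : 0 <= r by rewrite subr_ge0.
have e0 : 0 <= e by rewrite divr_ge0// exprn_ge0// ltW.
have rdd : 0 <= r * dd by rewrite mulr_ge0.
(* The signal comes first; each of the four noise terms is arranged to be proportional to [r],
   either as an increment of the noise or through a difference of weights. *)
rewrite [leRHS](_ : _ = (N - S) / (N - T) * (r * dd) + 2 * (p' - p) +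
   2 * (r / (N - T)) * p + N / (S * (N - S)) * (q' - q) +
   N * r * (T + S - N) / (S * (N - S) * (T * (N - T))) * q); last first.
  by rewrite /r; field; rewrite !gt_eqF.
have A1 : k * (r * dd) <= (N - S) / (N - T) * (r * dd).
  rewrite ler_wpM2r// ler_pdivlMr//; apply: le_trans kS; rewrite ler_wpM2l ?(ltW k0)//; lra.
have A2 : - (2 * e * (r * dd)) <= 2 * (p' - p).
  by move: Hpp; rewrite ler_norml => /andP[+ _]; lra.
have A3 : - (2 / k * e * (r * dd)) <= 2 * (r / (N - T)) * p.
  have h1 : r / (N - T) <= r / (k * N).
    by rewrite ler_wpM2l// lef_pV2 ?posrE//; lra.
  have h2 : - (r / (N - T) * `|p|) <= r / (N - T) * p.
    rewrite -mulrN ler_wpM2l ?divr_ge0// ?(ltW NT0)//.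
    by rewrite lerNl -normrN ler_norm.
  have h3 : r / (N - T) * `|p| <= r / (k * N) * (e * N * dd).
    by rewrite ler_pM// divr_ge0// ltW.
  have h4 : r / (k * N) * (e * N * dd) = k^-1 * e * (r * dd) by field; rewrite !gt_eqF.
  by move: h2 h3; rewrite h4; lra.
have k2 : (k * N) * (k * N) <= S * (N - S).
  by rewrite ler_pM ?(ltW kN)// (le_trans kT).
have k2' : (k * N) * (k * N) <= T * (N - T).
  by rewrite ler_pM ?(ltW kN)// (le_trans kS)//; lra.
have kN2 : 0 < (k * N) * (k * N) by rewrite mulr_gt0.
have A4 : - (k ^- 2 * e * (r * dd)) <= N / (S * (N - S)) * (q' - q).
  have h1 : N / (S * (N - S)) <= N / ((k * N) * (k * N)).
    by rewrite ler_wpM2l ?(ltW N0)// lef_pV2 ?posrE// mulr_gt0.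
  have h0 : 0 <= N / (S * (N - S)) by rewrite divr_ge0 ?mulr_ge0// ltW.
  have h2 : - (N / (S * (N - S)) * `|q' - q|) <= N / (S * (N - S)) * (q' - q).
    by rewrite -mulrN ler_wpM2l// lerNl -normrN ler_norm.
  have h3 : N / (S * (N - S)) * `|q' - q| <= N / ((k * N) * (k * N)) * (e * N * r * dd).
    by rewrite ler_pM.
  have h4 : N / ((k * N) * (k * N)) * (e * N * r * dd) = k ^- 2 * e * (r * dd).
    by field; rewrite !gt_eqF.
  by move: h2 h3; rewrite h4; lra.
have A5 : - (k ^- 4 * e * (r * dd)) <=
    N * r * (T + S - N) / (S * (N - S) * (T * (N - T))) * q.
  have h1 : (S * (N - S) * (T * (N - T)))^-1 <= ((k * N) * (k * N) * ((k * N) * (k * N)))^-1.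
    by rewrite lef_pV2 ?posrE ?mulr_gt0// ler_pM// ltW.
  have h2 : N * r * (- N) <= N * r * (T + S - N).
    by rewrite ler_wpM2l ?mulr_ge0 ?(ltW N0)//; lra.
  have h3 : 0 <= N * r * N by rewrite !mulr_ge0 ?(ltW N0).
  have h5 : N * r * N * (S * (N - S) * (T * (N - T)))^-1 * q <=
      N * r * N * ((k * N) * (k * N) * ((k * N) * (k * N)))^-1 * (e * N ^+ 2 * dd).
    rewrite ler_pM//; first by rewrite mulr_ge0// invr_ge0 !mulr_ge0// ltW.
    by rewrite ler_wpM2l.
  have h6 : N * r * N * ((k * N) * (k * N) * ((k * N) * (k * N)))^-1 * (e * N ^+ 2 * dd) =
     k ^- 4 * e * (r * dd) by field; rewrite !gt_eqF.
  have h7 : - (N * r * N * (S * (N - S) * (T * (N - T)))^-1 * q) <=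
      N * r * (T + S - N) / (S * (N - S) * (T * (N - T))) * q.
    rewrite -mulNr -mulNr -mulrN; apply: ler_wpM2r => //; apply: ler_wpM2r => //.
    by rewrite invr_ge0 !mulr_ge0// ltW.
  by apply: le_trans h7; rewrite lerN2 -h6.
(* The term [k ^- 4], from the product of the weights at S and T, dictates the fifth power in
   [e]. *)
have ek : e * (2 + 2 / k + k ^- 2 + k ^- 4) <= k / 2.
  have -> : e * (2 + 2 / k + k ^- 2 + k ^- 4) =
    k * (2 * k ^+ 4 + 2 * k ^+ 3 + k ^+ 2 + 1) / 16 by rewrite /e; field; rewrite gt_eqF.
  have H (m : nat) : k ^+ m <= 1 by rewrite exprn_ile1// ltW.
  have h : 2 * k ^+ 4 + 2 * k ^+ 3 + k ^+ 2 + 1 <= 6.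
    by have := H 4%N; have := H 3%N; have := H 2%N; lra.
  have := ler_wpM2l (ltW k0) h; lra.
have := ler_wpM2r rdd ek; move: A1 A2 A3 A4 A5.
have -> : k / 2 * r * dd = k / 2 * (r * dd) by rewrite mulrA.
move: ((N - S) / (N - T) * (r * dd)) (2 * (p' - p)) (2 * (r / (N - T)) * p)
  (N / (S * (N - S)) * (q' - q)) (N * r * (T + S - N) / (S * (N - S) * (T * (N - T))) * q).
move: (r * dd) => z a1 a2 a3 a4 a5.
have -> : e * (2 + 2 / k + k ^- 2 + k ^- 4) * z =
   2 * e * z + 2 / k * e * z + k ^- 2 * e * z + k ^- 4 * e * z by ring.
lra.
Qed.

Definition cusum_weight (n t : nat) : R := n%:R / (t%:R * (n%:R - t%:R)).

Definition cusum {V : lmodType R} n (F : 'I_n -> V) t : V :=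
  prefix F t - (t%:R / n%:R) *: prefix F n.

(* The CUSUM at [t] of the indicator of [i < tau]. *)
Definition cusum_drift (n tau t : nat) : R := (minn t tau)%:R - t%:R * tau%:R / n%:R.

Definition energy L n (F : 'I_n -> nat -> R) t : R :=
  cusum_weight n t * dot L (cusum F t) (cusum F t).

(** Stated in any module because it serves both the feature vectors and the scalar squared
    distances. *)
Lemma cusum_change {V : lmodType R} n (F G : 'I_n -> V) tau (m0 m1 : V) t :
  (t <= n)%N -> (tau <= n)%N ->
  (forall i, F i = (if (i < tau)%N then m0 else m1) + G i) ->
  cusum F t = cusum_drift n tau t *: (m0 - m1) + cusum G t.
Proof.
move=> tn taun FE; case: (posnP n) => [n0|n0].
  subst n; rewrite /cusum /prefix !big_ord0 scaler0 subr0 addr0 /cusum_drift.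
  by move: tn taun; rewrite !leqn0 => /eqP -> /eqP ->; rewrite mul0r mul0r subr0 scale0r.
have pE s : (s <= n)%N ->
    prefix F s = s%:R *: m1 + (minn s tau)%:R *: (m0 - m1) + prefix G s.
  move=> sn; rewrite /prefix.
  under eq_bigr do rewrite FE.
  rewrite big_split /=; congr (_ + _).
  transitivity (\sum_(i < n | (i < s)%N) (m1 + if (i < tau)%N then m0 - m1 else 0)).
    by apply: eq_bigr => i _; case: ifP; rewrite ?addr0// addrC subrK.
  rewrite big_split /=; congr (_ + _).
    by rewrite -(big_ord_widen n (fun=> m1) sn) sumr_const card_ord scaler_nat.
  rewrite -big_mkcondr /=.
  rewrite (eq_bigl (fun i : 'I_n => (i < minn s tau)%N)); last by move=> i; rewrite leq_min.
  rewrite -(big_ord_widen n (fun=> m0 - m1)) ?sumr_const ?card_ord ?scaler_nat//.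
  by rewrite geq_min sn.
have gen (a b c b' c' : V) : a + b + c - (a + b' + c') = (b - b') + (c - c').
  by rewrite -(addrA a b c) -(addrA a b' c') opprD addrACA subrr add0r opprD addrACA.
have nn : n%:R != 0 :> R by rewrite pnatr_eq0 -lt0n.
rewrite /cusum !pE// /cusum_drift (minn_idPr taun); move: (m0 - m1) => u.
rewrite !scalerDr.
rewrite (scalerA _ n%:R) (scalerA _ tau%:R) divfK// gen; congr (_ + _).
by rewrite -scalerBl mulrAC.
Qed.

End CusumPeak.

(** * The energy gap for vectors with bounded noise *)

Section VectorPeak.
Context {R : realType}.
Implicit Types (k b D : R).

Lemma cusum_drift_left n tau t : (t <= tau)%N -> (0 < n)%N ->
  cusum_drift n tau t = t%:R * (n%:R - tau%:R) / n%:R :> R.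
Proof.
move=> tt n0; rewrite /cusum_drift (minn_idPl tt).
by field; rewrite pnatr_eq0 -lt0n.
Qed.

Lemma cusum_drift_right n tau t : (tau <= t)%N -> (0 < n)%N ->
  cusum_drift n tau t = tau%:R * (n%:R - t%:R) / n%:R :> R.
Proof.
move=> tt n0; rewrite /cusum_drift (minn_idPr tt).
by field; rewrite pnatr_eq0 -lt0n.
Qed.

Lemma prefixB_nrm L n (G : 'I_n -> nat -> R) b s t : (forall i, nrm L (G i) <= b) ->
  (s <= n)%N -> (t <= n)%N ->
  nrm L (prefix G s - prefix G t) <= `|s%:R - t%:R| * b.
Proof.
move=> Gb; wlog st : s t / (t <= s)%N => [H sn tn|sn tn].
  have [ts|/ltnW st] := leqP t s; first exact: H.
  by rewrite -nrmN opprB distrC; exact: H.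
rewrite prefixB// ger0_norm ?subr_ge0 ?ler_nat// -natrB//.
have -> : \sum_(i < n | (t <= i < s)%N) G i =
    \sum_(i <- [seq i : 'I_n <- enum 'I_n | (t <= i)%N && (i < s)%N]) G i.
  by rewrite big_filter big_enum_cond.
apply: le_trans (nrm_sum_le _ Gb) _.
by rewrite size_filter_enum_ord (minn_idPr sn).
Qed.

Lemma prefix_nrm L n (G : 'I_n -> nat -> R) b t : (forall i, nrm L (G i) <= b) ->
  (t <= n)%N -> nrm L (prefix G t) <= t%:R * b.
Proof.
move=> Gb tn; have := prefixB_nrm Gb tn (leq0n n).
rewrite [prefix _ 0](_ : _ = 0) ?subr0 ?normr_nat//.
by rewrite /prefix big1.
Qed.

(** Only two facts about the noise are needed: a global bound on its walk, and a bound linear in |t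
    - tau| on the increments projected on the jump. The case of t after [tau] reduces to
    [cusum_gap_below] by reversing time. *)
Lemma cusum_peak L n tau t (F G : 'I_n -> nat -> R) (m0 m1 : nat -> R) b k :
  let D := nrm L (m0 - m1) in let h := k ^+ 5 / 128 in
  0 < k -> k <= 1 -> (0 < n)%N -> (tau <= n)%N -> (t <= n)%N -> 0 < b -> D <= b ->
  k * n%:R <= tau%:R -> k * n%:R <= n%:R - tau%:R ->
  k * n%:R <= t%:R -> k * n%:R <= n%:R - t%:R ->
  (forall i, F i = (if (i < tau)%N then m0 else m1) + G i) ->
  (forall i, nrm L (G i) <= b) ->
  (forall s, nrm L (prefix G s) <= h * n%:R * D ^+ 2 / b) ->
  `|dot L (m0 - m1) (prefix G t - prefix G tau)| <= h * D ^+ 2 * `|t%:R - tau%:R| ->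
  k / 2 * `|t%:R - tau%:R| * D ^+ 2 <= energy L F tau - energy L F t.
Proof.
move=> D h k0 k1 n0 taun tn b0 Db kt1 kt2 kT1 kT2 FE Gb H1 H2.
have N0 : 0 < n%:R :> R by rewrite ltr0n.
have D0 : 0 <= D by exact: nrm_ge0.
have h0 : 0 <= h by rewrite divr_ge0// exprn_ge0// ltW.
have h1 : h <= 1.
  have : k ^+ 5 <= 1 by rewrite exprn_ile1// ltW.
  by rewrite /h; lra.
(* The noise bounds below carry the constants 2, 2, 4 and 8; the largest one turns the admissible 16
   into 128. *)
have hE : 8 * h = k ^+ 5 / 16 by rewrite /h; field.
clearbody h.
have nn0 : n%:R != 0 :> R by rewrite gt_eqF.
set B := h * n%:R * D ^+ 2 / b in H1.
have B0 : 0 <= B by exact: le_trans (nrm_ge0 L (prefix G 0)) (H1 0).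
have DB : D * B <= h * n%:R * D ^+ 2.
  rewrite /B mulrCA ler_piMr// ?mulr_ge0 ?sqr_ge0//.
  by rewrite ler_pdivrMr// mul1r.
have bB : b * B = h * n%:R * D ^+ 2 by rewrite /B mulrC divfK// gt_eqF.
have BB : B <= h * n%:R * b.
  rewrite /B -(mulrA _ (D ^+ 2)); rewrite ler_wpM2l ?mulr_ge0//.
  by rewrite ler_pdivrMr// -expr2 lerXn2r// nnegrE ltW.
clearbody B.
have frac s : (s <= n)%N -> 0 <= (s%:R / n%:R : R) <= 1.
  by move=> sn; rewrite divr_ge0//= ler_pdivrMr// mul1r ler_nat.
have NB s : (s <= n)%N -> nrm L (cusum G s) <= 2 * B.
  move=> sn; apply: le_trans (nrmB _ _ _) _; rewrite nrmZ.
  have /andP[f0 f1] := frac s sn.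
  rewrite ger0_norm// [leRHS]mulr_natl [leRHS]mulr2n lerD//.
  by apply: le_trans (H1 n); rewrite ler_piMl// nrm_ge0.
set r : R := `|t%:R - tau%:R|.
have r0 : 0 <= r by exact: normr_ge0.
have NE : cusum G tau - cusum G t =
    (prefix G tau - prefix G t) + ((t%:R - tau%:R) / n%:R) *: prefix G n.
  rewrite /cusum mulrBl scalerBl opprB (addrC _ (- prefix G t)) addrACA.
  by congr (_ + _); rewrite addrC.
have rn : `|(t%:R - tau%:R) / n%:R| = r / n%:R :> R.
  by rewrite normrM normfV normr_nat.
have p_le s : (s <= n)%N -> `|dot L (m0 - m1) (cusum G s)| <= 2 * (h * n%:R * D ^+ 2).
  move=> sn; apply: le_trans (dot_le _ _ _) _; rewrite -/D.
  apply: (@le_trans _ _ (D * (2 * B))); first by rewrite ler_wpM2l// NB.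
  by rewrite mulrCA ler_wpM2l.
have pp : `|dot L (m0 - m1) (cusum G tau) - dot L (m0 - m1) (cusum G t)| <=
    2 * (h * r * D ^+ 2).
  rewrite -dotBr NE dotDr dotZr; apply: le_trans (ler_normD _ _) _.
  rewrite [leRHS]mulr_natl [leRHS]mulr2n lerD//.
    by rewrite -opprB dotNr normrN (le_trans H2)// mulrAC.
  rewrite normrM rn.
  apply: (@le_trans _ _ (r / n%:R * (D * B))).
    rewrite ler_wpM2l ?divr_ge0//; apply: le_trans (dot_le _ _ _) _.
    by rewrite ler_wpM2l.
  apply: (@le_trans _ _ (r / n%:R * (h * n%:R * D ^+ 2))); first by rewrite ler_wpM2l ?divr_ge0.
  by rewrite le_eqVlt; apply/orP; left; apply/eqP; field.
have q_le s : (s <= n)%N ->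
    0 <= dot L (cusum G s) (cusum G s) <= 4 * (h * n%:R ^+ 2 * D ^+ 2).
  move=> sn; rewrite dot_ge0/= -sqr_nrm.
  apply: (@le_trans _ _ ((2 * B) ^+ 2)); first by rewrite lerXn2r ?nnegrE ?nrm_ge0 ?mulr_ge0// NB.
  have : B * B <= h * n%:R * b * B by rewrite ler_wpM2r.
  have -> : h * n%:R * b * B = h * (h * n%:R ^+ 2 * D ^+ 2).
    by rewrite -(mulrA _ b) bB; ring.
  have : h * (h * n%:R ^+ 2 * D ^+ 2) <= h * n%:R ^+ 2 * D ^+ 2.
    by rewrite ler_piMl// !mulr_ge0// sqr_ge0.
  by rewrite expr2; lra.
have qq : `|dot L (cusum G tau) (cusum G tau) - dot L (cusum G t) (cusum G t)| <=
    8 * (h * n%:R * r * D ^+ 2).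
  (* Factoring the difference of squares isolates an increment, at most [2 * (r * b)] with
     certainty, against the global bound [4 * B]. *)
  have -> : dot L (cusum G tau) (cusum G tau) - dot L (cusum G t) (cusum G t) =
      dot L (cusum G tau - cusum G t) (cusum G tau + cusum G t).
    move: (cusum G tau) (cusum G t) => c1 c2.
    by rewrite dotBl !dotDr (dotC L c2 c1); ring.
  apply: le_trans (dot_le _ _ _) _.
  have -> : 8 * (h * n%:R * r * D ^+ 2) = (2 * (r * b)) * (4 * B).
    have -> : 2 * (r * b) * (4 * B) = 8 * (r * (b * B)) by ring.
    by rewrite bB; ring.
  rewrite ler_pM ?nrm_ge0//.
    rewrite NE [leRHS]mulr_natl [leRHS]mulr2n; apply: le_trans (nrmD _ _ _) _; rewrite lerD//.
      by rewrite (le_trans (prefixB_nrm Gb _ _))// distrC.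
    rewrite nrmZ rn -mulrA ler_wpM2l//.
    by rewrite ler_pdivrMl// prefix_nrm.
  have := NB _ taun; have := NB _ tn; have := nrmD L (cusum G tau) (cusum G t).
  by move: (nrm L (_ + _)) (nrm L (cusum G tau)) (nrm L (cusum G t)) => a1 a2 a3; clear; lra.
have EE s : (s <= n)%N -> energy L F s = cusum_weight n s *
    (cusum_drift n tau s ^+ 2 * D ^+ 2 +
     2 * cusum_drift n tau s * dot L (m0 - m1) (cusum G s) +
     dot L (cusum G s) (cusum G s)).
  move=> sn; rewrite /energy (cusum_change sn taun FE) /D sqr_nrm.
  move: (cusum G s) (m0 - m1) => c u.
  by rewrite !(dotDl, dotDr, dotZl, dotZr) (dotC L c u); congr (_ * _); ring.
rewrite !EE//.
have d0 : 0 <= D ^+ 2 by exact: sqr_ge0.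
have z1 : 0 <= h * n%:R * D ^+ 2 by rewrite !mulr_ge0.
have z2 : 0 <= h * r * D ^+ 2 by rewrite !mulr_ge0.
have z3 : 0 <= h * n%:R ^+ 2 * D ^+ 2 by rewrite !mulr_ge0// ?sqr_ge0// ltW.
have [tt|/ltnW tt] := leqP t tau.
  have rE : r = tau%:R - t%:R by rewrite /r distrC ger0_norm// subr_ge0 ler_nat.
  have tt' : t%:R <= tau%:R :> R by rewrite ler_nat.
  rewrite !cusum_drift_left// rE.
  apply: (cusum_gap_below k0 k1 N0 tt' kT1 kt2 d0); rewrite -?rE -?hE.
  - by apply: le_trans pp _; clear - z1 z2; lra.
  - by apply: le_trans (p_le _ tn) _; clear - z1; lra.
  - by apply: le_trans qq _; clear - z1; lra.
  - by have /andP[-> /= q2] := q_le _ tn; apply: le_trans q2 _; clear - z3; lra.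
have rE : r = (n%:R - tau%:R) - (n%:R - t%:R).
  by rewrite /r ger0_norm ?subr_ge0 ?ler_nat//; ring.
have tt' : n%:R - t%:R <= n%:R - tau%:R :> R by rewrite lerD2l lerN2 ler_nat.
(* Time reversal t -> n - t preserves the weights and exchanges the two branches of the drift. *)
have := (@cusum_gap_below R n%:R (n%:R - tau%:R) (n%:R - t%:R) k (D ^+ 2)
  (dot L (m0 - m1) (cusum G t)) (dot L (m0 - m1) (cusum G tau))
  (dot L (cusum G t) (cusum G t)) (dot L (cusum G tau) (cusum G tau))
  k0 k1 N0 tt' kT2 _ d0).
have -> : n%:R - (n%:R - tau%:R) = tau%:R :> R by ring.
have -> : n%:R - (n%:R - t%:R) = t%:R :> R by ring.
rewrite !cusum_drift_right// /cusum_weight -rE -hE.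
rewrite !(mulrC (n%:R - _)); apply => //.
- by apply: le_trans pp _; clear - z1 z2; lra.
- by apply: le_trans (p_le _ tn) _; clear - z1; lra.
- by apply: le_trans qq _; clear - z1; lra.
- by have /andP[-> /= q2] := q_le _ tn; apply: le_trans q2 _; clear - z3; lra.
Qed.

End VectorPeak.

Lemma nrm1 {R : realType} (u : nat -> R) : nrm 1 u = `|u 0%N|.
Proof. by rewrite /nrm /dot big_ord1 -expr2 sqrtr_sqr. Qed.

Definition centered {R : realType} {X : Type} n (tau : nat) (m0 m1 : nat -> R)
    (f : X -> nat -> R) (i : 'I_n) (z : X) : nat -> R :=
  f z - (if (i < tau)%N then m0 else m1).

(** * The energy gap with high probability *)

Section ChangePointGap.
Context {R : realType} {dispX dispO : measure_display}
  {X : measurableType dispX} {Omega : measurableType dispO}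
  {P : probability Omega R}.
Variables (n : nat) (y : 'I_n -> {RV P >-> X}) (L tau : nat).
Variables (f : X -> nat -> R) (m0 m1 : nat -> R) (b k : R).
Let g := @centered R X n tau m0 m1 f.
Let D := nrm L (m0 - m1).
Let h := k ^+ 5 / 128.
Hypothesis y_indep : mutually_independent y.
Hypothesis b_gt0 : 0 < b.
Hypothesis f_measurable : forall l, measurable_fun [set: X] (f ^~ l).
Hypothesis g_bound : forall i z, nrm L (g i z) <= b.
Hypothesis g_mean0 : forall i (l : 'I_L), (\int[P]_w (g i (y i w) l)%:E = 0)%E.

Lemma centered_measurable i l : measurable_fun [set: X] (fun z => g i z l).
Proof.
by apply: measurable_funB => //; exact: measurable_cst.
Qed.

Lemma dot_mean0 (u : nat -> R) i :
  (\int[P]_w (dot L u (g i (y i w)))%:E = 0)%E.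
Proof.
have igl (l : 'I_L) : P.-integrable [set: Omega] (EFin \o (fun w => g i (y i w) l)).
  apply: (@bounded_integrable _ _ _ P _ b).
    by apply: (measurableT_comp (centered_measurable i l)).
  by move=> w; apply: le_trans (g_bound i (y i w)); exact: coord_le_nrm.
rewrite /dot; under eq_integral do rewrite -sumEFin.
rewrite integral_sum//; last first.
  move=> l; rewrite (_ : (fun w => _) = (fun w => (u l)%:E * (EFin \o (fun w => g i (y i w) l)) w)%E).
    by apply: integrableZl.
  by apply/funext => w.
rewrite big1// => l _; under eq_integral do rewrite EFinM.
transitivity ((u l)%:E * \int[P]_w (g i (y i w) l)%:E)%E; last by rewrite g_mean0 mule0.
by rewrite -integralZl//; exact: igl.
Qed.

(** A scalar coded as a constant sequence, so that the walk estimates apply to it with one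
    coordinate. *)
Definition scalar_noise (i : 'I_n) (z : X) : nat -> R := fun=> dot L (m0 - m1) (g i z).

Lemma scalar_noise_walk w t :
  walk y scalar_noise w t 0%N = dot L (m0 - m1) (walk y g w t).
Proof.
rewrite /walk /prefix dotC dot_suml.
elim/big_rec2: _ => [//|i u v _ <-]; by rewrite /scalar_noise dotC.
Qed.

(** The probability 6 exp(-x) is 2 for the global bound plus 4 for the two-sided drift of the
    projected walk, whose steps are at most [D * b]. The last two hypotheses are the tail conditions
    for these two events. *)
Lemma change_point_gap (x r0 : R) :
  0 < k -> k <= 1 -> (0 < n)%N -> (tau <= n)%N -> 0 < D -> D <= b ->
  k * n%:R <= tau%:R -> k * n%:R <= n%:R - tau%:R ->
  4 * n%:R * b ^+ 2 * x <= (h * n%:R * D ^+ 2 / b) ^+ 2 ->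
  4 * (D * b) ^+ 2 * x <= r0 * (h * D ^+ 2) ^+ 2 ->
  exceptional P (6 * expR (- x)) (fun w =>
    (forall t, nrm L (walk y g w t) < h * n%:R * D ^+ 2 / b) /\
    (forall t : nat, (t <= n)%N -> k * n%:R <= t%:R -> k * n%:R <= n%:R - t%:R ->
       r0 <= `|t%:R - tau%:R| ->
       k / 2 * `|t%:R - tau%:R| * D ^+ 2 <=
       energy L (fun i => f (y i w)) tau - energy L (fun i => f (y i w)) t)).
Proof.
move=> k0 k1 n0 taun D0 Db kt1 kt2 C1 C2.
have h0 : 0 < h by rewrite divr_gt0// exprn_gt0.
have N0 : 0 < n%:R :> R by rewrite ltr0n.
have c0 : 0 < h * n%:R * D ^+ 2 / b by rewrite !mulr_gt0 ?exprn_gt0 ?invr_gt0.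
have be0 : 0 < h * D ^+ 2 by rewrite mulr_gt0// exprn_gt0.
have sb i z : nrm 1 (scalar_noise i z) <= D * b.
  by rewrite nrm1 (le_trans (dot_le _ _ _))// ler_wpM2l// ltW.
have sm i l : measurable_fun [set: X] (fun z => scalar_noise i z l).
  apply: measurable_sum => j; apply: measurable_funM; first exact: measurable_cst.
  exact: centered_measurable.
have s0 i (l : 'I_1) : (\int[P]_w (scalar_noise i (y i w) l)%:E = 0)%E.
  exact: dot_mean0.
have Db0 : 0 < D * b by rewrite mulr_gt0.
apply: exceptional_imp (exceptional_and
  (walk_norm y_indep b_gt0 centered_measurable g_bound g_mean0 c0 C1)
  (walk_drift y_indep Db0 sm sb s0 be0 taun C2)).
  by rewrite -mulrDl; rewrite le_eqVlt; apply/orP; left; apply/eqP; congr (_ * _); lra.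
move=> w [H1 H2]; split => // t tn kT1 kT2 rt.
apply: (@cusum_peak R L n tau t (fun i => f (y i w)) (fun i => g i (y i w)) m0 m1 b k) => //.
- by move=> i; rewrite /g /centered addrC subrK.
- by move=> s; apply/ltW/H1.
- have := H2 t tn rt; rewrite nrm1 => /ltW.
  rewrite [(walk _ _ _ _ - _) 0%N](_ : _ = walk y scalar_noise w t 0%N - walk y scalar_noise w tau 0%N)//.
  by rewrite !scalar_noise_walk -dotBr.
Qed.

End ChangePointGap.

(** * The scan statistics of a Gram-type distance matrix *)

Section GramStatistics.
Context {R : realType} (L n : nat).
Implicit Types (q : 'I_n -> R) (xi : 'I_n -> nat -> R) (t : nat).

(** [q] is separate from [xi] because the two scans truncate differently: for the first [q] is the
    truncated squared norm, for the second it is the full one and only the inner product is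
    truncated. *)
Definition gram q xi (i j : 'I_n) : R := q i + q j - 2 * dot L (xi i) (xi j).

Definition suffix {V : zmodType} (F : 'I_n -> V) t : V := \sum_(i < n | (t <= i)%N) F i.

Lemma prefix_suffix {V : zmodType} (F : 'I_n -> V) t : (t <= n)%N ->
  prefix F t + suffix F t = prefix F n.
Proof.
move=> tn; rewrite -[RHS](subrK (prefix F t)) prefixB// addrC; congr (_ + _).
by apply: eq_bigl => i; rewrite ltn_ord andbT.
Qed.

Lemma sum_gram q xi (A B : pred 'I_n) :
  \sum_(i | A i) \sum_(j | B j) gram q xi i j =
  #|B|%:R * (\sum_(i | A i) q i) + #|A|%:R * (\sum_(j | B j) q j)
  - 2 * dot L (\sum_(i | A i) xi i) (\sum_(j | B j) xi j).
Proof.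
transitivity (\sum_(i | A i) (#|B|%:R * q i + \sum_(j | B j) q j
   - 2 * dot L (xi i) (\sum_(j | B j) xi j))).
  apply: eq_bigr => i _; rewrite !big_split /=; congr (_ + _ + _).
    by rewrite sumr_const mulr_natl.
  by rewrite sumrN -mulr_sumr dotC dot_suml; under eq_bigr do rewrite dotC.
rewrite !big_split /=; congr (_ + _ + _); first by rewrite mulr_sumr.
  by rewrite sumr_const mulr_natl.
by rewrite sumrN -mulr_sumr dot_suml.
Qed.

Lemma sum_off_diagonal (D : 'I_n -> 'I_n -> R) (A : pred 'I_n) :
  \sum_(i | A i) \sum_(j | A j && (i != j)) D i j =
  \sum_(i | A i) \sum_(j | A j) D i j - \sum_(i | A i) D i i.
Proof.
rewrite -sumrB; apply: eq_bigr => i Ai.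
rewrite [in RHS](bigD1 i)//= addrAC subrr add0r.
by apply: eq_bigl => j; rewrite eq_sym.
Qed.

Lemma card_prefix t : (t <= n)%N -> #|[pred i : 'I_n | (i < t)%N]| = t.
Proof.
move=> tn; rewrite -sum1_card -(big_ord_widen n (fun=> 1%N) tn).
by rewrite sum1_card card_ord.
Qed.

Lemma card_suffix t : (t <= n)%N -> #|[pred i : 'I_n | (t <= i)%N]| = (n - t)%N.
Proof.
move=> tn; have E : (\sum_(i < n) 1 = n)%N by rewrite sum1_card card_ord.
have := card_prefix tn; rewrite -!sum1_card => Et.
apply/eqP; rewrite -(eqn_add2l t) subnKC//; apply/eqP; rewrite -[RHS]E.
rewrite [RHS](bigID (fun i : 'I_n => (i < t)%N)) /=; congr addn; first exact/esym/Et.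
by apply: eq_bigl => i; rewrite -leqNgt.
Qed.

Lemma sum_gram_diag q xi (A : pred 'I_n) :
  \sum_(i | A i) gram q xi i i =
  2 * (\sum_(i | A i) q i) - 2 * (\sum_(i | A i) dot L (xi i) (xi i)).
Proof.
rewrite !mulr_sumr -sumrB; apply: eq_bigr => i _; rewrite /gram; ring.
Qed.

Let V xi i := dot L (xi i) (xi i).

(** Here and below the index set serves as sample space and [id] as sample, which makes the
    statistics functions of a matrix. *)
Lemma dbarA_gram q xi t : (0 < t < n)%N ->
  dbarA (gram q xi) id t = prefix q t / t%:R + suffix q t / (n%:R - t%:R)
    - 2 * dot L (prefix xi t) (suffix xi t) / (t%:R * (n%:R - t%:R)).
Proof.
move=> /andP[t0 tn]; rewrite /dbarA (sum_gram q xi (fun i => (i < t)%N) (fun j => (t <= j)%N)).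
rewrite card_prefix ?(ltnW tn)// card_suffix ?(ltnW tn)// natrM natrB ?(ltnW tn)//.
rewrite -/(prefix q t) -/(suffix q t) -/(prefix xi t) -/(suffix xi t).
have t1 : t%:R != 0 :> R by rewrite pnatr_eq0 -lt0n.
have t2 : n%:R - t%:R != 0 :> R by rewrite gt_eqF// subr_gt0 ltr_nat.
by field; rewrite t1 t2.
Qed.

Lemma dbarB1_gram q xi t : (1 < t <= n)%N ->
  dbarB1 (gram q xi) id t = 2 * (prefix q t / t%:R)
    - 2 * ((dot L (prefix xi t) (prefix xi t) - prefix (V xi) t) / (t%:R * (t%:R - 1))).
Proof.
move=> /andP[t1 tn]; rewrite /dbarB1 (sum_off_diagonal _ (fun i => (i < t)%N)).
rewrite sum_gram_diag (sum_gram q xi (fun i => (i < t)%N) (fun i => (i < t)%N)).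
rewrite card_prefix// natrM natrB ?(ltnW t1)//.
rewrite -/(prefix q t) -/(prefix xi t) -/(prefix (V xi) t).
have t2 : t%:R != 0 :> R by rewrite pnatr_eq0 -lt0n (ltn_trans _ t1).
have t3 : t%:R - 1 != 0 :> R by rewrite gt_eqF// subr_gt0 ltr1n.
by field; rewrite t2 t3.
Qed.

Lemma dbarB2_gram q xi t : (t < n - 1)%N ->
  dbarB2 (gram q xi) id t = 2 * (suffix q t / (n%:R - t%:R))
    - 2 * ((dot L (suffix xi t) (suffix xi t) - suffix (V xi) t) /
           ((n%:R - t%:R) * (n%:R - t%:R - 1))).
Proof.
move=> tn; have tn' : (t <= n)%N by lia.
have tn1 : (1 < n - t)%N by lia.
rewrite /dbarB2 (sum_off_diagonal _ (fun i => (t <= i)%N)).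
rewrite sum_gram_diag (sum_gram q xi (fun i => (t <= i)%N) (fun i => (t <= i)%N)).
rewrite card_suffix// natrM (natrB _ (ltnW tn1)) (natrB _ tn').
rewrite -/(suffix q t) -/(suffix xi t) -/(suffix (V xi) t).
have t2 : n%:R - t%:R != 0 :> R by rewrite -natrB// pnatr_eq0 -lt0n (ltn_trans _ tn1).
have t3 : n%:R - t%:R - 1 != 0 :> R by rewrite -natrB// gt_eqF// subr_gt0 ltr1n.
by field; rewrite t2 t3.
Qed.

Lemma dot_cusum xi t : (0 < t < n)%N ->
  energy L xi t = (n%:R - t%:R) / (n%:R * t%:R) * dot L (prefix xi t) (prefix xi t)
   + t%:R / (n%:R * (n%:R - t%:R)) * dot L (suffix xi t) (suffix xi t)
   - 2 * dot L (prefix xi t) (suffix xi t) / n%:R.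
Proof.
move=> /andP[t0 tn]; rewrite /energy /cusum -(prefix_suffix xi (ltnW tn)) /cusum_weight.
move: (prefix xi t) (suffix xi t) => u v.
rewrite !(dotBl, dotBr, dotDl, dotDr, dotZl, dotZr) (dotC L v u).
have t1 : t%:R != 0 :> R by rewrite pnatr_eq0 -lt0n.
have t2 : n%:R - t%:R != 0 :> R by rewrite gt_eqF// subr_gt0 ltr_nat.
have t3 : n%:R != 0 :> R by rewrite pnatr_eq0 -lt0n (ltn_trans t0).
by field; rewrite t1 t2 t3.
Qed.

(** [q] cancels in [T1]. The within-segment averages omit the diagonal while the energy includes it;
    the discrepancy is a weighted mean of the unbiased sample variances of the two segments. *)
Lemma scan1_gram q xi t : (1 < t)%N -> (t < n - 1)%N ->
  energy L xi t - scan1 (gram q xi) id t =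
  (n%:R - t%:R) / n%:R *
    ((t%:R * prefix (V xi) t - dot L (prefix xi t) (prefix xi t)) / (t%:R * (t%:R - 1))) +
  t%:R / n%:R *
    (((n%:R - t%:R) * suffix (V xi) t - dot L (suffix xi t) (suffix xi t)) /
      ((n%:R - t%:R) * (n%:R - t%:R - 1))).
Proof.
move=> t1 tn; have tn' : (t < n)%N by lia.
rewrite dot_cusum ?tn' ?(ltnW t1)// /scan1 /T1 dbarA_gram ?tn' ?(ltnW t1)//.
rewrite dbarB1_gram ?t1 ?(ltnW tn')// dbarB2_gram// natrM natrB ?(ltnW tn')//.
have t2 : t%:R != 0 :> R by rewrite pnatr_eq0 -lt0n (ltn_trans _ t1).
have t3 : t%:R - 1 != 0 :> R by rewrite gt_eqF// subr_gt0 ltr1n.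
have t4 : n%:R - t%:R != 0 :> R by rewrite gt_eqF// subr_gt0 ltr_nat.
have t5 : n%:R - t%:R - 1 != 0 :> R.
  by rewrite gt_eqF// -natrB ?(ltnW tn')// subr_gt0 ltr1n; lia.
have t6 : n%:R != 0 :> R by rewrite pnatr_eq0 -lt0n (leq_ltn_trans _ tn').
by field; rewrite t2 t3 t4 t5 t6.
Qed.

(** Half of each within-segment average is the mean of [q] minus an off-diagonal average of inner
    products; t (n - t) / n times the difference of the means of [q] is the CUSUM of [q]. *)
Lemma half_diff_gram q xi t : (1 < t)%N -> (t < n - 1)%N ->
  (t * (n - t))%N%:R / n%:R *
    ((dbarB1 (gram q xi) id t - dbarB2 (gram q xi) id t) / 2) ^+ 2 =
  cusum_weight n t * (prefix q t - t%:R / n%:R * prefix q n - t%:R * (n%:R - t%:R) / n%:R *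
    ((dot L (prefix xi t) (prefix xi t) - prefix (V xi) t) / (t%:R * (t%:R - 1)) -
     (dot L (suffix xi t) (suffix xi t) - suffix (V xi) t) /
           ((n%:R - t%:R) * (n%:R - t%:R - 1)))) ^+ 2.
Proof.
move=> t1 tn; have tn' : (t < n)%N by lia.
rewrite dbarB1_gram ?t1 ?(ltnW tn')// dbarB2_gram// natrM natrB ?(ltnW tn')//.
rewrite -(prefix_suffix q (ltnW tn')) /cusum_weight.
set a := _ / (t%:R * (t%:R - 1)); set c := _ / ((n%:R - t%:R) * _).
have t2 : t%:R != 0 :> R by rewrite pnatr_eq0 -lt0n (ltn_trans _ t1).
have t4 : n%:R - t%:R != 0 :> R by rewrite gt_eqF// subr_gt0 ltr_nat.
have t6 : n%:R != 0 :> R by rewrite pnatr_eq0 -lt0n (leq_ltn_trans _ tn').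
move: (prefix q t) (suffix q t) => u v.
by field; rewrite t2 t4 t6.
Qed.

(** The overall mean of [q] enters every row average and cancels. *)
Lemma row_gap_gram q xi t : (0 < t < n)%N ->
  prefix (dbar_row (gram q xi) id) t / t%:R -
  suffix (dbar_row (gram q xi) id) t / (n%:R - t%:R) =
  prefix q t / t%:R - suffix q t / (n%:R - t%:R) -
  2 / n%:R * (dot L (prefix xi t) (prefix xi n) / t%:R -
              dot L (suffix xi t) (prefix xi n) / (n%:R - t%:R)).
Proof.
move=> /andP[t0 tn].
have t1 : t%:R != 0 :> R by rewrite pnatr_eq0 -lt0n.
have t2 : n%:R - t%:R != 0 :> R by rewrite gt_eqF// subr_gt0 ltr_nat.
have t3 : n%:R != 0 :> R by rewrite pnatr_eq0 -lt0n (ltn_trans t0).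
have rowE (A : pred 'I_n) : \sum_(i | A i) dbar_row (gram q xi) id i =
    n%:R^-1 * (n%:R * (\sum_(i | A i) q i) + #|A|%:R * prefix q n
      - 2 * dot L (\sum_(i | A i) xi i) (prefix xi n)).
  rewrite /dbar_row -mulr_sumr; congr (_ * _).
  rewrite (sum_gram q xi A predT) cardT size_enum_ord !prefix_all//.
rewrite /prefix (rowE (fun i => (i < t)%N)) /suffix (rowE (fun i => (t <= i)%N)).
rewrite -/(prefix q t) -/(suffix q t) -/(prefix xi t) -/(suffix xi t).
rewrite card_prefix ?(ltnW tn)// card_suffix ?(ltnW tn)// natrB ?(ltnW tn)//.
rewrite -/(prefix q n) -/(prefix xi n).
by field; rewrite t1 t2.
Qed.

(** The radicand is the mean squared deviation of the row averages. A vanishing [Num.sqrt] only says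
    that the radicand is nonpositive, which is enough for a sum of squares. *)
Lemma shat0_dbar_row (D : 'I_n -> 'I_n -> R) (i : 'I_n) : (0 < n)%N ->
  shat D id = 0 -> dbar_row D id i = dbar D id.
Proof.
move=> n0 /eqP; rewrite sqrtr_eq0.
have nn : n%:R != 0 :> R by rewrite pnatr_eq0 -lt0n.
have N0 : 0 < n%:R :> R by rewrite ltr0n.
have E : dbar D id = n%:R^-1 * \sum_i dbar_row D id i.
  rewrite /dbar /dbar_row -mulr_sumr mulrA -invfM -natrM; congr (_%:R^-1 * _).
have -> : n%:R^-1 * \sum_i dbar_row D id i ^+ 2 - dbar D id ^+ 2 =
    n%:R^-1 * \sum_i (dbar_row D id i - dbar D id) ^+ 2.
  have Sr : \sum_i dbar_row D id i = n%:R * dbar D id by rewrite E mulrA mulfV ?mul1r.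
  transitivity (n%:R^-1 * \sum_i (dbar_row D id i ^+ 2 + - (2 * dbar D id * dbar_row D id i)
     + dbar D id ^+ 2)).
    rewrite !big_split /= sumrN -mulr_sumr Sr sumr_const card_ord -[_ *+ n]mulr_natl.
    by field.
  by congr (_ * _); apply: eq_bigr => j _; ring.
move=> H; have S0 : \sum_j (dbar_row D id j - dbar D id) ^+ 2 = 0.
  apply/le_anti; rewrite sumr_ge0 ?andbT; last by move=> j _; exact: sqr_ge0.
  by rewrite -(pmulr_rle0 _ (x := n%:R^-1)) ?invr_gt0.
have := psumr_eq0P (fun j _ => sqr_ge0 (dbar_row D id j - dbar D id)) S0.
by move=> /(_ i isT)/eqP; rewrite sqrf_eq0 subr_eq0 => /eqP.
Qed.

End GramStatistics.

(** * Passage of the statistics to the limit in the truncation *)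

Section Limits.
Context {R : realType}.

Lemma cvgn_sum I (r : seq I) (Q : pred I) (F : nat -> I -> R) (G : I -> R) :
  (forall i, F L i @[L --> \oo] --> G i) ->
  \sum_(i <- r | Q i) F L i @[L --> \oo] --> \sum_(i <- r | Q i) G i.
Proof.
move=> FG; elim: r => [|i r IH].
  rewrite big_nil (_ : (fun L => _) = cst 0); first exact: cvg_cst.
  by apply/funext => L; rewrite big_nil.
rewrite big_cons; case: ifP => Qi; last first.
  by rewrite (_ : (fun L => _) = (fun L => \sum_(i <- r | Q i) F L i))//; apply/funext => L; rewrite big_cons Qi.
rewrite (_ : (fun L => _) = (fun L => F L i + \sum_(i <- r | Q i) F L i)).
  by apply: cvgD.
by apply/funext => L; rewrite big_cons Qi.
Qed.

Lemma cvgn_scale (c : R) (f : nat -> R) a :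
  f L @[L --> \oo] --> a -> c * f L @[L --> \oo] --> c * a.
Proof. by move=> fa; apply: cvgM => //; exact: cvg_cst. Qed.

(** The counterpart of [exceptional_limsup]: estimates available for infinitely many [L] only still
    bound the limit. *)
Lemma cvgn_ge_frequently (f : nat -> R) a c :
  f L @[L --> \oo] --> a -> (forall N, exists2 L, (N <= L)%N & c <= f L) -> c <= a.
Proof.
move=> fa H; rewrite leNgt; apply/negP => ac.
have [N _ HN] := cvgr_lt a fa c ac.
have [L NL] := H N; have := HN L NL => /= h1 h2.
by move: h1; rewrite ltNge h2.
Qed.

Section Statistics.
Variables (n : nat) (DL : nat -> 'I_n -> 'I_n -> R) (D : 'I_n -> 'I_n -> R).
Hypothesis DLD : forall i j, DL L i j @[L --> \oo] --> D i j.

Lemma cvgn_sum2 (A : pred 'I_n) (B : 'I_n -> pred 'I_n) :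
  \sum_(i | A i) \sum_(j | B i j) DL L i j @[L --> \oo] -->
  \sum_(i | A i) \sum_(j | B i j) D i j.
Proof. by apply: cvgn_sum => i; exact: cvgn_sum. Qed.

Lemma cvg_dbarB1 t : dbarB1 (DL L) id t @[L --> \oo] --> dbarB1 D id t.
Proof.
by apply: cvgn_scale; exact: (@cvgn_sum2 (fun i => (i < t)%N) (fun i j => (j < t)%N && (i != j))).
Qed.

Lemma cvg_dbarB2 t : dbarB2 (DL L) id t @[L --> \oo] --> dbarB2 D id t.
Proof.
by apply: cvgn_scale; exact: (@cvgn_sum2 (fun i => (t <= i)%N) (fun i j => (t <= j)%N && (i != j))).
Qed.

Lemma cvg_dbarA t : dbarA (DL L) id t @[L --> \oo] --> dbarA D id t.
Proof.
by apply: cvgn_scale; exact: (@cvgn_sum2 (fun i => (i < t)%N) (fun _ j => (t <= j)%N)).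
Qed.

Lemma cvg_scan1 t : scan1 (DL L) id t @[L --> \oo] --> scan1 D id t.
Proof.
apply: cvgn_scale; apply: cvgB; last by apply: cvgn_scale; exact: cvg_dbarB2.
by apply: cvgB; [exact: cvg_dbarA|apply: cvgn_scale; exact: cvg_dbarB1].
Qed.

Lemma cvg_dbar_row i : dbar_row (DL L) id i @[L --> \oo] --> dbar_row D id i.
Proof. by apply: cvgn_scale; exact: cvgn_sum. Qed.

End Statistics.
End Limits.

(** * The sequence norm as a limit of truncated norms *)

Section HilbertNorm.
Context {R : realType}.
Implicit Types u : nat -> R.

Lemma dot_le_mono u L N : (L <= N)%N -> dot L u u <= dot N u u.
Proof.
move=> LN; rewrite /dot (big_ord_widen N (fun l => u l * u l) LN) [leRHS](bigID (fun l : 'I_N => (l < L)%N)) /=.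
by rewrite lerDl sumr_ge0// => l _; rewrite -expr2 sqr_ge0.
Qed.

(** The bound [c] excludes an infinite sum, which [fine] would turn into 0. *)
Lemma cvg_hnorm u (c : R) : (forall L, dot L u u <= c) ->
  dot L u u @[L --> \oo] --> hnorm u ^+ 2.
Proof.
move=> uc; have nd : nondecreasing_seq (fun L => dot L u u) by move=> L N; exact: dot_le_mono.
have cv : cvg (dot L u u @[L --> \oo]).
  by apply: nondecreasing_is_cvgn => //; exists c => _ [L _ <-].
rewrite /hnorm sqr_sqrtr ?fine_ge0 ?nneseries_ge0//; last by move=> k _ _; rewrite lee_fin sqr_ge0.
rewrite (_ : limn _ = (limn (fun L => dot L u u))%:E) //.
rewrite -EFin_lim//; apply: congr_lim; apply/funext => L /=.
by rewrite /dot -sumEFin big_mkord; apply: eq_bigr => l _; rewrite expr2.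
Qed.

Lemma dot_le_hnorm u c L : (forall L, dot L u u <= c) -> dot L u u <= hnorm u ^+ 2.
Proof.
move=> uc; have cu := @cvg_hnorm u c uc.
apply: (cvgn_ge_frequently cu) => N; exists (maxn N L); first exact: leq_maxl.
by apply: dot_le_mono; exact: leq_maxr.
Qed.

Lemma hnorm_sqr_le u c : (forall L, dot L u u <= c) -> hnorm u ^+ 2 <= c.
Proof. by move=> uc; apply: (cvgn_le (@cvg_hnorm u c uc) (@cvg_cst _ c _ _ _)). Qed.

Lemma hnorm_gt0 u c : (forall L, dot L u u <= c) -> u <> 0 -> 0 < hnorm u.
Proof.
move=> uc u0; rewrite lt_def sqrtr_ge0 andbT; apply/eqP => h0; apply: u0.
apply/funext => l; have := dot_le_hnorm l.+1 uc; rewrite h0 expr0n /=.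
have := coord_le_nrm u (@ord_max l); rewrite /= => cl d0.
have : nrm l.+1 u ^+ 2 = 0.
  by apply/le_anti; rewrite sqr_ge0 sqr_nrm d0.
move=> /eqP; rewrite sqrf_eq0 => /eqP n0; move: cl; rewrite n0 normr_le0 => /eqP.
by [].
Qed.

End HilbertNorm.

(** * From the kernel to bounded features *)

Section KernelFeatures.
Context {R : realType} {disp : measure_display} {X : measurableType disp}.
Variables (d : X -> X -> R) (F0 : probability X R) (y0 : X).
Variables (lambda : nat -> R) (psi : nat -> X -> R).
Let kt := centered_kernel d F0 y0.
Let phi := feature lambda psi.
Hypothesis d_neg : negative_type_semimetric d.
Hypothesis d_exp : eigen_expansion F0 kt lambda psi.

Lemma feature_measurable l : measurable_fun [set: X] (fun z => phi z l).
Proof. by apply: measurable_funM; [exact: measurable_cst|case: d_exp]. Qed.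

Lemma cvg_feature z z' : dot L (phi z) (phi z') @[L --> \oo] --> kt z z'.
Proof.
have [l0 _ _ _ /(_ z z')] := d_exp.
rewrite (_ : (fun L => dot L _ _) = series (fun l => lambda l * psi l z * psi l z'))//.
apply/funext => L; rewrite /dot /series /= big_mkord; apply: eq_bigr => l _.
rewrite /phi /feature mulrACA -expr2 sqr_sqrtr ?l0// mulrA//.
Qed.

(** By symmetry of the base kernel, the centering terms have the form -I(z) - I(z') + c, and they
    cancel under polarization. *)
Lemma kernel_semimetric z z' : kt z z + kt z' z' - 2 * kt z z' = d z z'.
Proof.
have [_ d0 ds _] := d_neg.
have dd a : d a a = 0 by exact/d0.
have bs a b : base_kernel d y0 a b = base_kernel d y0 b a.
  by rewrite /base_kernel (ds a b) (addrC (d a y0)).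
have E a : (\int[F0]_u base_kernel d y0 u a)%R = (\int[F0]_u base_kernel d y0 a u)%R.
  by apply: eq_Rintegral => u _; rewrite bs.
rewrite /kt /centered_kernel !E.
set c := (\int[(F0 \x F0)%E]_p _)%R; set a := (\int[F0]_u _)%R; set b := (\int[F0]_u _)%R.
have -> : base_kernel d y0 z z' = 2^-1 * (d z y0 + d z' y0 - d z z') by [].
have B a' : base_kernel d y0 a' a' = d a' y0.
  by rewrite /base_kernel dd subr0; field.
by rewrite !B; field.
Qed.

Lemma cvg_semimetric z z' :
  dot L (phi z - phi z') (phi z - phi z') @[L --> \oo] --> d z z'.
Proof.
rewrite -kernel_semimetric.
rewrite (_ : (fun L => _) = (fun L => dot L (phi z) (phi z) + dot L (phi z') (phi z')
   - 2 * dot L (phi z) (phi z'))).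
  apply: cvgB; first by apply: cvgD; exact: cvg_feature.
  by apply: cvgn_scale; exact: cvg_feature.
apply/funext => L; move: (phi z) (phi z') => u v.
rewrite !(dotBl, dotBr) (dotC L v u); ring.
Qed.

Variable M : R.
Hypothesis M_gt0 : 0 < M.

(** Stated on truncated norms rather than on the kernel, so that measurability comes from that of
    the eigenfunctions. *)
Definition good : set X := [set z | forall L, dot L (phi z) (phi z) <= M ^+ 2].

(* Equal to the feature map almost surely, but bounded everywhere. *)
Definition tfeat (z : X) : nat -> R := if `[< good z >] then phi z else 0.

Lemma kernel_good z : kt z z <= M ^+ 2 -> good z.
Proof.
move=> kM L; apply: le_trans kM; apply: (cvgn_ge_frequently (@cvg_feature z z)) => N.
exists (maxn N L); first exact: leq_maxl.
by apply: dot_le_mono; exact: leq_maxr.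
Qed.

Lemma good_measurable : measurable good.
Proof.
rewrite (_ : good = \bigcap_L [set z | dot L (phi z) (phi z) <= M ^+ 2]); last first.
  by apply/seteqP; split => [z gz L _|z gz L]; [exact: gz|exact: gz L I].
apply: bigcapT_measurable => L.
have mD : measurable_fun [set: X] (fun z => dot L (phi z) (phi z)).
  by apply: measurable_sum => l; apply: measurable_funM; exact: feature_measurable.
rewrite (_ : [set z | _] = (fun z => dot L (phi z) (phi z)) @^-1` `]-oo, M ^+ 2]%classic).
  by rewrite -[X in measurable X]setTI; exact: mD.
by apply/seteqP; split => z; rewrite /= in_itv.
Qed.

Lemma tfeat_good z : good z -> tfeat z = phi z.
Proof. by move=> gz; rewrite /tfeat; case: asboolP. Qed.

Lemma tfeat_measurable l : measurable_fun [set: X] (fun z => tfeat z l).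
Proof.
rewrite (_ : (fun z => _) = (fun z => (\1_good z : R)) \* (fun z => phi z l)).
  by apply: measurable_funM; [exact: measurable_indic good_measurable|exact: feature_measurable].
apply/funext => z; rewrite /tfeat /= indicE; case: asboolP => gz.
  by rewrite mem_set// mul1r.
by rewrite memNset// mul0r.
Qed.

Lemma tfeat_dot_le L z : dot L (tfeat z) (tfeat z) <= M ^+ 2.
Proof.
rewrite /tfeat; case: asboolP => gz; first exact: gz.
by rewrite dot0l sqr_ge0.
Qed.

Lemma tfeat_nrm L z : nrm L (tfeat z) <= M.
Proof. by apply: nrm_le; [exact: ltW|exact: tfeat_dot_le]. Qed.

Lemma tfeat_bound z l : `|tfeat z l| <= M.
Proof.
by apply: le_trans (tfeat_nrm l.+1 z); exact: (coord_le_nrm (tfeat z) (@ord_max l)).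
Qed.

Section Law.
Context {dispO : measure_display} {Omega : measurableType dispO}
  {P : probability Omega R}.
Variables (Y : {RV P >-> X}) (F : probability X R).
Hypothesis Y_law : same_law (distribution P Y) F.
Hypothesis Y_ae : {ae P, forall w, kt (Y w) (Y w) <= M ^+ 2}.

Lemma ae_good : {ae P, forall w, good (Y w)}.
Proof. by apply: filterS Y_ae => w; exact: kernel_good. Qed.

Lemma law_good : F (~` good) = 0.
Proof.
rewrite -Y_law; last exact: measurableC good_measurable.
have [N [mN PN gN]] := ae_good.
apply/eqP; rewrite eq_le measure_ge0 andbT -PN.
rewrite [X in (X <= _)%E](_ : _ = P (Y @^-1` (~` good)))//; apply: le_measure; rewrite ?inE//.
rewrite -[X in measurable X]setTI; apply: measurable_funP => //.
exact: measurableC good_measurable.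
Qed.

(** The means and variances are integrals of possibly unbounded functions; since [good] has full
    measure under the law, they are expectations of bounded functions of [Y]. *)
Lemma law_integral (G H : X -> R) (c : R) :
  measurable_fun [set: X] G -> measurable_fun [set: X] H -> (forall z, `|H z| <= c) ->
  (forall z, good z -> G z = H z) ->
  (\int[P]_w (H (Y w))%:E = (\int[F]_z G z)%:E)%E.
Proof.
move=> mG mH Hc GH.
have iH : P.-integrable [set: Omega] (EFin \o (H \o Y)).
  by apply: (@bounded_integrable _ _ _ P _ c) => //=; exact: measurableT_comp.
have iHF : (\int[F]_z (H z)%:E = \int[P]_w (H (Y w))%:E)%E.
  rewrite -(@integral_distribution _ _ _ _ _ P Y (EFin \o H)) //; last exact/measurable_EFinP.
  by apply: eq_measure_integral => A mA _; exact/esym/Y_law.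
have -> : (\int[F]_z G z)%R = (\int[F]_z H z)%R.
  rewrite /Rintegral; congr fine; apply: ae_eq_integral => //; try exact/measurable_EFinP.
  exists (~` good); split; [exact: measurableC good_measurable|exact: law_good|].
  by move=> z /= h gz; apply: h => _; rewrite GH.
rewrite /Rintegral iHF fineK//; exact: integrable_fin_num iH.
Qed.

Lemma tfeat_mean l : (\int[P]_w (tfeat (Y w) l)%:E = (feature_mean F phi l)%:E)%E.
Proof.
apply: (@law_integral (fun z => phi z l) (fun z => tfeat z l) M).
- exact: feature_measurable.
- exact: tfeat_measurable.
- by move=> z; exact: tfeat_bound.
- by move=> z gz; rewrite tfeat_good.
Qed.

Lemma tfeat_integrable l : P.-integrable [set: Omega] (EFin \o (fun w => tfeat (Y w) l)).
Proof.
apply: (@bounded_integrable _ _ _ P _ M) => [|w]; last exact: tfeat_bound.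
exact: (measurableT_comp (tfeat_measurable l)).
Qed.

(** Without vector-valued integration: |m|^2 is the expectation of the inner product of m with the
    truncated feature, hence at most |m| M. *)
Lemma mean_nrm L : nrm L (feature_mean F phi) <= M.
Proof.
set m := feature_mean F phi.
have E : (\int[P]_w (dot L m (tfeat (Y w)))%:E = (nrm L m ^+ 2)%:E)%E.
  rewrite sqr_nrm /dot; under eq_integral do rewrite -sumEFin.
  rewrite integral_sum//; last first.
    move=> l; rewrite (_ : (fun w => _) = (fun w => (m l)%:E * (EFin \o (fun w => tfeat (Y w) l)) w)%E).
      by apply: integrableZl => //; exact: tfeat_integrable.
    by apply/funext => w.
  rewrite -sumEFin; apply: eq_bigr => l _.
  transitivity ((m l)%:E * \int[P]_w (tfeat (Y w) l)%:E)%E; last by rewrite tfeat_mean.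
  by rewrite -integralZl//; exact: tfeat_integrable.
have mdot : measurable_fun [set: Omega] (fun w => dot L m (tfeat (Y w))).
  apply: measurable_sum => l; apply: measurable_funM; first exact: measurable_cst.
  exact: (measurableT_comp (tfeat_measurable l)).
have db w : `|dot L m (tfeat (Y w))| <= nrm L m * M.
  by rewrite (le_trans (dot_le _ _ _))// ler_wpM2l ?nrm_ge0// tfeat_nrm.
have H : \int[P]_w dot L m (tfeat (Y w)) <= \int[P]_w (nrm L m * M).
  apply: le_Rintegral => //.
  - exact: (@bounded_integrable _ _ _ P _ (nrm L m * M)).
  - apply: (@bounded_integrable _ _ _ P _ `|nrm L m * M|) => //; exact: measurable_cst.
  - by move=> w _; rewrite (le_trans (ler_norm _))// db.
move: H; rewrite {1}/Rintegral E /= Rintegral_cst//.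
have P1 : fine (P [set: Omega]) <= 1.
  by rewrite -lee_fin fineK; [exact: probability_le1|exact: fin_num_measure].
move=> H; have {}H : nrm L m ^+ 2 <= nrm L m * M.
  by apply: le_trans H _; rewrite ler_piMr// mulr_ge0 ?nrm_ge0// ltW.
have [->|m0] := eqVneq (nrm L m) 0; first exact: ltW.
by move: H; rewrite expr2 ler_pM2l// lt_def m0 nrm_ge0.
Qed.

Lemma tfeat_centered_mean0 l :
  (\int[P]_w (tfeat (Y w) l - feature_mean F phi l)%:E = 0)%E.
Proof.
under eq_integral do rewrite EFinB.
rewrite integralB//; last 2 first.
- exact: tfeat_integrable.
- by apply: (@bounded_integrable _ _ _ P (cst (feature_mean F phi l)) `|feature_mean F phi l|).
rewrite tfeat_mean integral_cst// [X in (_ * X)%E](_ : _ = 1%E) ?mule1 ?subee//.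
exact: probability_setT.
Qed.

Lemma centered_nrm L z : nrm L (tfeat z - feature_mean F phi) <= 2 * M.
Proof.
by rewrite (le_trans (nrmB _ _ _))// [leRHS]mulr_natl [leRHS]mulr2n lerD ?tfeat_nrm ?mean_nrm.
Qed.

End Law.
End KernelFeatures.

(** * Rounded sample sizes *)

Section CeilingSampleSize.
Context {R : realType}.
Implicit Types (n : nat) (r : R).

Lemma nceilE n r : 0 <= r -> (nceil n r)%:R = (Num.ceil (n%:R * r))%:~R :> R.
Proof.
move=> r0; rewrite /nceil -[LHS]/((`|Num.ceil (n%:R * r)|%N : int)%:~R).
by rewrite gez0_abs// ceil_ge0// (lt_le_trans (ltrN10 R))// mulr_ge0.
Qed.

Lemma nceil_ge n r : 0 <= r -> n%:R * r <= (nceil n r)%:R.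
Proof. by move=> r0; rewrite nceilE// ceil_ge. Qed.

Lemma nceil_lt n r : 0 <= r -> (nceil n r)%:R < n%:R * r + 1.
Proof.
by move=> r0; rewrite nceilE// -ltrBlDr -[1]/(1%:~R) -intrB ceilB1_lt.
Qed.

Lemma nceil_mono n r r' : 0 <= r -> r <= r' -> (nceil n r <= nceil n r')%N.
Proof.
move=> r0 rr; have r0' := le_trans r0 rr.
by rewrite -(ler_nat R) !nceilE// ler_int le_ceil// ler_wpM2l.
Qed.

End CeilingSampleSize.

Lemma measurable_nat_preimage {R : realType} {d : measure_display}
    {Omega : measurableType d} {P : probability Omega R}
    (t : {RV P >-> nat}) (Q : set nat) : measurable [set w | Q (t w)].
Proof. by rewrite -[X in measurable X]setTI; exact: (measurable_funP t). Qed.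

(** * The first scan statistic compared with the energy *)

Section Scan1Energy.
Context {R : realType} (L n : nat).

Lemma suffix_nrm (xi : 'I_n -> nat -> R) M t : (forall i, nrm L (xi i) <= M) ->
  (t <= n)%N -> nrm L (suffix xi t) <= (n%:R - t%:R) * M.
Proof.
move=> xM tn; have := prefixB_nrm xM (leqnn n) tn.
rewrite -(prefix_suffix xi tn) addrAC subrr add0r ger0_norm//.
by rewrite subr_ge0 ler_nat.
Qed.

(** From c^2 <= 2 c (c - 1) for c >= 2. *)
Lemma unbiased_correction (v s M : R) (c : R) : 2 <= c -> 0 <= v <= c * M ^+ 2 ->
  0 <= s <= (c * M) ^+ 2 -> `|(c * v - s) / (c * (c - 1))| <= 2 * M ^+ 2.
Proof.
move=> c2 /andP[v0 vM] /andP[s0 sM].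
have c0 : 0 < c * (c - 1) by rewrite mulr_gt0//; lra.
rewrite normrM normfV (gtr0_norm c0) ler_pdivrMr//.
have H : c ^+ 2 * M ^+ 2 <= 2 * M ^+ 2 * (c * (c - 1)).
  rewrite -subr_ge0.
  have -> : 2 * M ^+ 2 * (c * (c - 1)) - c ^+ 2 * M ^+ 2 = M ^+ 2 * (c * (c - 2)) by ring.
  by rewrite mulr_ge0 ?sqr_ge0// mulr_ge0//; lra.
apply: le_trans H; rewrite -exprMn ler_norml; apply/andP; split.
  have : 0 <= c * v by rewrite mulr_ge0//; lra.
  by lra.
have : c * v <= c * (c * M ^+ 2) by rewrite ler_wpM2l//; lra.
by rewrite exprMn expr2; move: s0; lra.
Qed.

Lemma prefix_dot_le (xi : 'I_n -> nat -> R) M t : (forall i, dot L (xi i) (xi i) <= M ^+ 2) ->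
  (t <= n)%N -> 0 <= prefix (fun i => dot L (xi i) (xi i)) t <= t%:R * M ^+ 2.
Proof.
move=> xM tn; apply/andP; split; first by apply: sumr_ge0 => i _; exact: dot_ge0.
rewrite -{2}(card_prefix tn) mulr_natl -sumr_const; apply: ler_sum => i _; exact: xM.
Qed.

Lemma suffix_dot_le (xi : 'I_n -> nat -> R) M t : (forall i, dot L (xi i) (xi i) <= M ^+ 2) ->
  (t <= n)%N -> 0 <= suffix (fun i => dot L (xi i) (xi i)) t <= (n%:R - t%:R) * M ^+ 2.
Proof.
move=> xM tn; apply/andP; split; first by apply: sumr_ge0 => i _; exact: dot_ge0.
rewrite -natrB// -(card_suffix tn) mulr_natl -sumr_const; apply: ler_sum => i _; exact: xM.
Qed.

(** The two sample variances in [scan1_gram] are at most 2 M^2 each, and their weights (n - t) / n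
    and t / n add up to 1. *)
Lemma scan1_energy q (xi : 'I_n -> nat -> R) M t : 0 <= M -> (forall i, nrm L (xi i) <= M) ->
  (1 < t)%N -> (t < n - 1)%N ->
  `|energy L xi t - scan1 (gram L q xi) id t| <= 2 * M ^+ 2.
Proof.
move=> M0 xM t1 tn; have tn' : (t < n)%N by lia.
have xM2 i : dot L (xi i) (xi i) <= M ^+ 2.
  by rewrite -sqr_nrm lerXn2r ?nnegrE ?nrm_ge0.
have t2 : 2 <= t%:R :> R by rewrite ler_nat.
have nt2 : 2 <= n%:R - t%:R :> R by rewrite -natrB ?(ltnW tn')// ler_nat; lia.
rewrite scan1_gram//.
have A1 := unbiased_correction t2 (prefix_dot_le xM2 (ltnW tn'))
  (s := dot L (prefix xi t) (prefix xi t)).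
have A2 := unbiased_correction nt2 (suffix_dot_le xM2 (ltnW tn'))
  (s := dot L (suffix xi t) (suffix xi t)).
have /A1 {}A1 : 0 <= dot L (prefix xi t) (prefix xi t) <= (t%:R * M) ^+ 2.
  rewrite dot_ge0 -sqr_nrm lerXn2r ?nnegrE ?nrm_ge0 ?mulr_ge0//.
  exact: prefix_nrm xM (ltnW tn').
have /A2 {}A2 : 0 <= dot L (suffix xi t) (suffix xi t) <= ((n%:R - t%:R) * M) ^+ 2.
  rewrite dot_ge0 -sqr_nrm lerXn2r ?nnegrE ?nrm_ge0 ?mulr_ge0//; first by lra.
  exact: suffix_nrm xM (ltnW tn').
move: (_ / (t%:R * (t%:R - 1))) A1 => u A1.
move: (_ / ((n%:R - t%:R) * _)) A2 => v A2.
apply: le_trans (ler_normD _ _) _; rewrite !normrM.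
have n0 : 0 < n%:R :> R by rewrite ltr0n; lia.
have -> : 2 * M ^+ 2 = (n%:R - t%:R) / n%:R * (2 * M ^+ 2) + t%:R / n%:R * (2 * M ^+ 2).
  by field; rewrite gt_eqF.
rewrite normfV (gtr0_norm n0) (@ger0_norm _ t%:R)// (@ger0_norm _ (n%:R - t%:R)); last by lra.
by rewrite lerD// ler_wpM2l// divr_ge0// ?(ltW n0)//; lra.
Qed.

Lemma gram_dist (xi : 'I_n -> nat -> R) i j :
  gram L (fun i => dot L (xi i) (xi i)) xi i j = dot L (xi i - xi j) (xi i - xi j).
Proof.
rewrite /gram; move: (xi i) (xi j) => u v.
by rewrite !(dotBl, dotBr) (dotC L v u); ring.
Qed.

End Scan1Energy.

(** * Localization by the first scan statistic *)

Section PartA.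
Context {R : realType} {dispX dispO : measure_display}
  {X : measurableType dispX} {Omega : measurableType dispO}
  {P : probability Omega R}.
Variables (d : X -> X -> R) (F0 F1 : probability X R) (y0 : X).
Variables (lambda : nat -> R) (psi : nat -> X -> R) (M : R) (n tau : nat).
Variable y : 'I_n -> {RV P >-> X}.
Let kt := centered_kernel d F0 y0.
Let phi := feature lambda psi.
Let m0 := feature_mean F0 phi.
Let m1 := feature_mean F1 phi.
Hypothesis d_neg : negative_type_semimetric d.
Hypothesis d_exp : eigen_expansion F0 kt lambda psi.
Hypothesis cp : single_change_point y tau F0 F1.
Hypothesis M_gt0 : 0 < M.
Hypothesis kt_le : forall i, {ae P, forall w, kt (y i w) (y i w) <= M ^+ 2}.
Hypothesis tau_gt0 : (0 < tau)%N.
Hypothesis tau_lt : (tau < n)%N.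

Let f := tfeat lambda psi M.

(** As 0 < tau < n, each law is that of some observation; this is how the almost sure bound on the
    sample reaches [F0] and [F1]. *)
Lemma centered0_nrm L z : nrm L (f z - m0) <= 2 * M.
Proof.
have [_ H _ _] := cp.
exact: (@centered_nrm _ _ _ _ _ _ _ _ d_exp M M_gt0 _ _ _ (y (Ordinal (ltn_trans tau_gt0 tau_lt))) F0
  (H (Ordinal (ltn_trans tau_gt0 tau_lt)) tau_gt0)).
Qed.

Lemma centered1_nrm L z : nrm L (f z - m1) <= 2 * M.
Proof.
have [_ _ H _] := cp.
exact: (@centered_nrm _ _ _ _ _ _ _ _ d_exp M M_gt0 _ _ _ (y (Ordinal tau_lt)) F1 (H (Ordinal tau_lt) (leqnn _))).
Qed.

Lemma mean0_nrm L : nrm L m0 <= M.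
Proof.
have [_ H _ _] := cp.
exact: (@mean_nrm _ _ _ _ _ _ _ _ d_exp M M_gt0 _ _ _ (y (Ordinal (ltn_trans tau_gt0 tau_lt))) F0
  (H (Ordinal (ltn_trans tau_gt0 tau_lt)) tau_gt0)).
Qed.

Lemma mean1_nrm L : nrm L m1 <= M.
Proof.
have [_ _ H _] := cp.
exact: (@mean_nrm _ _ _ _ _ _ _ _ d_exp M M_gt0 _ _ _ (y (Ordinal tau_lt)) F1 (H (Ordinal tau_lt) (leqnn _))).
Qed.

Lemma centered_tfeat_nrm L i z : nrm L (@centered R X n tau m0 m1 f i z) <= 2 * M.
Proof. by rewrite /centered; case: ifP => _; [exact: centered0_nrm|exact: centered1_nrm]. Qed.

Lemma centered_tfeat_mean0 i l :
  (\int[P]_w (@centered R X n tau m0 m1 f i (y i w) l)%:E = 0)%E.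
Proof.
have [_ H0 H1 _] := cp; rewrite /centered; case: (ltnP i tau) => it.
  exact: (@tfeat_centered_mean0 _ _ _ _ _ _ _ _ d_exp M M_gt0 _ _ _ (y i) F0 (H0 i it)).
exact: (@tfeat_centered_mean0 _ _ _ _ _ _ _ _ d_exp M M_gt0 _ _ _ (y i) F1 (H1 i it)).
Qed.

Lemma all_good : {ae P, forall w, forall i, good lambda psi M (y i w)}.
Proof. by apply: filter_forall => i; apply: ae_good d_exp _ _ _ _ _ (@kt_le i). Qed.

Let delta := hnorm (m0 - m1).
Hypothesis m01 : m0 <> m1.

Lemma mean_diff_le L : dot L (m0 - m1) (m0 - m1) <= (2 * M) ^+ 2.
Proof.
rewrite -sqr_nrm lerXn2r ?nnegrE ?nrm_ge0 ?mulr_ge0 ?(ltW M_gt0)//.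
by rewrite (le_trans (nrmB _ _ _))// [leRHS]mulr_natl [leRHS]mulr2n lerD ?mean0_nrm ?mean1_nrm.
Qed.

Lemma delta_gt0 : 0 < delta.
Proof.
apply: (hnorm_gt0 mean_diff_le) => h; apply: m01.
by apply/eqP; rewrite -subr_eq0 h.
Qed.

(** The price of truncation: a factor 2 in [delta ^+ 2], hence 4 in the condition on the sample
    size. *)
Lemma delta_half : exists L0, forall L, (L0 <= L)%N ->
  delta ^+ 2 / 2 <= nrm L (m0 - m1) ^+ 2.
Proof.
have c := cvg_hnorm mean_diff_le.
have : delta ^+ 2 / 2 < delta ^+ 2.
  have : 0 < delta ^+ 2 by rewrite exprn_gt0// delta_gt0.
  by lra.
move=> /(cvgr_gt _ c) [L0 _ H]; exists L0 => L LL.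
by rewrite sqr_nrm; apply/ltW; exact: H.
Qed.

(** Beyond the radius the energy gap is at least 8 M^2, while passing from energy to scan statistic
    costs 2 M^2 at each of the two points. A maximizer cannot fall 4 M^2 below [tau], which lies in
    the scanned range. *)
Lemma scan1_deviation (k x : R) (n0 n1 : nat) :
  let h := k ^+ 5 / 128 in
  0 < k -> k <= 1 -> 2^-1 <= x ->
  (n0 <= tau <= n1)%N -> (1 < n0)%N -> (n1 < n - 1)%N ->
  (forall t, (n0 <= t <= n1)%N -> k * n%:R <= t%:R /\ k * n%:R <= n%:R - t%:R) ->
  256 * x * M ^+ 4 <= h ^+ 2 * delta ^+ 4 * n%:R ->
  exceptional P (6 * expR (- x)) (fun w => forall t,
    attains_max (scan1 d (fun i => y i w)) n0 n1 t ->
    `|t%:R - tau%:R| <= 64 * x * M ^+ 2 / (h ^+ 2 * delta ^+ 2)).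
Proof.
move=> h k0 k1 x2 tn01 n01 n11 kn hn.
have [y_indep _ _ _] := cp.
have h0 : 0 < h by rewrite divr_gt0// exprn_gt0.
have hk : h ^+ 2 <= k.
  have k5 : k ^+ 5 <= k by rewrite exprS ler_piMr ?(ltW k0)// exprn_ile1// ltW.
  have hk' : h <= k by rewrite /h ler_pdivrMr//; lra.
  by rewrite expr2 (le_trans _ hk')// ler_piMr// ?(ltW h0)// (le_trans hk').
have hE : k ^+ 5 / 128 = h by [].
clearbody h.
have d2 : 0 < delta ^+ 2 by rewrite exprn_gt0// delta_gt0.
have h2 : 0 < h ^+ 2 by rewrite exprn_gt0.
have M2 : 0 < M ^+ 2 by rewrite exprn_gt0.
have [L0 HL0] := delta_half.
set r0 := 64 * x * M ^+ 2 / (h ^+ 2 * delta ^+ 2).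
have r0E : r0 * (h ^+ 2 * delta ^+ 2) = 64 * x * M ^+ 2.
  by rewrite /r0 divfK// gt_eqF// mulr_gt0.
have x0 : 0 < x by lra.
have r00 : 0 <= r0.
  by apply: ltW; apply: divr_gt0 (mulr_gt0 (mulr_gt0 _ x0) M2) (mulr_gt0 h2 d2).
clearbody r0.
have n_gt0 : (0 < n)%N by exact: leq_ltn_trans tau_lt.
have N0 : 0 < n%:R :> R by rewrite ltr0n.
have [kt1 kt2] := kn tau tn01.
have b0 : 0 < 2 * M by rewrite mulr_gt0.
pose Gap L w := (forall t : nat, (t <= n)%N -> k * n%:R <= t%:R -> k * n%:R <= n%:R - t%:R ->
       r0 <= `|t%:R - tau%:R| ->
       k / 2 * `|t%:R - tau%:R| * nrm L (m0 - m1) ^+ 2 <=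
       energy L (fun i => f (y i w)) tau - energy L (fun i => f (y i w)) t).
have H L : (L0 <= L)%N -> exceptional P (6 * expR (- x)) (fun w => (L0 <= L)%N /\ Gap L w).
  move=> LL; set D := nrm L (m0 - m1).
  have D2 : delta ^+ 2 / 2 <= D ^+ 2 by exact: HL0.
  have D20 : 0 < D ^+ 2 by rewrite (lt_le_trans _ D2)// divr_gt0.
  have D0 : 0 < D by rewrite lt_def nrm_ge0 andbT; apply: contraTneq D20 => ->; rewrite expr0n ltxx.
  have Db : D <= 2 * M by apply: nrm_le (mean_diff_le L); exact: ltW.
  have C1 : 4 * n%:R * (2 * M) ^+ 2 * x <= (h * n%:R * D ^+ 2 / (2 * M)) ^+ 2.
    have -> : (h * n%:R * D ^+ 2 / (2 * M)) ^+ 2 =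
        h ^+ 2 * n%:R ^+ 2 * (D ^+ 2) ^+ 2 / (4 * M ^+ 2) by field; rewrite gt_eqF.
    rewrite ler_pdivlMr ?mulr_gt0//.
    have D4 : (delta ^+ 2 / 2) ^+ 2 <= (D ^+ 2) ^+ 2.
      by rewrite lerXn2r// ?nnegrE ?sqr_ge0// divr_ge0// sqr_ge0.
    have A1 := ler_wpM2l (mulr_ge0 (ltW h2) (sqr_ge0 n%:R)) D4.
    apply: le_trans A1.
    have A2 := ler_wpM2r (ltW N0) hn.
    rewrite -subr_ge0.
    have -> : h ^+ 2 * n%:R ^+ 2 * (delta ^+ 2 / 2) ^+ 2 -
       4 * n%:R * (2 * M) ^+ 2 * x * (4 * M ^+ 2) =
      (h ^+ 2 * delta ^+ 4 * n%:R * n%:R - 256 * x * M ^+ 4 * n%:R) / 4 by field.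
    by apply: divr_ge0 (ler0n R 4); rewrite subr_ge0; exact: A2.
  have C2 : 4 * (D * (2 * M)) ^+ 2 * x <= r0 * (h * D ^+ 2) ^+ 2.
    have -> : 4 * (D * (2 * M)) ^+ 2 * x = D ^+ 2 * (r0 * (h ^+ 2 * delta ^+ 2) / 4).
      by rewrite r0E; field.
    have -> : r0 * (h * D ^+ 2) ^+ 2 = D ^+ 2 * (r0 * h ^+ 2 * D ^+ 2) by ring.
    rewrite ler_wpM2l ?(ltW D20)//.
    have := ler_wpM2l (mulr_ge0 r00 (ltW h2)) D2.
    have := mulr_ge0 (mulr_ge0 r00 (ltW h2)) (ltW d2).
    by lra.
  have := @change_point_gap _ _ _ _ _ P n y L tau f m0 m1 (2 * M) k y_indep b0
    (@tfeat_measurable _ _ _ _ _ _ _ _ d_exp M)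
    (@centered_tfeat_nrm L) (fun i l => @centered_tfeat_mean0 i l) x r0
    k0 k1 n_gt0 (ltnW tau_lt) D0 Db kt1 kt2.
  rewrite hE => /(_ C1 C2); apply: exceptional_imp => // w [_ G]; split=> //; exact: G.
(* From here on [w] is fixed; the truncated features are the true ones at all its observations, and
   the gap holds for infinitely many [L]. *)
have := exceptional_ae all_good (exceptional_limsup H).
apply: exceptional_imp => // w [Hw gw] t [tn tmax].
rewrite leNgt; apply/negP => rt.
have [kT1 kT2] := kn t tn.
have /andP[t1 t2] := tn; have /andP[u1 u2] := tn01.
have tn' : (t <= n)%N.
  by rewrite (leq_trans t2)// ltnW// (leq_trans n11)// leq_subr.
pose xi i := tfeat lambda psi M (y i w).
pose DL L := gram L (fun i => dot L (xi i) (xi i)) xi.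
have DLc i j : DL L i j @[L --> \oo] --> d (y i w) (y j w).
  rewrite (_ : (fun L => _) = (fun L => dot L (phi (y i w) - phi (y j w)) (phi (y i w) - phi (y j w)))).
    exact: cvg_semimetric d_neg d_exp (y i w) (y j w).
  by apply/funext => L; rewrite /DL gram_dist /xi !tfeat_good.
have c s := cvg_scan1 DLc s.
have cc : scan1 (DL L) id tau - scan1 (DL L) id t @[L --> \oo] -->
   scan1 (fun i j => d (y i w) (y j w)) id tau - scan1 (fun i j => d (y i w) (y j w)) id t.
  by apply: cvgB; exact: c.
have le0 : scan1 (fun i j => d (y i w) (y j w)) id tau -
    scan1 (fun i j => d (y i w) (y j w)) id t <= 0.
  by rewrite subr_le0; exact: tmax.
have : 4 * M ^+ 2 <= scan1 (fun i j => d (y i w) (y j w)) id tau -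
    scan1 (fun i j => d (y i w) (y j w)) id t.
  apply: (cvgn_ge_frequently cc) => N.
  have [L NL [LL GL]] := Hw N; exists L => //.
  have {GL}G := GL t tn' kT1 kT2 (ltW rt).
  have xM i : nrm L (xi i) <= M by exact: (tfeat_nrm lambda psi M_gt0 L (y i w)).
  have E1 : `|energy L xi tau - scan1 (DL L) id tau| <= 2 * M ^+ 2.
    by apply: scan1_energy (ltW M_gt0) xM (leq_trans n01 u1) (leq_ltn_trans u2 n11).
  have E2 : `|energy L xi t - scan1 (DL L) id t| <= 2 * M ^+ 2.
    by apply: scan1_energy (ltW M_gt0) xM (leq_trans n01 t1) (leq_ltn_trans t2 n11).
  (* Uses [h ^+ 2 <= k] and [2^-1 <= x]: the gap at distance [r0] is at least 16 x M^2. *)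
  have A : 8 * M ^+ 2 <= k / 2 * `|t%:R - tau%:R| * nrm L (m0 - m1) ^+ 2.
    apply: (@le_trans _ _ (k / 2 * r0 * (delta ^+ 2 / 2))); last first.
      apply: ler_pM; rewrite ?HL0//.
      - by rewrite !mulr_ge0 ?(ltW k0).
      - by rewrite divr_ge0// sqr_ge0.
      - by rewrite ler_wpM2l ?divr_ge0 ?(ltW k0)// ltW.
    have B1 : h ^+ 2 * (r0 * delta ^+ 2) <= k * (r0 * delta ^+ 2).
      by rewrite ler_wpM2r// mulr_ge0 ?sqr_ge0.
    have B2 : h ^+ 2 * (r0 * delta ^+ 2) = 64 * x * M ^+ 2 by rewrite -r0E; ring.
    have B3 : 2^-1 * M ^+ 2 <= x * M ^+ 2 by rewrite ler_wpM2r// ltW.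
    have -> : k / 2 * r0 * (delta ^+ 2 / 2) = k * (r0 * delta ^+ 2) / 4 by field.
    by move: B1; rewrite B2; lra.
  move: E1 E2; rewrite !ler_norml => /andP[a1 a2] /andP[a3 a4].
  move: (energy L xi tau) (energy L xi t) (scan1 (DL L) id tau) (scan1 (DL L) id t) G a1 a2 a3 a4 A.
  by move: (k / 2 * _ * _) => g e1 e2 s1 s2; lra.
by move=> le4; move: (le_trans le4 le0); rewrite leNgt mulr_gt0.
Qed.

End PartA.

Lemma ltn_pred_leq t n : (t < n - 1)%N -> (t <= n)%N.
Proof. lia. Qed.

Lemma ltn_pred_subn t n : (t < n - 1)%N -> (1 < n - t)%N.
Proof. lia. Qed.

(** * The second scan statistic and its normalization *)

Section Scan2.
Context {R : realType} (n : nat).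
Implicit Types (D : 'I_n -> 'I_n -> R) (t : nat).

(** The square of [scan2] times [shat ^+ 2]: a polynomial in the distances, so it passes to the
    limit, with the same maximizers as [scan2] unless [shat] is 0. *)
Definition sq_scan D t : R :=
  (t * (n - t))%N%:R / n%:R * ((dbarB1 D id t - dbarB2 D id t) / 2) ^+ 2.

Lemma scan2_sq_scan D s t : shat D id != 0 -> scan2 D id s <= scan2 D id t ->
  sq_scan D s <= sq_scan D t.
Proof.
move=> s0; have sp : 0 < shat D id by rewrite lt_def s0 sqrtr_ge0.
have E u : sq_scan D u = (shat D id * scan2 D id u) ^+ 2.
  rewrite /sq_scan /scan2 /T2.
  have -> : shat D id * ((2 * shat D id)^-1 * Num.sqrt ((u * (n - u))%:R / n%:R) *
      `|dbarB1 D id u - dbarB2 D id u|) =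
    Num.sqrt ((u * (n - u))%:R / n%:R) * (`|dbarB1 D id u - dbarB2 D id u| / 2).
    by field.
  rewrite [in RHS]exprMn sqr_sqrtr ?divr_ge0//; congr (_ * _).
  by rewrite !exprMn real_normK ?num_real.
have p u : 0 <= scan2 D id u.
  by rewrite /scan2 /T2 !mulr_ge0// ?sqrtr_ge0// invr_ge0 mulr_ge0// ltW.
move=> st; rewrite !E; apply: lerXn2r; rewrite ?nnegrE.
- exact: mulr_ge0 (ltW sp) (p _).
- exact: mulr_ge0 (ltW sp) (p _).
- by apply: ler_wpM2l; [exact: ltW|].
Qed.

Lemma cvg_sq_scan (DL : nat -> 'I_n -> 'I_n -> R) D t :
  (forall i j, DL L i j @[L --> \oo] --> D i j) ->
  sq_scan (DL L) t @[L --> \oo] --> sq_scan D t.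
Proof.
move=> c; apply: cvgn_scale; rewrite expr2.
under eq_fun do rewrite expr2.
have h : (dbarB1 (DL L) id t - dbarB2 (DL L) id t) / 2 @[L --> \oo] -->
    (dbarB1 D id t - dbarB2 D id t) / 2.
  apply: cvgM; last exact: cvg_cst.
  by apply: cvgB; [exact: cvg_dbarB1|exact: cvg_dbarB2].
by apply: cvgM.
Qed.

(** The witness that [shat] is not 0: equal row averages would make it vanish, whereas at the change
    point the jump in variance keeps it away from 0. *)
Definition row_gap D t : R :=
  prefix (dbar_row D id) t / t%:R - suffix (dbar_row D id) t / (n%:R - t%:R).

Lemma cvg_row_gap (DL : nat -> 'I_n -> 'I_n -> R) D t :
  (forall i j, DL L i j @[L --> \oo] --> D i j) ->
  row_gap (DL L) t @[L --> \oo] --> row_gap D t.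
Proof.
move=> c; apply: cvgB; (apply: cvgM; [|exact: cvg_cst]);
  by apply: cvgn_sum => i; exact: cvg_dbar_row.
Qed.

Lemma shat0_row_gap D t : (0 < t < n)%N -> shat D id = 0 -> row_gap D t = 0.
Proof.
move=> /andP[t0 tn] s0; have n0 : (0 < n)%N by exact: ltn_trans tn.
have cE (A : pred 'I_n) : \sum_(i | A i) dbar_row D id i = #|A|%:R * dbar D id.
  by rewrite mulr_natl -sumr_const; apply: eq_bigr => i _; exact: shat0_dbar_row.
rewrite /row_gap /prefix (cE (fun i => (i < t)%N)) /suffix (cE (fun i => (t <= i)%N)).
rewrite card_prefix ?(ltnW tn)// card_suffix ?(ltnW tn)// natrB ?(ltnW tn)//.
have t1 : t%:R != 0 :> R by rewrite pnatr_eq0 -lt0n.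
have t2 : n%:R - t%:R != 0 :> R by rewrite gt_eqF// subr_gt0 ltr_nat.
by field; rewrite t1 t2.
Qed.

(** Each of the two cross terms costs at most 2 B K e; of the squared errors only the one at the
    second point has the harmful sign. *)
Lemma sq_perturb (b1 b2 c1 c2 e1 e2 B K e : R) :
  0 <= b1 <= B -> 0 <= b2 <= B -> `|c1| <= K -> `|c2| <= K -> `|e1| <= e -> `|e2| <= e ->
  b1 * c1 ^+ 2 - b2 * c2 ^+ 2 - B * (4 * K * e + e ^+ 2) <=
  b1 * (c1 - e1) ^+ 2 - b2 * (c2 - e2) ^+ 2.
Proof.
move=> /andP[b10 b1B] /andP[b20 b2B] c1K c2K e1e e2e.
have K0 : 0 <= K by exact: le_trans c1K.
have e0 : 0 <= e by exact: le_trans e1e.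
have H c f : `|c| <= K -> `|f| <= e -> `|c * f| <= K * e by move=> ? ?; rewrite normrM ler_pM.
have := H _ _ c1K e1e; have := H _ _ c2K e2e.
rewrite !ler_norml => /andP[h1 h2] /andP[h3 h4].
have f2 : e2 ^+ 2 <= e ^+ 2 by rewrite -real_normK ?num_real// lerXn2r// nnegrE.
have A1 : b1 * (c1 * e1) <= B * (K * e).
  by apply: (le_trans (ler_wpM2l b10 h4)); rewrite ler_wpM2r// mulr_ge0.
have A2 : - (B * (K * e)) <= b2 * (c2 * e2).
  rewrite lerNl -mulrN; apply: (@le_trans _ _ (b2 * (K * e))); last by rewrite ler_wpM2r// mulr_ge0.
  by rewrite ler_wpM2l// lerNl.
have A3 : b2 * e2 ^+ 2 <= B * e ^+ 2.
  by rewrite ler_pM// sqr_ge0.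
have A4 : 0 <= b1 * e1 ^+ 2 by rewrite mulr_ge0// sqr_ge0.
have -> : b1 * (c1 - e1) ^+ 2 - b2 * (c2 - e2) ^+ 2 = b1 * c1 ^+ 2 - b2 * c2 ^+ 2
   - 2 * (b1 * (c1 * e1)) + b1 * e1 ^+ 2 + 2 * (b2 * (c2 * e2)) - b2 * e2 ^+ 2 by ring.
have -> : B * (4 * K * e + e ^+ 2) = 4 * (B * (K * e)) + B * e ^+ 2 by ring.
move: A1 A2 A3 A4.
move: (b1 * (c1 * e1)) (b2 * (c2 * e2)) (B * (K * e)) (b1 * e1 ^+ 2) (b2 * e2 ^+ 2) (B * e ^+ 2).
by move=> ? ? ? ? ? ? ? ? ? ?; lra.
Qed.

Lemma cusum_weight_le (k : R) t : 0 < k -> (0 < n)%N ->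
  k * n%:R <= t%:R -> k * n%:R <= n%:R - t%:R ->
  0 <= (cusum_weight n t : R) <= (k ^+ 2 * n%:R)^-1.
Proof.
move=> k0 n0 k1 k2; have N0 : 0 < n%:R :> R by rewrite ltr0n.
have kn : 0 < k * n%:R by rewrite mulr_gt0.
have t0 : 0 < t%:R :> R by exact: lt_le_trans k1.
have t1 : 0 < n%:R - t%:R :> R by exact: lt_le_trans k2.
rewrite /cusum_weight divr_ge0 ?mulr_ge0 ?(ltW t0) ?(ltW t1)//=.
rewrite ler_pdivrMr ?mulr_gt0//.
rewrite [leLHS](_ : _ = (k ^+ 2 * n%:R)^-1 * ((k * n%:R) * (k * n%:R))); last first.
  by field; rewrite !gt_eqF.
apply: ler_wpM2l; first by rewrite invr_ge0 mulr_ge0// sqr_ge0.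
by apply: ler_pM => //; exact: ltW.
Qed.

(** Sharper than [unbiased_correction] in the squared sum [S], whose bound [A] will be of order n
    rather than n^2. The [k] here is to be [k * n]. *)
Lemma unbiased_noise (k c S V A B : R) : 0 < k -> 2 <= c -> k <= c ->
  0 <= S <= A -> 0 <= V <= c * B -> 0 <= B ->
  c * `|(S - V) / (c * (c - 1))| <= 2 * A / k + 2 * B.
Proof.
move=> k0 c2 kc /andP[S0 SA] /andP[V0 VB] B0.
have c1 : 0 < c - 1 by lra.
have c0 : 0 < c by lra.
have A0 : 0 <= A by exact: le_trans SA.
rewrite normrM normfV (gtr0_norm (mulr_gt0 c0 c1)).
have -> : c * (`|S - V| / (c * (c - 1))) = `|S - V| / (c - 1).
  by field; rewrite !gt_eqF.
have h : `|S - V| <= A + c * B.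
  have cB : 0 <= c * B by rewrite mulr_ge0// ltW.
  by rewrite ler_norml; apply/andP; split; lra.
apply: (@le_trans _ _ ((A + c * B) * (2 / c))).
  apply: ler_pM => //; first by rewrite invr_ge0 ltW.
  by rewrite ler_pdivlMr// mulrC ler_pdivrMr//; lra.
have -> : (A + c * B) * (2 / c) = 2 * A / c + 2 * B by field; rewrite gt_eqF.
by rewrite lerD2r ler_wpM2l ?mulr_ge0// lef_pV2.
Qed.

End Scan2.

(** * Gap of the squared second scan on a fixed sample *)

Section Scan2Gram.
Context {R : realType} (L n tau : nat).
Variables (q : 'I_n -> R) (xi : 'I_n -> nat -> R) (v0 v1 k M x : R).
Let D := `|v0 - v1|.
Let h : R := k ^+ 5 / 128.
Let b := 4 * M ^+ 2.
Let noise i := q i - (if (i < tau)%N then v0 else v1).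
Hypothesis k_gt0 : 0 < k.
Hypothesis k_le1 : k <= 1.
Hypothesis M_gt0 : 0 < M.
Hypothesis x_ge : 2^-1 <= x.
Hypothesis n_gt3 : (3 < n)%N.
Hypothesis tau_le : (tau <= n)%N.
Hypothesis v_neq : v0 != v1.
Hypothesis var_diff_le : D <= b.
Hypothesis kD_n : 384 * M ^+ 2 * x <= k * D * n%:R.
Hypothesis noise_le : forall t, `|prefix noise t| <= h * n%:R * D ^+ 2 / b.
Hypothesis xi_le : forall i, nrm L (xi i) <= 2 * M.
Hypothesis walk_le : forall t, dot L (prefix xi t) (prefix xi t) <= 16 * n%:R * M ^+ 2 * x.

Let n_gt0 : (0 < n)%N. Proof. exact: leq_trans n_gt3. Qed.
Let N0 : 0 < n%:R :> R. Proof. by rewrite ltr0n. Qed.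
Let x0 : 0 < x. Proof. by apply: lt_le_trans x_ge; rewrite invr_gt0. Qed.
Let D_gt0 : 0 < D. Proof. by rewrite normr_gt0 subr_eq0. Qed.
Let M2 : 0 < M ^+ 2. Proof. by rewrite exprn_gt0. Qed.
Let b_gt0 : 0 < b. Proof. by rewrite mulr_gt0. Qed.
(** The walk terms of the two segments give 32 and 128, the diagonal terms another 32 by
    [2^-1 <= x]; 200 rounds up the sum. *)
Let err : R := 200 * M ^+ 2 * x / k.
Let err_gt0 : 0 < err. Proof. exact: divr_gt0 (mulr_gt0 (mulr_gt0 (ltr0Sn R 199) M2) x0) k_gt0. Qed.

Lemma noise_level_le : 0 < h <= k ^+ 2 / 128.
Proof.
rewrite (divr_gt0 (exprn_gt0 5 k_gt0) (ltr0Sn R 127))/= ler_wpM2r ?invr_ge0//.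
by rewrite -[5%N]/(2 + 3)%N exprD ler_piMr ?sqr_ge0// exprn_ile1// ltW.
Qed.

Lemma noise_level_le1 : h <= 1 / 128.
Proof.
have /andP[_ h1] := noise_level_le; apply: le_trans h1 _.
by rewrite ler_wpM2r ?invr_ge0// exprn_ile1// ltW.
Qed.

Lemma noise_bound : h * n%:R * D ^+ 2 / b <= h * n%:R * D.
Proof.
have /andP[h0 _] := noise_level_le.
have -> : h * n%:R * D ^+ 2 / b = h * n%:R * D * (D / b) by ring.
apply: ler_piMr; last by rewrite ler_pdivrMr// mul1r.
by apply: mulr_ge0 (ltW D_gt0); apply: mulr_ge0 (ltW h0) _.
Qed.

Lemma scalar_cusumE t : (t <= n)%N ->
  prefix q t - t%:R / n%:R * prefix q n =
  cusum_drift n tau t * (v0 - v1) + (prefix noise t - t%:R / n%:R * prefix noise n).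
Proof.
move=> tn.
have := @cusum_change R R^o n q noise tau v0 v1 t tn tau_le.
by apply => i; rewrite /noise addrC subrK.
Qed.

Lemma scalar_noise_le t : (t <= n)%N ->
  `|prefix noise t - t%:R / n%:R * prefix noise n| <= 2 * (h * n%:R * D).
Proof.
move=> tn; have f1 : 0 <= (t%:R / n%:R : R) <= 1.
  by rewrite divr_ge0//= ler_pdivrMr// mul1r ler_nat.
have /andP[f10 f11] := f1.
have A s : `|prefix noise s| <= h * n%:R * D by exact: le_trans (noise_le s) noise_bound.
apply: le_trans (ler_normB _ _) _; rewrite [leRHS]mulr_natl [leRHS]mulr2n lerD// normrM.
by rewrite ger0_norm// (le_trans _ (A n))// ler_piMl.
Qed.

Lemma scalar_cusum_le t : (t <= n)%N ->
  `|prefix q t - t%:R / n%:R * prefix q n| <= 2 * n%:R * D.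
Proof.
move=> tn; rewrite scalar_cusumE// (le_trans (ler_normD _ _))//.
have := scalar_noise_le tn; have /andP[h0 _] := noise_level_le.
have : 2 * (h * n%:R * D) <= n%:R * D.
  have -> : 2 * (h * n%:R * D) = (2 * h) * (n%:R * D) by ring.
  rewrite ler_piMl ?mulr_ge0 ?(ltW D_gt0)//; have := noise_level_le1; lra.
have : `|cusum_drift n tau t * (v0 - v1)| <= n%:R * D.
  rewrite normrM -/D ler_wpM2r ?(ltW D_gt0)//.
  rewrite /cusum_drift; set m := (minn t tau)%:R.
  have m1 : m <= t%:R :> R by rewrite ler_nat geq_minl.
  have m2 : 0 <= m :> R by [].
  have tn' : t%:R <= n%:R :> R by rewrite ler_nat.
  have p0 : 0 <= t%:R * tau%:R / n%:R :> R by rewrite divr_ge0 ?mulr_ge0.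
  have p1 : t%:R * tau%:R / n%:R <= t%:R :> R.
    by rewrite ler_pdivrMr// ler_wpM2l// ler_nat.
  by rewrite ler_norml; apply/andP; split; lra.
lra.
Qed.

(** The difference between the off-diagonal averages of inner products before and after [t]. *)
Let E t : R := (dot L (prefix xi t) (prefix xi t) - prefix (fun i => dot L (xi i) (xi i)) t) /
    (t%:R * (t%:R - 1)) -
  (dot L (suffix xi t) (suffix xi t) - suffix (fun i => dot L (xi i) (xi i)) t) /
    ((n%:R - t%:R) * (n%:R - t%:R - 1)).

Lemma suffix_walk_le t : (t <= n)%N ->
  dot L (suffix xi t) (suffix xi t) <= 4 * (16 * n%:R * M ^+ 2 * x).
Proof.
move=> tn; set A := 16 * n%:R * M ^+ 2 * x.
have A0 : 0 <= A by apply: mulr_ge0 (ltW x0); apply: mulr_ge0 (ltW M2); apply: mulr_ge0.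
have W s : nrm L (prefix xi s) <= Num.sqrt A by rewrite /nrm ler_sqrt// walk_le.
have -> : suffix xi t = prefix xi n - prefix xi t.
  by rewrite -(prefix_suffix xi tn) addrAC subrr add0r.
rewrite -sqr_nrm (_ : 4 * A = (Num.sqrt A + Num.sqrt A) ^+ 2).
  rewrite lerXn2r ?nnegrE ?nrm_ge0 ?addr_ge0 ?sqrtr_ge0//.
  by rewrite (le_trans (nrmB _ _ _))// lerD.
have -> : (Num.sqrt A + Num.sqrt A) ^+ 2 = 4 * Num.sqrt A ^+ 2 by ring.
by rewrite sqr_sqrtr.
Qed.

(** The factor t (n - t) / n is at most the length of either segment, which cancels one power of
    that length in the corresponding average. *)
Lemma err_le t : (1 < t)%N -> (t < n - 1)%N ->
  k * n%:R <= t%:R -> k * n%:R <= n%:R - t%:R ->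
  `|t%:R * (n%:R - t%:R) / n%:R * E t| <= err.
Proof.
move=> t1 tn kt1 kt2; have tn' := ltn_pred_leq tn.
have t2 : 2 <= t%:R :> R by rewrite ler_nat.
have nt2 : 2 <= n%:R - t%:R :> R by rewrite -natrB// ler_nat ltn_pred_subn.
have kn0 : 0 < k * n%:R by rewrite mulr_gt0.
have xi2 i : dot L (xi i) (xi i) <= (2 * M) ^+ 2.
  by rewrite -sqr_nrm lerXn2r ?nnegrE ?nrm_ge0 ?mulr_ge0// ltW.
set A := 16 * n%:R * M ^+ 2 * x.
have H1 := @unbiased_noise R (k * n%:R) t%:R (dot L (prefix xi t) (prefix xi t))
  (prefix (fun i => dot L (xi i) (xi i)) t) A ((2 * M) ^+ 2) kn0 t2 kt1.
have {}H1 := H1 _ (prefix_dot_le xi2 tn') (sqr_ge0 _).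
have H2 := @unbiased_noise R (k * n%:R) (n%:R - t%:R) (dot L (suffix xi t) (suffix xi t))
  (suffix (fun i => dot L (xi i) (xi i)) t) (4 * A) ((2 * M) ^+ 2) kn0 nt2 kt2.
have {}H2 := H2 _ (suffix_dot_le xi2 tn') (sqr_ge0 _).
have {H1} : t%:R * `|(dot L (prefix xi t) (prefix xi t) - prefix (fun i => dot L (xi i) (xi i)) t) /
    (t%:R * (t%:R - 1))| <= 2 * A / (k * n%:R) + 2 * (2 * M) ^+ 2.
  by apply: H1; rewrite dot_ge0 walk_le.
have {H2} : (n%:R - t%:R) * `|(dot L (suffix xi t) (suffix xi t) - suffix (fun i => dot L (xi i) (xi i)) t) /
    ((n%:R - t%:R) * (n%:R - t%:R - 1))| <= 2 * (4 * A) / (k * n%:R) + 2 * (2 * M) ^+ 2.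
  by apply: H2; rewrite dot_ge0 suffix_walk_le.
rewrite /E; move: (_ / ((n%:R - t%:R) * _)) (_ / (t%:R * (t%:R - 1))) => w u H2 H1.
rewrite normrM (@ger0_norm _ (_ / _)); last by rewrite divr_ge0// mulr_ge0//; lra.
have w0 : t%:R * (n%:R - t%:R) / n%:R <= t%:R :> R.
  rewrite ler_pdivrMr// ler_wpM2l//; lra.
have w1 : t%:R * (n%:R - t%:R) / n%:R <= n%:R - t%:R :> R.
  by rewrite ler_pdivrMr// mulrC ler_wpM2l ?ler_nat//; lra.
have G1 := ler_wpM2r (normr_ge0 u) w0.
have G2 := ler_wpM2r (normr_ge0 w) w1.
apply: (@le_trans _ _ (t%:R * (n%:R - t%:R) / n%:R * (`|u| + `|w|))).
  by rewrite ler_wpM2l ?ler_normB// divr_ge0// mulr_ge0//; lra.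
rewrite mulrDr.
have K1 : 2 * A / (k * n%:R) = 32 * M ^+ 2 * x / k.
  by rewrite /A; field; rewrite !gt_eqF.
have K2 : 2 * (4 * A) / (k * n%:R) = 128 * M ^+ 2 * x / k.
  by rewrite /A; field; rewrite !gt_eqF.
have K3 : M ^+ 2 <= 2 * (M ^+ 2 * x / k).
  have : M ^+ 2 * 2^-1 <= M ^+ 2 * x by rewrite ler_wpM2l// ltW.
  have : M ^+ 2 * x <= M ^+ 2 * x / k.
    by apply: ler_peMr; [exact: mulr_ge0 (ltW M2) (ltW x0)|rewrite invf_ge1].
  by lra.
have K4 : (2 * M) ^+ 2 = 4 * M ^+ 2 by ring.
move: H1 H2; rewrite K1 K2 K4 /err => H1 H2.
have K5 := ltW M2; move: G1 G2 H1 H2 K3 K5.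
have -> : 32 * M ^+ 2 * x / k = 32 * (M ^+ 2 * x / k) by ring.
have -> : 128 * M ^+ 2 * x / k = 128 * (M ^+ 2 * x / k) by ring.
have -> : 200 * M ^+ 2 * x / k = 200 * (M ^+ 2 * x / k) by ring.
move: (M ^+ 2 * x / k) (t%:R * `|u|) ((n%:R - t%:R) * `|w|) => z a1 a2.
move: (_ * `|u|) (_ * `|w|) (M ^+ 2) => a3 a4 m2.
by lra.
Qed.

Lemma sq_scan_gram t : (1 < t)%N -> (t < n - 1)%N ->
  sq_scan (gram L q xi) t = cusum_weight n t *
   ((prefix q t - t%:R / n%:R * prefix q n) - t%:R * (n%:R - t%:R) / n%:R * E t) ^+ 2.
Proof. by move=> t1 tn; rewrite /sq_scan half_diff_gram. Qed.

(** In units of D err / k^2, the constant 4000 makes the energy gap at least 10. The perturbation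
    costs 8 through the cross terms and 1 through the squared error, as err <= n D by [kD_n]; one
    unit is left. *)
Lemma sq_scan_gap t : (1 < t)%N -> (t < n - 1)%N -> (1 < tau)%N -> (tau < n - 1)%N ->
  k * n%:R <= t%:R -> k * n%:R <= n%:R - t%:R ->
  k * n%:R <= tau%:R -> k * n%:R <= n%:R - tau%:R ->
  4000 * M ^+ 2 * x / (k ^+ 4 * D) <= `|t%:R - tau%:R| ->
  k / 2 * `|t%:R - tau%:R| * D ^+ 2 <=
     cusum_weight n tau * (prefix q tau - tau%:R / n%:R * prefix q n) ^+ 2 -
     cusum_weight n t * (prefix q t - t%:R / n%:R * prefix q n) ^+ 2 ->
  D * err / k ^+ 2 <= sq_scan (gram L q xi) tau - sq_scan (gram L q xi) t.
Proof.
move=> t1 tn u1 un kt1 kt2 ku1 ku2 rt G.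
have tn' := ltn_pred_leq tn.
rewrite !sq_scan_gram//.
apply: le_trans (sq_perturb (cusum_weight_le k_gt0 n_gt0 ku1 ku2)
  (cusum_weight_le k_gt0 n_gt0 kt1 kt2) (scalar_cusum_le tau_le) (scalar_cusum_le tn')
  (err_le u1 un ku1 ku2) (err_le t1 tn kt1 kt2)).
move: G; move: (cusum_weight n tau * _) (cusum_weight n t * _) => a1 a2 G.
have A : 10 * (D * err / k ^+ 2) <= k / 2 * `|t%:R - tau%:R| * D ^+ 2.
  have -> : 10 * (D * err / k ^+ 2) = k / 2 * (4000 * M ^+ 2 * x / (k ^+ 4 * D)) * D ^+ 2.
    by rewrite /err; field; rewrite !gt_eqF.
  by rewrite ler_wpM2r ?sqr_ge0// ler_wpM2l ?divr_ge0// ltW.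
have B : (k ^+ 2 * n%:R)^-1 * (4 * (2 * n%:R * D) * err + err ^+ 2) <= 9 * (D * err / k ^+ 2).
  have -> : (k ^+ 2 * n%:R)^-1 * (4 * (2 * n%:R * D) * err + err ^+ 2) =
     8 * (D * err / k ^+ 2) + (err / n%:R) * (err / k ^+ 2) by field; rewrite !gt_eqF.
  have : (err / n%:R) * (err / k ^+ 2) <= D * (err / k ^+ 2).
    apply: ler_wpM2r; first exact: divr_ge0 (ltW err_gt0) (sqr_ge0 k).
    rewrite ler_pdivrMr// /err ler_pdivrMr//.
    have -> : D * n%:R * k = k * D * n%:R by ring.
    apply: le_trans kD_n; rewrite !ler_wpM2r ?(ltW x0) ?(ltW M2)// ler_nat//.
  by rewrite mulrA; lra.
by move: A B G; move: (D * err / k ^+ 2) (k / 2 * _ * _) (_^-1 * _) => *; lra.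
Qed.

(** The scalar noise takes at most D / 4 of the jump and the inner products at most D / 3; the
    latter fixes 384 = 3 * 128 in [kD_n]. *)
Lemma row_gap_ge : (1 < tau)%N -> (tau < n - 1)%N ->
  k * n%:R <= tau%:R -> k * n%:R <= n%:R - tau%:R ->
  D / 3 <= `|row_gap (gram L q xi) tau|.
Proof.
move=> u1 un ku1 ku2.
have tn : (0 < tau < n)%N by rewrite (ltnW u1) (leq_trans un)// leq_subr.
have /andP[t0 tn'] := tn.
rewrite /row_gap row_gap_gram//.
have kn0 : 0 < k * n%:R by rewrite mulr_gt0.
have T0 : 0 < tau%:R :> R by rewrite ltr0n.
have NT0 : 0 < n%:R - tau%:R :> R by rewrite subr_gt0 ltr_nat.
set Q := prefix q tau / tau%:R - suffix q tau / (n%:R - tau%:R).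
set A := 16 * n%:R * M ^+ 2 * x.
have A0 : 0 <= A by apply: mulr_ge0 (ltW x0); apply: mulr_ge0 (ltW M2); apply: mulr_ge0.
have QE : Q = (v0 - v1) + cusum_weight n tau *
    (prefix noise tau - tau%:R / n%:R * prefix noise n).
  have -> : Q = cusum_weight n tau * (prefix q tau - tau%:R / n%:R * prefix q n).
    rewrite /Q -(prefix_suffix q (ltnW tn')) /cusum_weight.
    by field; rewrite !gt_eqF.
  rewrite scalar_cusumE// mulrDr cusum_drift_left// /cusum_weight; congr (_ + _).
  by field; rewrite !gt_eqF.
have Q1 : `|cusum_weight n tau * (prefix noise tau - tau%:R / n%:R * prefix noise n)| <= D / 4.
  have /andP[c0 c1] := cusum_weight_le k_gt0 n_gt0 ku1 ku2.
  rewrite normrM ger0_norm//.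
  apply: (@le_trans _ _ ((k ^+ 2 * n%:R)^-1 * (2 * (h * n%:R * D)))).
    by rewrite ler_pM// scalar_noise_le.
  have -> : (k ^+ 2 * n%:R)^-1 * (2 * (h * n%:R * D)) = h / k ^+ 2 * (2 * D).
    by field; rewrite !gt_eqF.
  have /andP[h0 h1] := noise_level_le.
  have hk : h / k ^+ 2 <= 1 / 128.
    by rewrite ler_pdivrMr ?exprn_gt0//; move: h1; lra.
  have := ler_wpM2r (mulr_ge0 (ler0n R 2) (ltW D_gt0)) hk; have := D_gt0; lra.
have Wn s : nrm L (prefix xi s) <= Num.sqrt A by rewrite /nrm ler_sqrt// walk_le.
have dA u v : nrm L u <= Num.sqrt A -> nrm L v <= 2 * Num.sqrt A -> `|dot L v u| <= 2 * A.
  move=> hu hv; apply: le_trans (dot_le _ _ _) _.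
  apply: (le_trans (ler_pM (nrm_ge0 _ _) (nrm_ge0 _ _) hv hu)).
  by rewrite -mulrA -expr2 sqr_sqrtr.
have P1 : `|dot L (prefix xi tau) (prefix xi n) / tau%:R| <= 2 * A / (k * n%:R).
  rewrite normrM normfV (gtr0_norm T0) ler_pM// ?invr_ge0 ?(ltW T0)//.
    apply: dA => //; apply: le_trans (Wn _) _; rewrite ler_peMl ?sqrtr_ge0// ler1n//.
  by rewrite lef_pV2.
have P2 : `|dot L (suffix xi tau) (prefix xi n) / (n%:R - tau%:R)| <= 2 * A / (k * n%:R).
  rewrite normrM normfV (gtr0_norm NT0) ler_pM// ?invr_ge0 ?(ltW NT0)//.
    apply: dA => //; rewrite /nrm.
    rewrite (_ : 2 * Num.sqrt A = Num.sqrt (4 * A)).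
      by apply: ler_wsqrtr; exact: suffix_walk_le (ltnW tn').
    rewrite -[LHS]ger0_norm ?mulr_ge0 ?sqrtr_ge0// -sqrtr_sqr; congr Num.sqrt.
    by rewrite exprMn sqr_sqrtr//; ring.
  by rewrite lef_pV2.
have P3 : 2 / n%:R * (2 * A / (k * n%:R) + 2 * A / (k * n%:R)) <= D / 3.
  have -> : 2 / n%:R * (2 * A / (k * n%:R) + 2 * A / (k * n%:R)) = 128 * M ^+ 2 * x / (k * n%:R).
    by rewrite /A; field; rewrite !gt_eqF.
  rewrite ler_pdivrMr//; move: kD_n.
  have -> : k * D * n%:R = 3 * (D / 3 * (k * n%:R)) by field.
  by lra.
have P4 : `|2 / n%:R * (dot L (prefix xi tau) (prefix xi n) / tau%:R -
      dot L (suffix xi tau) (prefix xi n) / (n%:R - tau%:R))| <= D / 3.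
  apply: le_trans P3; rewrite normrM ger0_norm ?divr_ge0 ?(ltW N0)//.
  rewrite ler_wpM2l ?divr_ge0 ?(ltW N0)//.
  by apply: le_trans (ler_normB _ _) _; rewrite lerD.
rewrite QE; move: P4 Q1; move: (2 / n%:R * _) (cusum_weight n tau * _) => a c ha hc.
have : D <= `|v0 - v1 + c - a| + `|c| + `|a|.
  have -> : D = `|(v0 - v1 + c - a) - c + a| by congr `|_|; ring.
  apply: le_trans (ler_normD _ _) _; rewrite lerD2r.
  exact: ler_normB.
have := D_gt0; lra.
Qed.

End Scan2Gram.

Lemma prefix_coord {R : realType} n (F : 'I_n -> nat -> R) t l :
  prefix F t l = prefix (fun i => F i l) t.
Proof. by rewrite /prefix; elim/big_rec2: _ => [//|i u v _ <-]. Qed.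

Lemma energy1 {R : realType} n (F : 'I_n -> nat -> R) t :
  energy 1 F t = cusum_weight n t *
    (prefix (fun i => F i 0%N) t - t%:R / n%:R * prefix (fun i => F i 0%N) n) ^+ 2.
Proof. by rewrite /energy /dot big_ord1 -expr2 -!prefix_coord. Qed.

(** * Localization by the second scan statistic *)

Section PartB.
Context {R : realType} {dispX dispO : measure_display}
  {X : measurableType dispX} {Omega : measurableType dispO}
  {P : probability Omega R}.
Variables (d : X -> X -> R) (F0 F1 : probability X R) (y0 : X).
Variables (lambda : nat -> R) (psi : nat -> X -> R) (M : R) (n tau : nat).
Variable y : 'I_n -> {RV P >-> X}.
Let kt := centered_kernel d F0 y0.
Let phi := feature lambda psi.
Let m := feature_mean F0 phi.
Hypothesis d_neg : negative_type_semimetric d.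
Hypothesis d_exp : eigen_expansion F0 kt lambda psi.
Hypothesis cp : single_change_point y tau F0 F1.
Hypothesis M_gt0 : 0 < M.
Hypothesis kt_le : forall i, {ae P, forall w, kt (y i w) (y i w) <= M ^+ 2}.
Hypothesis tau_gt0 : (0 < tau)%N.
Hypothesis tau_lt : (tau < n)%N.
Hypothesis m_eq : m = feature_mean F1 phi.

Let f := tfeat lambda psi M.
Let v0 := feature_var F0 phi.
Let v1 := feature_var F1 phi.

Definition sq_dist (z : X) : R := hnorm (f z - m) ^+ 2.

Lemma tfeat_centered_nrm L z : nrm L (f z - m) <= 2 * M.
Proof. exact: (@centered0_nrm _ _ _ _ _ _ _ _ _ _ _ _ _ _ _ _ d_exp cp). Qed.

Lemma tfeat_centered_dot L z : dot L (f z - m) (f z - m) <= (2 * M) ^+ 2.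
Proof.
rewrite -sqr_nrm lerXn2r ?nnegrE ?nrm_ge0 ?mulr_ge0 ?(ltW M_gt0)//.
exact: tfeat_centered_nrm.
Qed.

Lemma cvg_sq_dist z : dot L (f z - m) (f z - m) @[L --> \oo] --> sq_dist z.
Proof. by apply: cvg_hnorm => L; exact: tfeat_centered_dot. Qed.

Lemma sq_dist_bound z : 0 <= sq_dist z <= 4 * M ^+ 2.
Proof.
rewrite sqr_ge0/=.
have -> : 4 * M ^+ 2 = (2 * M) ^+ 2 by ring.
by apply: hnorm_sqr_le => L; exact: tfeat_centered_dot.
Qed.

Lemma cvg_measurable (g : nat -> X -> R) (h : X -> R) :
  (forall L, measurable_fun [set: X] (g L)) ->
  (forall z, g L z @[L --> \oo] --> h z) -> measurable_fun [set: X] h.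
Proof. by move=> mg gh; apply: (measurable_fun_cvg mg) => z _; exact: gh. Qed.

Lemma sq_dist_measurable : measurable_fun [set: X] sq_dist.
Proof.
apply: (@cvg_measurable (fun L z => dot L (f z - m) (f z - m))); last exact: cvg_sq_dist.
move=> L; apply: measurable_sum => l; apply: measurable_funM;
  by apply: measurable_funB; [exact: tfeat_measurable d_exp _ _|exact: measurable_cst].
Qed.

(** The expansion at (z, z) bounds the partial sums by [kt z z], so the truncated distances converge
    at every z, whether or not z is [good]. *)
Lemma feature_dist_measurable : measurable_fun [set: X] (fun z => hnorm (phi z - m) ^+ 2).
Proof.
apply: (@cvg_measurable (fun L z => dot L (phi z - m) (phi z - m))).
  move=> L; apply: measurable_sum => l; apply: measurable_funM;
    by apply: measurable_funB; [exact: feature_measurable d_exp _|exact: measurable_cst].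
move=> z; apply: (@cvg_hnorm _ _ ((Num.sqrt (kt z z) + M) ^+ 2)) => L.
have kz : dot L (phi z) (phi z) <= kt z z.
  apply: (cvgn_ge_frequently (cvg_feature d_exp (z := z) (z' := z))) => N.
  exists (maxn N L); first exact: leq_maxl.
  by apply: dot_le_mono; exact: leq_maxr.
rewrite -sqr_nrm lerXn2r ?nnegrE ?nrm_ge0 ?addr_ge0 ?sqrtr_ge0 ?(ltW M_gt0)//.
apply: (le_trans (nrmB _ _ _)); apply: lerD; first by rewrite /nrm ler_wsqrtr.
exact: (@mean0_nrm _ _ _ _ _ _ _ _ _ _ _ _ _ _ _ _ d_exp cp).
Qed.

(** Under [F1] too the center is [m], because the two feature means coincide. *)
Lemma sq_dist_mean i :
  (\int[P]_w (sq_dist (y i w))%:E = (if (i < tau)%N then v0 else v1)%:E)%E.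
Proof.
have [_ H0 H1 _] := cp.
have B z : `|sq_dist z| <= 4 * M ^+ 2.
  by have /andP[a c] := sq_dist_bound z; rewrite ger0_norm.
have E z : good lambda psi M z -> hnorm (phi z - m) ^+ 2 = sq_dist z.
  by move=> gz; rewrite /sq_dist /f tfeat_good.
case: (ltnP i tau) => it.
  rewrite (law_integral d_exp (H0 i it) (@kt_le i) feature_dist_measurable
     sq_dist_measurable B E); congr (_%:E).
rewrite (law_integral d_exp (H1 i it) (@kt_le i) feature_dist_measurable
     sq_dist_measurable B E) /v1 /feature_var -m_eq; congr (_%:E).
Qed.

Lemma rv_sq_dist_measurable i : measurable_fun [set: Omega] (fun w => sq_dist (y i w)).
Proof. by apply: (measurableT_comp sq_dist_measurable). Qed.

Lemma rv_sq_dist_integrable i :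
  P.-integrable [set: Omega] (EFin \o (fun w => sq_dist (y i w))).
Proof.
apply: (@bounded_integrable _ _ _ P _ (4 * M ^+ 2)); first exact: rv_sq_dist_measurable.
by move=> w; have /andP[a c] := sq_dist_bound (y i w); rewrite ger0_norm.
Qed.

Lemma var_bound (i : 'I_n) : 0 <= (if (i < tau)%N then v0 else v1) <= 4 * M ^+ 2.
Proof.
have E := sq_dist_mean i; rewrite -!lee_fin -E; apply/andP; split.
  by apply: integral_ge0 => w _; rewrite lee_fin; have /andP[] := sq_dist_bound (y i w).
have B0 : 0 <= 4 * M ^+ 2 by rewrite mulr_ge0// sqr_ge0.
apply: (@le_trans _ _ (\int[P]_w (cst (4 * M ^+ 2)%:E w))%E).
  apply: ge0_le_integral => //.
  - by move=> w _; rewrite lee_fin; have /andP[] := sq_dist_bound (y i w).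
  - by apply/measurable_EFinP; exact: rv_sq_dist_measurable.
  - by move=> w _; rewrite lee_fin; have /andP[] := sq_dist_bound (y i w).
rewrite integral_cst//.
have PT : (P [set: Omega] <= 1)%E by exact: probability_le1.
have Bf : (0 <= (4 * M ^+ 2)%:E)%E by rewrite lee_fin.
by have := lee_wpmul2l Bf PT; rewrite mule1.
Qed.

Lemma v0_bound : 0 <= v0 <= 4 * M ^+ 2.
Proof. by have := var_bound (Ordinal (ltn_trans tau_gt0 tau_lt)); rewrite /= tau_gt0. Qed.

Lemma v1_bound : 0 <= v1 <= 4 * M ^+ 2.
Proof. by have := var_bound (Ordinal tau_lt); rewrite /= ltnn. Qed.

Let sq (z : X) : nat -> R := fun=> sq_dist z.
Let g := @centered R X n tau (fun=> v0) (fun=> v1) sq.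

Lemma sq_centered_nrm i z : nrm 1 (g i z) <= 4 * M ^+ 2.
Proof.
rewrite nrm1 /g /centered.
have -> : (sq z - (if (i < tau)%N then (fun=> v0) else (fun=> v1))) 0%N =
   sq_dist z - (if (i < tau)%N then v0 else v1) by case: ifP.
have /andP[a1 a2] := sq_dist_bound z; have /andP[b1 b2] := var_bound i.
by move: b1 b2; case: ifP => _ b1 b2; rewrite ler_norml; apply/andP; split; lra.
Qed.

Lemma sq_centered_mean0 i (l : 'I_1) : (\int[P]_w (g i (y i w) l)%:E = 0)%E.
Proof.
rewrite /g /centered.
transitivity (\int[P]_w ((sq_dist (y i w))%:E - (if (i < tau)%N then v0 else v1)%:E))%E.
  by apply: eq_integral => w _; rewrite -EFinB; case: ifP.
set c := (if _ then _ else _).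
rewrite integralB//; last 2 first.
- exact: rv_sq_dist_integrable.
- by apply: (@bounded_integrable _ _ _ P (cst c) `|c|).
rewrite sq_dist_mean integral_cst// [X in (_ * X)%E](_ : _ = 1%E) ?mule1 ?subee//.
exact: probability_setT.
Qed.

(** This matrix differs from the truncated squared distances only by the tails of the two squared
    norms, which tend to 0. *)
Lemma cvg_sq_gram z z' : good lambda psi M z -> good lambda psi M z' ->
  sq_dist z + sq_dist z' - 2 * dot L (f z - m) (f z' - m) @[L --> \oo] --> d z z'.
Proof.
move=> gz gz'.
have c1 := @cvg_sq_dist z; have c2 := @cvg_sq_dist z'.
have c3 := cvg_semimetric d_neg d_exp (z := z) (z' := z').
rewrite (_ : (fun L => _) = (fun L => (sq_dist z - dot L (f z - m) (f z - m)) +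
   (sq_dist z' - dot L (f z' - m) (f z' - m)) + dot L (phi z - phi z') (phi z - phi z'))).
  rewrite -[X in _ --> X]add0r -[X in _ --> X + _]addr0 -{1}(subrr (sq_dist z)) -(subrr (sq_dist z')).
  by apply: cvgD; [apply: cvgD; apply: cvgB => //; exact: cvg_cst|].
apply/funext => L; rewrite /f !tfeat_good//.
have -> : phi z - phi z' = (phi z - m) - (phi z' - m).
  by rewrite opprB addrA subrK.
rewrite -[feature lambda psi z]/(phi z) -[feature lambda psi z']/(phi z').
move: (phi z - m) (phi z' - m) => u v.
by rewrite !(dotBl, dotBr) (dotC L v u); ring.
Qed.

Hypothesis v_neq : v0 != v1.
Let D := `|v0 - v1|.

Lemma var_diff_le : D <= 4 * M ^+ 2.
Proof.
have /andP[a1 a2] := v0_bound; have /andP[b1 b2] := v1_bound.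
by rewrite /D ler_norml; apply/andP; split; lra.
Qed.

(** Beyond the first summand of the radius the scalar energy has its linear gap; beyond the second
    the gap exceeds the perturbation. The probability is 6 exp(-x) for the scalars and 2 exp(-x) for
    the vector walk. *)
Lemma scan2_deviation (k x : R) (n0 n1 : nat) :
  let h := k ^+ 5 / 128 in
  0 < k -> k <= 1 -> 2^-1 <= x ->
  (n0 <= tau <= n1)%N -> (1 < n0)%N -> (n1 < n - 1)%N ->
  (forall t, (n0 <= t <= n1)%N -> k * n%:R <= t%:R /\ k * n%:R <= n%:R - t%:R) ->
  1024 * x * M ^+ 8 <= h ^+ 2 * D ^+ 4 * n%:R ->
  384 * M ^+ 2 * x <= k * D * n%:R ->
  exceptional P (8 * expR (- x)) (fun w => forall t,
    attains_max (scan2 d (fun i => y i w)) n0 n1 t ->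
    `|t%:R - tau%:R| <= 64 * x * M ^+ 4 / (h ^+ 2 * D ^+ 2) +
       4000 * M ^+ 2 * x / (k ^+ 4 * D)).
Proof.
move=> h k0 k1 x2 tn01 n01 n11 kn hn kD.
have [y_indep _ _ _] := cp.
have h0 : 0 < h by rewrite divr_gt0// exprn_gt0.
have D0 : 0 < D by rewrite normr_gt0 subr_eq0.
have x0 : 0 < x by lra.
have n_gt0 : (0 < n)%N by exact: leq_ltn_trans tau_lt.
have N0 : 0 < n%:R :> R by rewrite ltr0n.
have M2 : 0 < M ^+ 2 by rewrite exprn_gt0.
have b0 : 0 < 4 * M ^+ 2 by rewrite mulr_gt0.
have [ku1 ku2] := kn tau tn01.
have /andP[u1 u2] := tn01.
have u1' := leq_trans n01 u1.
have u2' := leq_ltn_trans u2 n11.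
have n3 : (3 < n)%N by move: u1' u2'; clear; lia.
have Dn : nrm 1 ((fun=> v0) - (fun=> v1)) = D by rewrite nrm1.
set r0 := 64 * x * M ^+ 4 / (h ^+ 2 * D ^+ 2).
set r1 := 4000 * M ^+ 2 * x / (k ^+ 4 * D).
have r0_ge : 0 <= r0.
  by apply: ltW; apply: divr_gt0; apply: mulr_gt0; rewrite ?exprn_gt0//; exact: mulr_gt0.
have r1_ge : 0 <= r1.
  apply: ltW; apply: divr_gt0 (mulr_gt0 (mulr_gt0 _ M2) x0) (mulr_gt0 _ D0).
    by rewrite ltr0n.
  exact: exprn_gt0.
have C1 : 4 * n%:R * (4 * M ^+ 2) ^+ 2 * x <= (h * n%:R * D ^+ 2 / (4 * M ^+ 2)) ^+ 2.
  have -> : (h * n%:R * D ^+ 2 / (4 * M ^+ 2)) ^+ 2 =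
     (h ^+ 2 * D ^+ 4 * n%:R) * n%:R / (16 * M ^+ 4) by field; rewrite gt_eqF.
  rewrite ler_pdivlMr ?mulr_gt0 ?exprn_gt0//.
  apply: le_trans (ler_wpM2r (ltW N0) hn).
  by rewrite le_eqVlt; apply/orP; left; apply/eqP; ring.
have C2 : 4 * (D * (4 * M ^+ 2)) ^+ 2 * x <= r0 * (h * D ^+ 2) ^+ 2.
  by rewrite le_eqVlt; apply/orP; left; apply/eqP; rewrite /r0; field; rewrite !gt_eqF.
have sm l : measurable_fun [set: X] (sq ^~ l) by exact: sq_dist_measurable.
(* The squared distances form a one-dimensional walk, so this event does not involve the
   truncation. *)
have := @change_point_gap _ _ _ _ _ P n y 1 tau sq (fun=> v0) (fun=> v1) (4 * M ^+ 2) k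
  y_indep b0 sm sq_centered_nrm sq_centered_mean0 x r0 k0 k1 n_gt0 (ltnW tau_lt).
rewrite Dn -/h => /(_ D0 var_diff_le ku1 ku2 C1 C2) ES.
pose c := Num.sqrt (16 * n%:R * M ^+ 2 * x).
have A0 : 0 < 16 * n%:R * M ^+ 2 * x by apply: mulr_gt0 x0; apply: mulr_gt0 M2; apply: mulr_gt0.
have c0 : 0 < c by rewrite sqrtr_gt0.
pose gv (i : 'I_n) (z : X) := f z - m.
have gvm i l : measurable_fun [set: X] (fun z => gv i z l).
  by apply: measurable_funB; [exact: tfeat_measurable d_exp _ _|exact: measurable_cst].
have gv0 L i (l : 'I_L) : (\int[P]_w (gv i (y i w) l)%:E = 0)%E.
  have [_ H0 H1 _] := cp; rewrite /gv /f; case: (ltnP i tau) => it.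
    exact: (tfeat_centered_mean0 d_exp M_gt0 (H0 i it)).
  rewrite m_eq; exact: (tfeat_centered_mean0 d_exp M_gt0 (H1 i it)).
have b2 : 0 < 2 * M by rewrite mulr_gt0.
have xc : 4 * n%:R * (2 * M) ^+ 2 * x <= c ^+ 2.
  rewrite sqr_sqrtr ?(ltW A0)// le_eqVlt; apply/orP; left; apply/eqP; ring.
have EV L : (0 <= L)%N -> exceptional P (2 * expR (- x)) (fun w => forall t, nrm L (walk y gv w t) < c).
  by move=> _; exact: (walk_norm y_indep b2 gvm (fun i z => tfeat_centered_nrm L z) (gv0 L) c0 xc).
have := exceptional_ae (all_good d_exp kt_le) (exceptional_and ES (exceptional_limsup EV)).
apply: exceptional_imp.
  by rewrite -mulrDl -natrD.
move=> w [[[Hs Hgap] Hv] gw] t [tn tmax].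
rewrite leNgt; apply/negP => rt.
have [kt1 kt2] := kn t tn.
have /andP[t1 t2] := tn.
have t1' := leq_trans n01 t1.
have t2' := leq_ltn_trans t2 n11.
pose q i := sq_dist (y i w).
pose xi i := f (y i w) - m.
pose DL L := gram L q xi.
pose Dw i j := d (y i w) (y j w).
have DLc i j : DL L i j @[L --> \oo] --> Dw i j.
  by apply: cvg_sq_gram; exact: gw.
have nE s : prefix (fun i : 'I_n => q i - (if (i < tau)%N then v0 else v1)) s = walk y g w s 0%N.
  by rewrite /walk prefix_coord; apply: eq_bigr => i _; rewrite /g /centered /sq; case: ifP.
have noise_le s : `|prefix (fun i : 'I_n => q i - (if (i < tau)%N then v0 else v1)) s| <=
    h * n%:R * D ^+ 2 / (4 * M ^+ 2).
  by have := ltW (Hs s); rewrite nrm1 nE.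
have walk_le L : (forall t, nrm L (walk y gv w t) < c) -> forall s,
    dot L (prefix xi s) (prefix xi s) <= 16 * n%:R * M ^+ 2 * x.
  move=> H s; rewrite -sqr_nrm -[leRHS]sqr_sqrtr ?(ltW A0)//.
  by rewrite lerXn2r ?nnegrE ?nrm_ge0 ?sqrtr_ge0//; exact: ltW (H s).
have xi_le L i : nrm L (xi i) <= 2 * M by exact: tfeat_centered_nrm.
have shat_neq : shat Dw id != 0.
  apply/eqP => s0; have tr : (0 < tau < n)%N by rewrite (ltnW u1').
  have := shat0_row_gap tr s0 => rg0.
  have cn : `|row_gap (DL L) tau| @[L --> \oo] --> `|row_gap Dw tau|.
    by apply: cvg_norm; exact: cvg_row_gap.
  have : D / 3 <= `|row_gap Dw tau|.
    apply: (cvgn_ge_frequently cn) => N; have [L NL HL] := Hv N; exists L => //.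
    exact: (@row_gap_ge R L n tau q xi v0 v1 k M x k0 k1 M_gt0 x2 n3 (ltnW tau_lt)
      v_neq var_diff_le kD noise_le (walk_le L HL) u1' u2' ku1 ku2).
  by rewrite rg0 normr0 leNgt divr_gt0.
have le_sq : sq_scan Dw tau <= sq_scan Dw t.
  by apply: scan2_sq_scan => //; exact: tmax.
have cd : sq_scan (DL L) tau - sq_scan (DL L) t @[L --> \oo] --> sq_scan Dw tau - sq_scan Dw t.
  by apply: cvgB; exact: cvg_sq_scan.
have tn' : (t <= n)%N by exact: ltn_pred_leq t2'.
have rt0 : r0 <= `|t%:R - tau%:R| by apply: le_trans (ltW rt); rewrite lerDl.
have rt1 : r1 <= `|t%:R - tau%:R| by apply: le_trans (ltW rt); rewrite lerDr.
have G := Hgap t tn' kt1 kt2 rt0.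
rewrite !energy1 in G.
pose err := 200 * M ^+ 2 * x / k.
have : D * err / k ^+ 2 <= sq_scan Dw tau - sq_scan Dw t.
  apply: (cvgn_ge_frequently cd) => N; have [L NL HL] := Hv N; exists L => //.
  exact: (@sq_scan_gap R L n tau q xi v0 v1 k M x k0 k1 M_gt0 x2 n3 (ltnW tau_lt)
      v_neq var_diff_le kD noise_le (xi_le L) (walk_le L HL) t t1' t2' u1' u2' kt1 kt2 ku1 ku2 rt1 G).
have : 0 < D * err / k ^+ 2.
  apply: divr_gt0; last by rewrite exprn_gt0.
  by apply: mulr_gt0 D0 _; exact: divr_gt0 (mulr_gt0 (mulr_gt0 (ltr0Sn R 199) M2) x0) k0.
by move=> /lt_le_trans h1 /h1; rewrite subr_gt0 ltNge le_sq.
Qed.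

End PartB.

(** * Margins, thresholds and the final radius *)

Section Radius.
Context {R : realType}.

(** From exp(-x) >= 1 - x >= 1/2; it disposes of small [x]. *)
Lemma expRN_half (c x : R) : 2 <= c -> x <= 2^-1 -> 1 - c * expR (- x) <= 0.
Proof.
move=> c2 x2; have e := expR_ge1Dx (- x).
have : 2 * expR (- x) <= c * expR (- x) by rewrite ler_wpM2r// expR_ge0.
by lra.
Qed.

Lemma add_mul_le (p q a b : R) : 0 <= p -> 0 <= q -> 0 <= a -> 0 <= b ->
  p * a + q * b <= (p + q) * (a + b).
Proof.
move=> p0 q0 a0 b0; have := mulr_ge0 p0 b0; have := mulr_ge0 q0 a0.
by rewrite mulrDl !mulrDr; lra.
Qed.

Lemma ler_normB_nat (s t n : nat) : (s <= n)%N -> (t <= n)%N ->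
  `|s%:R - t%:R| <= n%:R :> R.
Proof.
move=> sn tn; have : s%:R <= n%:R :> R by rewrite ler_nat.
have : t%:R <= n%:R :> R by rewrite ler_nat.
have : 0 <= s%:R :> R by []. have : 0 <= t%:R :> R by [].
by move=> *; rewrite ler_norml; apply/andP; split; lra.
Qed.

Lemma scaled_radius (s t : R) (n : nat) c z : (0 < n)%N ->
  `|s - t| <= c * z -> `|(s - t) / n%:R| <= c / n%:R * z.
Proof.
move=> n0 st; rewrite normrM normfV normr_nat ler_pdivrMr ?ltr0n//.
by rewrite mulrAC divfK// pnatr_eq0 -lt0n.
Qed.

Variables (rho0 rhos rho1 : R).
Hypothesis h0 : 0 < rho0.
Hypothesis h0s : rho0 < rhos.
Hypothesis hs1 : rhos < rho1.
Hypothesis h1 : rho1 < 1.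

(** The halving absorbs the unit that the ceiling may add to n rho1. *)
Definition margin : R := Num.min rho0 ((1 - rho1) / 2).

Lemma margin_gt0 : 0 < margin.
Proof. by rewrite /margin lt_min h0 divr_gt0// subr_gt0. Qed.

Lemma margin_le1 : margin <= 1.
Proof. rewrite /margin ge_min; apply/orP; left; have := h0; have := h0s; have := hs1; have := h1; lra. Qed.

Lemma margin_le0 : margin <= rho0.
Proof. by rewrite /margin ge_min lexx. Qed.

Lemma margin_le2 : 2 * margin <= 1 - rho1.
Proof.
have : margin <= (1 - rho1) / 2 by rewrite /margin ge_min lexx orbT.
lra.
Qed.

Lemma change_between n : (nceil n rho0 <= nceil n rhos <= nceil n rho1)%N.
Proof. apply/andP; split; apply: nceil_mono; [exact: ltW|exact: ltW|exact/ltW/(lt_trans h0)|exact: ltW]. Qed.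

Lemma margin_between n t : (nceil n rho1 < n - 1)%N ->
  (nceil n rho0 <= t <= nceil n rho1)%N ->
  margin * n%:R <= t%:R /\ margin * n%:R <= n%:R - t%:R.
Proof.
move=> n1 /andP[t0 t1].
have n0 : 0 <= n%:R :> R by [].
have A1 := ler_wpM2r n0 margin_le0; have A2 := ler_wpM2r n0 margin_le2.
have r0 := ltW h0; have r1 := ltW (lt_trans h0 (lt_trans h0s hs1)).
have B0 := nceil_ge n r0; have B1 := nceil_lt n r1.
have t0' : (nceil n rho0)%:R <= t%:R :> R by rewrite ler_nat.
have t1' : t%:R <= (nceil n rho1)%:R :> R by rewrite ler_nat.
have n1' : (nceil n rho1)%:R + 2 <= n%:R :> R.
  by rewrite -natrD ler_nat; move: n1; clear; lia.
rewrite mulrC in B0; rewrite mulrC in B1.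
by split; lra.
Qed.

Lemma margin_large n : 2 <= margin * n%:R ->
  (1 < nceil n rho0)%N /\ (nceil n rho1 < n - 1)%N.
Proof.
move=> n2; have n0 : 0 <= n%:R :> R by [].
have A1 := ler_wpM2r n0 margin_le0; have A2 := ler_wpM2r n0 margin_le2.
have r0 := ltW h0; have r1 := ltW (lt_trans h0 (lt_trans h0s hs1)).
have B0 := nceil_ge n r0; have B1 := nceil_lt n r1.
rewrite mulrC in B0; rewrite mulrC in B1.
split; first by rewrite -(ler_nat R); lra.
have : (nceil n rho1)%:R + 1 < n%:R :> R by lra.
by rewrite natr1 ltr_nat; clear; lia.
Qed.

Lemma archimedean_nat (a b : R) : 0 < a -> exists N : nat, forall n : nat, (N <= n)%N ->
  b <= a * n%:R.
Proof.
move=> a0; exists (Num.bound (`|b| / a)) => n Nn.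
have := archi_boundP (divr_ge0 (normr_ge0 b) (ltW a0)).
have : (Num.bound (`|b| / a))%:R <= n%:R :> R by rewrite ler_nat.
move=> H1 H2; have : `|b| / a <= n%:R by lra.
by rewrite ler_pdivrMr// mulrC; apply: le_trans; exact: ler_norm.
Qed.

End Radius.

(** * Choice of the constants and conclusion *)

Theorem theorem4p3 (R : realType) (rho0 rhos rho1 : R)
    (h0 : 0 < rho0) (h0s : rho0 < rhos) (hs1 : rhos < rho1) (h1 : rho1 < 1) :
  (exists C1 : R,
     forall (dispX : measure_display) (X : measurableType dispX)
       (d : X -> X -> R) (F0 F1 : probability X R) (y0 : X)
       (lambda : nat -> R) (psi : nat -> X -> R) (M x : R) (n : nat)
       (dispO : measure_display) (Omega : measurableType dispO)
       (P : probability Omega R) (y : 'I_n -> {RV P >-> X})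
       (tauhat : {RV P >-> nat}),
     let kt := centered_kernel d F0 y0 in
     let phi := feature lambda psi in
     let mu0 := feature_mean F0 phi in
     let mu1 := feature_mean F1 phi in
     let delta := hnorm (fun l => mu0 l - mu1 l) in
     let n0 := nceil n rho0 in
     let n1 := nceil n rho1 in
     let taus := nceil n rhos in
     negative_type_semimetric d ->
     (forall z, F0.-integrable [set: X] (fun u => (d u z)%:E)) ->
     eigen_expansion F0 kt lambda psi ->
     single_change_point y taus F0 F1 ->
     0 < M ->
     (forall i, {ae P, forall w, kt (y i w) (y i w) <= M ^+ 2}) ->
     mu0 <> mu1 ->
     0 < x ->
     (1 < n0)%N -> (n1 < n - 1)%N ->
     (forall w, attains_max (scan1 d (fun i => y i w)) n0 n1 (tauhat w)) ->
     ((1 - 22 * expR (- x))%:E <=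
      P [set w | `|((tauhat w)%:R - taus%:R) / n%:R| <=
           C1 / n%:R * (M ^+ 2 * x / delta ^+ 2 + M ^+ 4 * x / delta ^+ 4)]%R)%E)
  /\
  (exists C2 : R,
     forall (v0 v1 M x : R), v0 != v1 -> 0 < M -> 0 < x ->
     exists N : nat, forall n : nat, (N <= n)%N ->
     forall (dispX : measure_display) (X : measurableType dispX)
       (d : X -> X -> R) (F0 F1 : probability X R) (y0 : X)
       (lambda : nat -> R) (psi : nat -> X -> R)
       (dispO : measure_display) (Omega : measurableType dispO)
       (P : probability Omega R) (y : 'I_n -> {RV P >-> X})
       (tauhat : {RV P >-> nat}),
     let kt := centered_kernel d F0 y0 in
     let phi := feature lambda psi in
     let n0 := nceil n rho0 in
     let n1 := nceil n rho1 in
     let taus := nceil n rhos in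
     negative_type_semimetric d ->
     (forall z, F0.-integrable [set: X] (fun u => (d u z)%:E)) ->
     eigen_expansion F0 kt lambda psi ->
     single_change_point y taus F0 F1 ->
     (forall i, {ae P, forall w, kt (y i w) (y i w) <= M ^+ 2}) ->
     feature_mean F0 phi = feature_mean F1 phi ->
     feature_var F0 phi = v0 ->
     feature_var F1 phi = v1 ->
     (forall w, attains_max (scan2 d (fun i => y i w)) n0 n1 (tauhat w)) ->
     ((1 - 16 * expR (- x))%:E <=
      P [set w | `|((tauhat w)%:R - taus%:R) / n%:R| <=
           C2 / n%:R * (M ^+ 4 * x / `|v0 - v1| ^+ 2 + M ^+ 2 * x / `|v0 - v1|)]%R)%E).
Proof.
set k := margin rho0 rho1; set h := k ^+ 5 / 128.
have k0 : 0 < k by exact: margin_gt0.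
have k1 : k <= 1 by exact: margin_le1 h0 h0s hs1 h1.
have kh : 0 < h by rewrite divr_gt0// exprn_gt0.
have rs0 : 0 <= rhos by rewrite ltW// (lt_trans h0).
have rs1 : rhos <= 1 by rewrite ltW// (lt_trans hs1).
split.
  exists (256 / h ^+ 2).
  move=> dispX X d F0 F1 y0 lambda psi M x n dispO Omega P y tauhat kt phi mu0 mu1
    delta n0 n1 taus d_neg _ d_exp cp M0 kt_le mu01 x0 n01 n11 tmax.
  have [x2|x2] := leP x 2^-1.
    apply: le_trans (measure_ge0 P _); rewrite lee_fin.
    by apply: expRN_half x2; rewrite ler_nat.
  have tn01 : (n0 <= taus <= n1)%N by exact: change_between.
  have /andP[u1 u2] := tn01.
  have tau_gt0 : (0 < taus)%N by rewrite (leq_trans _ u1)// ltnW.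
  have tau_lt : (taus < n)%N by rewrite (leq_ltn_trans u2)// (leq_trans n11)// leq_subr.
  have n_gt0 : (0 < n)%N by exact: leq_ltn_trans tau_lt.
  have kn t : (n0 <= t <= n1)%N -> k * n%:R <= t%:R /\ k * n%:R <= n%:R - t%:R.
    exact: (margin_between h0 h0s hs1 n11).
  have delta0 : 0 < delta.
    exact: (@delta_gt0 R dispX dispO X Omega P d F0 F1 y0 lambda psi M n taus y).
  set a := M ^+ 2 * x / delta ^+ 2; set c := M ^+ 4 * x / delta ^+ 4.
  have a0 : 0 <= a by rewrite divr_ge0 ?mulr_ge0 ?exprn_ge0 ?(ltW M0) ?(ltW x0) ?(ltW delta0).
  have c0 : 0 <= c by rewrite divr_ge0 ?mulr_ge0 ?exprn_ge0 ?(ltW M0) ?(ltW x0) ?(ltW delta0).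
  have C0 : 0 <= 256 / h ^+ 2 by rewrite divr_ge0// sqr_ge0.
  have H : exceptional P (6 * expR (- x)) (fun w =>
      `|(tauhat w)%:R - taus%:R| <= 256 / h ^+ 2 * (a + c) :> R).
    (* If the sample is too small for the noise estimates, n itself is below the constant times [c],
       and |tauhat - taus| <= n suffices. This accounts for the second term of the radius and lets
       the bound hold for every [n]. *)
    have [hn|hn] := leP (256 * x * M ^+ 4) (h ^+ 2 * delta ^+ 4 * n%:R).
      apply: exceptional_imp (@scan1_deviation R dispX dispO X Omega P d F0 F1 y0
        lambda psi M n taus y d_neg d_exp cp M0 kt_le tau_gt0 tau_lt mu01 k x n0 n1
        k0 k1 (ltW x2) tn01 n01 n11 kn hn) => // w /(_ _ (tmax w)).
      move=> /le_trans; apply.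
      rewrite [leLHS](_ : _ = 64 * x * M ^+ 2 / (h ^+ 2 * delta ^+ 2))//.
      have -> : 64 * x * M ^+ 2 / (h ^+ 2 * delta ^+ 2) = 64 / h ^+ 2 * a.
        by rewrite /a; move: (h) (delta) kh delta0 => h' d' *; field; rewrite !gt_eqF.
      apply: ler_pM => //; [by rewrite divr_ge0// sqr_ge0| |by rewrite lerDl].
      by rewrite ler_wpM2r ?invr_ge0 ?sqr_ge0// ler_nat.
    exists set0; split => //; first by rewrite measure0 lee_fin mulr_ge0// expR_ge0.
    move=> w _; have [/andP[t1 t2] _] := tmax w.
    have tn : (tauhat w <= n)%N.
      by rewrite (leq_trans t2)// ltnW// (leq_trans n11)// leq_subr.
    apply: (le_trans (ler_normB_nat tn (ltnW tau_lt))).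
    apply: (@le_trans _ _ (256 / h ^+ 2 * c)).
      have -> : 256 / h ^+ 2 * c = 256 * x * M ^+ 4 / (h ^+ 2 * delta ^+ 4).
        by rewrite /c; move: (h) (delta) kh delta0 => h' d' *; field; rewrite !gt_eqF.
      by rewrite ler_pdivlMr ?mulr_gt0 ?exprn_gt0// mulrC; exact: ltW.
    by rewrite ler_wpM2l// lerDr.
  pose A := [set w | `|((tauhat w)%:R - taus%:R) / n%:R| <= 256 / h ^+ 2 / n%:R * (a + c)].
  have mA : measurable A.
    exact: (measurable_nat_preimage tauhat
      [set t : nat | `|(t%:R - taus%:R) / n%:R| <= 256 / h ^+ 2 / n%:R * (a + c)]).
  apply: (exceptional_probability mA); apply: exceptional_imp H => [|w].
    by rewrite ler_wpM2r ?expR_ge0// ler_nat.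
  exact: scaled_radius.
(* The two summands are the coefficients of the two radii in [scan2_deviation]; the existential
   keeps [C] opaque. *)
have [C CE] : exists C, C = 64 / h ^+ 2 + 4000 / k ^+ 4 by eexists.
exists C => v0 v1 M x v01 M0 x0.
set D := `|v0 - v1|.
have D0 : 0 < D by rewrite normr_gt0 subr_eq0.
have hD : 0 < h ^+ 2 * D ^+ 4 by rewrite mulr_gt0// exprn_gt0.
(* The three thresholds ensure, in turn, that the statistics are defined, that the scalar noise is
   below its level, and that the inner products disturb neither [shat] nor the gap. *)
have [N1 HN1] := @archimedean_nat R k 2 k0.
have [N2 HN2] := @archimedean_nat R _ (1024 * x * M ^+ 8) hD.
have [N3 HN3] := @archimedean_nat R _ (384 * M ^+ 2 * x) (mulr_gt0 k0 D0).
exists (maxn N1 (maxn N2 N3)) => n; rewrite !geq_max => /andP[/HN1 nk /andP[/HN2 nh /HN3 nD]].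
move=> dispX X d F0 F1 y0 lambda psi dispO Omega P y tauhat kt phi n0 n1 taus
  d_neg _ d_exp cp kt_le mu_eq v0E v1E tmax.
have [x2|x2] := leP x 2^-1.
  apply: le_trans (measure_ge0 P _); rewrite lee_fin.
  by apply: expRN_half x2; rewrite ler_nat.
have [n01 n11] := margin_large h0 h0s hs1 nk.
have tn01 : (n0 <= taus <= n1)%N by exact: change_between.
have /andP[u1 u2] := tn01.
have tau_gt0 : (0 < taus)%N by rewrite (leq_trans _ u1)// ltnW.
have tau_lt : (taus < n)%N by rewrite (leq_ltn_trans u2)// (leq_trans n11)// leq_subr.
have n_gt0 : (0 < n)%N by exact: leq_ltn_trans tau_lt.
have kn t : (n0 <= t <= n1)%N -> k * n%:R <= t%:R /\ k * n%:R <= n%:R - t%:R.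
  exact: (margin_between h0 h0s hs1 n11).
subst v0 v1.
set a := M ^+ 4 * x / D ^+ 2; set c := M ^+ 2 * x / D.
have a0 : 0 <= a by rewrite divr_ge0 ?mulr_ge0 ?exprn_ge0 ?(ltW M0) ?(ltW x0) ?(ltW D0).
have c0 : 0 <= c by rewrite divr_ge0 ?mulr_ge0 ?exprn_ge0 ?(ltW M0) ?(ltW x0) ?(ltW D0).
have H : exceptional P (8 * expR (- x)) (fun w =>
    `|(tauhat w)%:R - taus%:R| <= C * (a + c) :> R).
  apply: exceptional_imp (@scan2_deviation R dispX dispO X Omega P d F0 F1 y0
    lambda psi M n taus y d_neg d_exp cp M0 kt_le tau_gt0 tau_lt mu_eq v01 k x n0 n1
    k0 k1 (ltW x2) tn01 n01 n11 kn nh nD) => // w /(_ _ (tmax w)).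
  move=> /le_trans; apply.
  rewrite [leLHS](_ : _ = 64 / h ^+ 2 * a + 4000 / k ^+ 4 * c); last first.
    rewrite -/h -/D /a /c; move: (h) (D) (k) kh D0 k0 => h' d' k' *.
    by field; rewrite !gt_eqF.
  rewrite CE; apply: add_mul_le a0 c0; first exact: divr_ge0 (ler0n R 64) (sqr_ge0 h).
  exact: divr_ge0 (ler0n R 4000) (exprn_ge0 4 (ltW k0)).
pose A := [set w | `|((tauhat w)%:R - taus%:R) / n%:R| <= C / n%:R * (a + c)].
have mA : measurable A.
  exact: (measurable_nat_preimage tauhat
    [set t : nat | `|(t%:R - taus%:R) / n%:R| <= C / n%:R * (a + c)]).
apply: (exceptional_probability mA); apply: exceptional_imp H => [|w].
  by rewrite ler_wpM2r ?expR_ge0// ler_nat.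
exact: scaled_radius.
Qed.
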